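(* Let $(\varphi_s)_s$ be a flow preserving an infinite ($\sigma$-finite) measure $\nu$ on a measurable space $\mathcal M$. Assume that $(\mathcal M,(\varphi_t)_t,\nu)$ is conservative and ergodic and satisfies the following functional law of large numbers, for some positive numbers $(\mathfrak a_\epsilon)_{\epsilon>0}$ and some continuous increasing process $(Z_t)_{t\ge0}$: for every $T>0$ and every $g\in L^1(\nu)$, $$\Big(\mathfrak a_\epsilon\int_0^{t/\epsilon}g\circ\varphi_s\,ds\Big)_{t\in[0,T]}\longrightarrow\int_{\mathcal M}g\,d\nu\;(Z_t)_{t\in[0,T]}\qquad(\epsilon\to0)$$ strongly in distribution with respect to $\nu$ for the uniform norm. Let $f:\mathbb R^d\times\mathcal M\to\mathbb R^d$ and $\overline f:\mathbb R^d\to\mathbb R^d$ be measurable, uniformly bounded and uniformly Lipschitz in their first coordinate $x\in\mathbb R^d$, with $f(x,\cdot)\in L^1(\nu)$ for every $x$. Assume that $f(\cdot,\omega)$ and $\overline f$ are twice differentiable with bounded derivatives (uniformly in $\omega$) up to order $2$, and that the Lipschitz constants $[f]$ and $[D_1f]$ of $f$ and $D_1f$ with respect to their first coordinate are $\nu$-integrable in $\omega\in\mathcal M$. Let $W_t(x)$ and $X^\epsilon_t(x,\omega)$ solve $$\frac{dW_t}{dt}(x)=\overline f(W_t(x)),\ W_0(x)=x;\qquad \frac{dX_t^\epsilon}{dt}(x,\omega)=f(X_t^\epsilon(x,\omega),\varphi_{t/\epsilon}(\omega))+\overline f(X_t^\epsilon(x,\omega)),\ X_0^\epsilon(x,\omega)=x.$$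 Then, for any $x\in\mathbb R^d$, the normalized error $$\Big(\frac{\mathfrak a_\epsilon}{\epsilon}E^\epsilon_t(x,\cdot):=\frac{\mathfrak a_\epsilon}{\epsilon}\big(X_t^\epsilon(x,\cdot)-W_t(x)\big)\Big)_{t\ge0}$$ converges, as $\epsilon\to0$, strongly in distribution with respect to $\nu$, for the local topology of $\mathcal C([0,+\infty))$, to the process $(\tilde Y_t(x))_{t}$ given by $$\tilde Y_t(x)=\tilde V_t(x)+\int_0^tD\overline f(W_s(x))\exp\left(\int_s^tD\overline f(W_u(x))\,du\right)\tilde V_s(x)\,ds,$$ with $$\tilde V_t(x)=\int_0^th(W_s(x))\,dZ_s,\qquad h(x):=\int_{\mathcal M}f(x,\cdot)\,d\nu.$$
   Context: Strong convergence in distribution with respect to $\nu$ means convergence in distribution with respect to every probability measure absolutely continuous with respect to $\nu$. Convergence for the local topology of $\mathcal C([0,+\infty))$ means that the restrictions to $[0,T]$ converge in $(\mathcal C([0,T]),\|\cdot\|_\infty)$ for every $T>0$. $D_1$ denotes the derivative in the first coordinate and $D\overline f$ the derivative of $\overline f$. The integral $\int_0^th(W_s(x))\,dZ_s$ is a Stieltjes integral.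
   Formalization: In the limit process, the exponential of the integral of D f̄(W_u) from s to t is the time-ordered exponential, applied after D f̄(W_s); the printed formula is false for d ≥ 2 when these matrices do not commute and agrees when they do, e.g. d = 1. *)

(* Defs.v *)
From HB Require Import structures.
From mathcomp Require Import all_boot all_order all_algebra.
From mathcomp Require Import all_classical all_reals all_analysis.

Set Implicit Arguments.
Unset Strict Implicit.
Unset Printing Implicit Defensive.

Import Order.TTheory GRing.Theory Num.Theory.
Import numFieldNormedType.Exports.

Local Open Scope classical_set_scope.
Local Open Scope ring_scope.

(* R^d with its Borel sigma-algebra; the carrier is 'rV[R]_d. *)
Definition borelRV (R : realType) (d : nat) : Type :=
  g_sigma_algebraType (@open 'rV[R]_d).
HB.instance Definition _ (R : realType) (d : nat) :=
  Measurable.on (borelRV R d).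

Section flow.
Context {R : realType} {dM : measure_display} {M : measurableType dM}.
Implicit Types (nu : {measure set M -> \bar R}) (phi : R -> M -> M).

Definition measurable_flow phi : Prop :=
  [/\ measurable_fun [set: R * M] (fun p => phi p.1 p.2),
      phi 0 = id & forall s t, phi (s + t) = phi s \o phi t].

Definition flow_preserves nu phi : Prop :=
  forall t A, measurable A -> nu (phi t @^-1` A) = nu A.

(* No time-t map, t > 0, has a wandering set of positive measure. *)
Definition conservative_flow nu phi : Prop :=
  forall t A, 0 < t -> measurable A ->
    trivIset [set: nat] (fun n => phi (t *+ n) @^-1` A) -> nu A = 0%E.

Definition ergodic_flow nu phi : Prop :=
  forall A, measurable A -> (forall t, phi t @^-1` A = A) ->
    nu A = 0%E \/ nu (~` A) = 0%E.

End flow.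

(* The functionals F are those on C([0, T]) with the uniform norm: functions
   on R are identified when they agree on [0, T] (uniform convergence on
   [0, T] does not separate them), and F is only required to be continuous
   at, and along, the functions that are continuous on [0, T]. *)
Definition cvg_in_distribution_C {R : realType} {V : normedModType R}
    {d1 d2 : measure_display}
    {O1 : measurableType d1} {O2 : measurableType d2} (T : R)
    (P : probability O1 R) (Y : R -> O1 -> R -> V)
    (Q : probability O2 R) (L : O2 -> R -> V) : Prop :=
  forall F : {uniform` `[0, T]%classic -> V} -> R,
    {within [set y : {uniform` `[0, T]%classic -> V} |
              {within `[0, T]%classic, continuous (y : R -> V)}],
      continuous F} ->
    (exists B, forall y, `|F y| <= B) ->
    \int[P]_w F (Y e w) @[e --> 0^'+] --> \int[Q]_w F (L w).

Definition strong_cvg_in_distribution_C {R : realType} {V : normedModType R}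
    {d1 d2 : measure_display}
    {O1 : measurableType d1} {O2 : measurableType d2} (T : R)
    (nu : {measure set O1 -> \bar R}) (Y : R -> O1 -> R -> V)
    (Q : probability O2 R) (L : O2 -> R -> V) : Prop :=
  forall P : probability O1 R, P `<< nu -> cvg_in_distribution_C T P Y Q L.

Definition mxint {R : realType} {dT : measure_display} {T : measurableType dT}
    {m n : nat} (mu : {measure set T -> \bar R}) (D : set T)
    (F : T -> 'M[R]_(m, n)) : 'M[R]_(m, n) :=
  \matrix_(i, j) \int[mu]_(t in D) F t i j.

Section stieltjes.
Context {R : realType}.
Implicit Type z : R -> R.

Definition increasing_path z : Prop :=
  {within `[0, +oo[%classic, continuous z} /\
  {in `[0, +oo[ &, {homo z : s t / s <= t}}.

(* Constant extension to negative times; the value 0 for the functions that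
   are not increasing_path only serves to make it total. *)
Definition path_ext z (t : R) : R :=
  if `[< increasing_path z >] then z (Num.max 0 t) else 0.

Lemma path_ext_continuous z : continuous (path_ext z).
Proof.
rewrite /path_ext; case: asboolP => [[zc _]|_]; last by move=> t; exact: cvg_cst.
move=> t; have max0 u : `[0, +oo[%classic (Num.max 0 u : R).
  by rewrite /= in_itv/= andbT le_max lexx.
have /subspace_continuousP /(_ _ (max0 t)) := zc.
apply: cvg_trans => A /= [e e0 eA].
have mc : {for t, continuous (fun u : R => Num.max 0 u)}.
  by apply: (@continuous_max _ _ (cst 0) id); [exact: cvg_cst|exact: cvg_id].
have : \forall u \near t, ball (Num.max 0 t) e (Num.max 0 u).
  by apply: mc; exact: nbhsx_ballx.
by apply: filterS => u /eA; apply; exact: max0.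
Qed.

Lemma path_ext_nondecreasing z : nondecreasing (path_ext z).
Proof.
rewrite /path_ext; case: asboolP => [[_ zi]|_] s t st //.
apply: zi; rewrite ?in_itv/= ?andbT ?le_max ?lexx//.
by have [t0|t0] := leP t 0; rewrite !ge_max ?lexx ?st ?(le_trans st t0)// (ltW t0) orbT.
Qed.

HB.instance Definition _ z := isCumulative.Build R _ R (path_ext z)
  (@path_ext_nondecreasing z) (right_continuousW (@path_ext_continuous z)).

(* \int_0^t H_s dz_s *)
Definition stieltjes_int {m n : nat} z (H : R -> 'M[R]_(m, n)) (t : R) :
    'M[R]_(m, n) :=
  mxint (lebesgue_stieltjes_measure (path_ext z)) `[0, t]%classic H.

End stieltjes.

(* Smallest Lipschitz constant; the pairs x = y contribute 0. *)
Definition lip_const {R : realType} {V W : normedModType R} (g : V -> W) :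
    \bar R :=
  ereal_sup [set (`|g p.1 - g p.2| / `|p.1 - p.2|)%:E | p in [set: V * V]].

Definition lipschitz_with {R : realType} {V W : normedModType R} (K : R)
    (g : V -> W) : Prop :=
  forall x y, `|g x - g y| <= K * `|x - y|.

(* 'J g x acts on row vectors from the right: 'd g x v = v *m 'J g x. *)
Definition twice_diff_bounded {R : realType} {d : nat} (K : R)
    (g : 'rV[R]_d -> 'rV[R]_d) : Prop :=
  forall x, [/\ differentiable g x, differentiable (jacobian g) x,
    `|'J g x| <= K & forall v, `|'d (jacobian g) x v| <= K * `|v|].

(* dy/dt = F y for t >= 0, y_0 = x *)
Definition solves_autonomous {R : realType} {d : nat}
    (F : 'rV[R]_d -> 'rV[R]_d) (x : 'rV[R]_d) (y : R -> 'rV[R]_d) : Prop :=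
  [/\ y 0 = x, {within `[0, +oo[%classic, continuous y} &
      forall t : R, 0 < t -> is_derive t 1 y (F (y t))].

(* dy/dt = F t y for t >= 0, y_0 = x, in the sense of Caratheodory: the right
   hand side is only measurable in t, so that y is absolutely continuous and
   the equation holds for almost every t. *)
Definition solves_caratheodory {R : realType} {d : nat}
    (F : R -> 'rV[R]_d -> 'rV[R]_d) (x : 'rV[R]_d) (y : R -> 'rV[R]_d) : Prop :=
  {within `[0, +oo[%classic, continuous y} /\
  forall t, 0 <= t ->
    y t = x + mxint lebesgue_measure `[0, t]%classic (fun s => F s (y s)).

Definition expmx {R : realType} {d : nat} (B : 'M[R]_d) : 'M[R]_d :=
  limn (series (fun n => (n`!%:R)^-1 *: B ^+ n)).

(* exp(int_s^t A_u du) = \sum_n (int_s^t A_u du)^n / n!, where the factors of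
   the powers are time-ordered, i.e.
     (int_s^t A_u du)^n / n! =
       int_(s <= u_1 <= .. <= u_n <= t) A_(u_1) *m .. *m A_(u_n).
   (The smallest time comes first since matrices act on row vectors.)  This is
   the usual exponential of the matrix int_s^t A_u du if the A_u commute, see
   ordered_expmx_comm, in particular if d = 1; in general it is the resolvent
   E of the linear equation dE/dt = E *m A_t, E_s = 1, whereas the exponential
   of the matrix int_s^t A_u du is not. *)
Section ordered_exponential.
Context {R : realType} {d : nat}.
Implicit Type A : R -> 'M[R]_d.

Fixpoint ordered_power A (s : R) (n : nat) (t : R) : 'M[R]_d :=
  if n is m.+1 then
    mxint lebesgue_measure `[s, t]%classic
      (fun u => ordered_power A s m u *m A u)
  else 1%:M.

Definition ordered_expmx A (s t : R) : 'M[R]_d :=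
  limn (series (fun n => ordered_power A s n t)).

End ordered_exponential.

#[local] Lemma cvg_sumR {R : realType} {T : Type} (F : set_system T) {FF : Filter F} (I : Type)
  (r : seq I) (f : I -> T -> R) (l : I -> R) :
  (forall i, f i x @[x --> F] --> l i) ->
  \sum_(i <- r) f i x @[x --> F] --> \sum_(i <- r) l i.
Proof.
move=> fl; elim: r => [|i r IH].
  by under eq_fun do rewrite big_nil; rewrite big_nil; exact: cvg_cst.
by under eq_fun do rewrite big_cons; rewrite big_cons; apply: cvgD.
Qed.

Section ordered_power_comm.
Context {R : realType} {d : nat} (A : R -> 'M[R]_d) (Ac : continuous A)
  (AC : forall u v, A u *m A v = A v *m A u) (s : R).
Notation mu := (@lebesgue_measure R).
Let B u := mxint mu `[s, u]%classic A.

Let Acij i j : continuous (fun u => A u i j).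
Proof.
move=> u; apply: (@continuous_comp _ _ _ A (fun N : 'M[R]_d => N i j)).
  exact: Ac.
exact: coord_continuous.
Qed.

Let itgA i j a b : mu.-integrable `[a, b]%classic (EFin \o (fun u => A u i j)).
Proof.
apply: continuous_compact_integrable; first exact: segment_compact.
by apply: continuous_subspaceT; exact: Acij.
Qed.

Let BA u v : B u *m A v = A v *m B u.
Proof.
apply/matrixP => i j; rewrite !mxE.
have E (c : 'I_d -> R) (G : 'I_d -> R -> R) :
   (forall k, mu.-integrable `[s, u]%classic (EFin \o G k)) ->
   \sum_k c k * (\int[mu]_(x in `[s, u]%classic) G k x) =
   \int[mu]_(x in `[s, u]%classic) \sum_k c k * G k x.
  move=> Gi; rewrite /Rintegral.
  have cGi k : mu.-integrable `[s, u]%classic (fun x => (c k * G k x)%:E).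
    by apply: (@integrableZl _ _ _ _ _ _ (c k) _ (Gi k)).
  under [in RHS]eq_integral do rewrite -sumEFin.
  rewrite integral_sum// -sum_fine; last first.
    by move=> k _; apply: integrable_fin_num => //; exact: cGi.
  apply: eq_bigr => k _.
  under [in RHS]eq_integral do rewrite EFinM.
  rewrite integralZl//; [|exact: Gi]; rewrite fineM//; apply: integrable_fin_num => //; exact: Gi.
under eq_bigr do rewrite mxE mulrC.
rewrite E; last by move=> k; exact: itgA.
under [RHS]eq_bigr do rewrite mxE.
rewrite E; last by move=> k; exact: itgA.
apply: eq_Rintegral => x _.
have /matrixP/(_ i j) := AC x v; rewrite !mxE => <-.
by apply: eq_bigr => k _; rewrite mulrC.
Qed.

Let B_derive u i j : s < u -> is_derive u 1 (fun v => B v i j) (A u i j).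
Proof.
move=> su.
have uu : u < u + 1 by rewrite ltrDl.
have [] := @continuous_FTC1_closed R (fun v => A v i j) s u _ uu (itgA i j s (u + 1)) su (@Acij i j u).
have -> : (fun v => B v i j) = (fun v => \int[mu]_(x in `[s, v]) A x i j)%R.
  by apply/funext => v; rewrite mxE.
move=> H1 H2; rewrite derive1E in H2.
by apply: DeriveDef.
Qed.

Let Bn_derive u n i j : s < u ->
  is_derive u 1 (fun v => (B v ^+ n) i j) ((B u ^+ n.-1 *m A u) i j *+ n).
Proof.
move=> su; elim: n i j => [|n IH] i j.
  rewrite mulr0n (_ : (fun v => _) = cst ((1 : 'M[R]_d) i j)); last by apply/funext.
  exact: is_derive_cst.
rewrite (_ : (fun v => _) = \sum_(k < d) ((fun v => B v i k) * (fun v => (B v ^+ n) k j))); last first.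
  apply/funext => v; rewrite exprS mxE fct_sumE; exact: eq_bigr.
have D k := @is_deriveM R R^o _ _ u 1 _ _ (B_derive i k su) (IH k j).
apply: is_derive_eq.
rewrite /= big_split/=.
have -> : \sum_(k < d) B u i k *: ((B u ^+ n.-1 *m A u) k j *+ n) = (B u ^+ n *m A u) i j *+ n.
  case: n {IH D} => [|n] /=; first by rewrite mulr0n big1// => k _; rewrite mulr0n scaler0.
  rewrite exprS -[B u * _]/(B u *m _) -mulmxA mxE -sumrMnl.
  by apply: eq_bigr => k _; rewrite /GRing.scale/= mulrnAr.
rewrite mulrSr; congr (_ + _).
have -> : B u ^+ n *m A u = A u *m B u ^+ n.
  elim: n {IH D} => [|n IH]; first by rewrite expr0 mul1mx mulmx1.
  by rewrite exprS -[B u * _]/(B u *m _) -mulmxA IH mulmxA BA mulmxA.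
by rewrite mxE; apply: eq_bigr => k _; rewrite /GRing.scale/= mulrC.
Qed.

Let B_cont i j u : s <= u -> {within `[s, u]%classic, continuous (fun v => B v i j)}.
Proof.
move=> su.
have -> : (fun v => B v i j) = (fun v => \int[mu]_(x in `[s, v]) A x i j)%R.
  by apply/funext => v; rewrite mxE.
apply: (parameterized_integral_continuous su); exact: itgA.
Qed.

Let Bn_cont n i j u : s <= u -> {within `[s, u]%classic, continuous (fun v => (B v ^+ n) i j)}.
Proof.
move=> su; elim: n i j => [|n IH] i j.
  by rewrite (_ : (fun v => _) = cst ((1 : 'M[R]_d) i j)); [move=> ?; exact: cvg_cst|apply/funext].
rewrite (_ : (fun v => _) = fun v => \sum_(k < d) (B v i k * (B v ^+ n) k j)); last first.
  by apply/funext => v; rewrite exprS mxE.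
move=> x; apply: cvg_sumR => k; apply: cvgM; [exact: B_cont|exact: IH].
Qed.

Lemma ordered_power_comm n u : s <= u ->
  ordered_power A s n u = (n`!%:R)^-1 *: B u ^+ n.
Proof.
elim: n u => [|n IH] u; first by rewrite /= fact0 invr1 scale1r expr0.
rewrite le_eqVlt => /predU1P[<-|su].
  have -> : B s = 0 by apply/matrixP => i j; rewrite !mxE set_itv1 Rintegral_set1.
  by rewrite exprS mul0r scaler0; apply/matrixP => i j; rewrite !mxE set_itv1 Rintegral_set1.
apply/matrixP => i j; rewrite /= [LHS]mxE.
pose c : R := (n.+1`!%:R)^-1.
have cE : (n`!%:R)^-1 = c *+ n.+1 :> R.
  have n0 : n.+1%:R != 0 :> R by rewrite pnatr_eq0.
  by rewrite /c factS natrM invfM -[RHS]mulr_natr mulrAC mulVf// mul1r.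
transitivity (\int[mu]_(x in `[s, u]%classic) (c * ((B x ^+ n *m A x) i j *+ n.+1))).
  apply: eq_Rintegral => x; rewrite inE/= in_itv/= => /andP[sx _].
  by rewrite IH// -scalemxAl mxE cE mulrnAl mulrnAr.
have FE : (\int[mu]_(x in `[s, u]) ((c * ((B x ^+ n *m A x) i j *+ n.+1))%:E))%E =
   ((c * (B u ^+ n.+1) i j)%:E - (c * (B s ^+ n.+1) i j)%:E)%E.
  apply: (@continuous_FTC2 R _ (fun v => c * (B v ^+ n.+1) i j) s u su).
  - move=> x; apply: cvgM; first exact: cvg_cst.
    apply: cvgMn.
    rewrite (_ : (fun v => _) = fun v => \sum_(k < d) ((B v ^+ n) i k * A v k j)); last first.
      by apply/funext => v; rewrite mxE.
    rewrite mxE; apply: cvg_sumR => k; apply: cvgM; first by exact: (@Bn_cont n i k u (ltW su)).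
    by apply: continuous_subspaceT; exact: Acij.
  - have C : {within `[s, u]%classic, continuous (fun v => c * (B v ^+ n.+1) i j)}.
      by move=> x; apply: cvgM; [exact: cvg_cst|exact: (@Bn_cont n.+1 i j u (ltW su))].
    have [_ ? ?] := (continuous_within_itvP _ su).1 C.
    split => // x; rewrite in_itv/= => /andP[sx _].
    have D := @Bn_derive x n.+1 i j sx.
    by apply: derivableM => //; exact: derivable_cst.
  - move=> x; rewrite in_itv/= => /andP[sx _].
    have D := @Bn_derive x n.+1 i j sx.
    rewrite derive1E deriveM//.
    by rewrite derive_cst scaler0 addr0 derive_val.
rewrite /Rintegral FE /= mxE.
have -> : B s = 0 by apply/matrixP => i' j'; rewrite !mxE set_itv1 Rintegral_set1.
by rewrite (exprS 0) mul0r [in X in _ - X]mxE mulr0 subr0.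
Qed.
End ordered_power_comm.

Lemma ordered_expmx_comm {R : realType} {d : nat} (A : R -> 'M[R]_d) (s t : R) :
  continuous A -> (forall u v, A u *m A v = A v *m A u) -> s <= t ->
  ordered_expmx A s t = expmx (mxint lebesgue_measure `[s, t]%classic A).
Proof.
move=> Ac AC st; rewrite /ordered_expmx /expmx.
by under eq_fun do rewrite ordered_power_comm//.
Qed.

(* Main.v *)
Require Import Defs.
From HB Require Import structures.
From mathcomp Require Import all_boot all_order all_algebra.
From mathcomp Require Import all_classical all_reals all_analysis.
From mathcomp Require Import measurable_realfun.
From mathcomp Require Import ring lra.

Set Implicit Arguments.
Unset Strict Implicit.
Unset Printing Implicit Defensive.

Import Order.TTheory GRing.Theory Num.Theory.
Import numFieldNormedType.Exports.

Local Open Scope classical_set_scope.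
Local Open Scope ring_scope.

(** Write S^e_t(g) for the occupation integral a_e int_0^(t/e) g o phi_s ds, and
    fix a bounded integrable g0 with integral 1.

    Subtracting the integral equations of X and W and multiplying by a_e / e, the
    normalized error y solves the linear equation
      y_t = V^e_t + int_0^t y_s A_s ds + r_t,
    where V^e_t = (a_e / e) int_0^t f(W_s, phi_(s/e)) ds, A_s is the Jacobian of
    fbar at W_s, and r collects f(X_s) - f(W_s) and the second order Taylor
    remainder of fbar.  Let M be the occupation integral at time T of an
    integrable g1 that dominates the Lipschitz constant of f and |f(W_s)|.  By
    Gronwall, |X - W| is at most a multiple of (e / a_e) M, whence |r| is at most
    a multiple of M min(1, (e / a_e) M) (error_expansion).  This tends to 0 in
    probability (quadratic_remainder_whp): M is tight, and either Z_T = 0 almost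
    surely, in which case M itself tends to 0, or e / a_e tends to 0.  Indeed the
    normalized indicator of a set of measure m has an occupation integral of at
    most a_e T / (e m), and m is as large as we like, while the limit does not
    depend on m (normalization_negligible).

    For the source term, freeze W at the points t_j of a mesh of [0, T].  The
    function f(W_(t_j)) - h(W_(t_j)) g0 has integral 0, so that its occupation
    integrals tend to 0 uniformly in time.  Up to an error of the order of the
    mesh size times M, V^e is thus the Riemann sum along the mesh of h(W) against
    the scalar path S^e(g0) (perturbation_riemann).  The same Riemann sum against
    Z approximates the Stieltjes integral of h(W) (stieltjes_mesh_approx).

    The formula of the theorem is the variation of constants for the linear
    equation y = v + int y A (volterra_solP), and its solution is Lipschitz in v.
    Hence y is close in probability to Psi_n(S^e(g0)), where Psi_n is a Lipschitz
    map on paths, S^e(g0) converges in distribution to Z, and Psi_n(Z) tends to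
    the limit process as the mesh is refined (converging_together).  Convergence
    in distribution is tested on Lipschitz functionals (portmanteau_lip).  Those of
    X may fail to be measurable in w, and enter only through the monotonicity of
    the integral. *)

(** * Continuous paths and functionals of paths *)

Section paths.
Context {R : realType}.

Definition cont_path {V : normedModType R} (T : R) (y : R -> V) : Prop :=
  {within `[0, T]%classic, continuous y}.

Definition unif_le {V : normedModType R} (T c : R) (y z : R -> V) : Prop :=
  forall t, 0 <= t <= T -> `|y t - z t| <= c.

(** Any bound c of the uniform distance is allowed, so that the distance itself,
    a supremum, need not be formed. *)
Definition lip_functional {V : normedModType R} (T k : R) (F : (R -> V) -> R) :
    Prop :=
  forall y z c, 0 <= c -> cont_path T y -> cont_path T z -> unif_le T c y z ->
  `|F y - F z| <= k * c.

Definition bounded_functional {V : Type} (B : R) (F : (R -> V) -> R) : Prop :=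
  forall y, `|F y| <= B.

(** Only continuous paths are compared, and their uniform neighbourhoods are
    given by the balls of the uniform distance on [0, T]. *)
Lemma functional_continuousP {V : normedModType R} (T : R)
    (F : (R -> V) -> R) :
  {within [set y : {uniform` `[0, T]%classic -> V} | cont_path T (y : R -> V)],
    continuous (F : {uniform` `[0, T]%classic -> V} -> R)} <->
  forall y, cont_path T y -> forall e, 0 < e -> exists2 c, 0 < c &
    forall z, cont_path T z -> unif_le T c y z -> `|F y - F z| < e.
Proof.
split=> [/subspace_continuousP cF y yc e e0|H].
  have /cvgrPdist_lt /(_ e e0) /= := cF y yc.
  rewrite /within/= => /uniform_nbhs [E [entE sub]].
  have : nbhs (0 : V) [set v | `|v| < 1] by apply: nbhs0_lt.
  move: entE; rewrite -entourage_ballE => -[c /= c0 cE].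
  exists (c / 2); first by rewrite divr_gt0.
  move=> z zc yz; apply: sub => //= t tT; apply: cE => /=.
  rewrite -ball_normE /ball_/=; apply: le_lt_trans (yz t tT) _.
  by rewrite ltr_pdivrMr// ltr_pMr// ltr1n.
apply/subspace_continuousP => y /= yc; apply/cvgrPdist_lt => e e0.
have [c c0 hc] := H y yc e e0.
rewrite /within/=; apply/uniform_nbhs; exists [set xy | ball xy.1 c xy.2].
split; first by apply: (@entourage_ball _ _ (PosNum c0)).
move=> z /= yz zc; apply: hc => // t tT; have := yz t tT.
by rewrite -ball_normE /ball_/= => /ltW.
Qed.

Lemma lip_functional_continuous {V : normedModType R} (T k : R)
    (F : (R -> V) -> R) : lip_functional T k F ->
  {within [set y : {uniform` `[0, T]%classic -> V} | cont_path T (y : R -> V)],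
    continuous (F : {uniform` `[0, T]%classic -> V} -> R)}.
Proof.
move=> FL; apply/functional_continuousP => y yc e e0.
have k1 : 0 < `|k| + 1 by rewrite ltr_wpDl.
have c0 : 0 < e / (`|k| + 1) by rewrite divr_gt0.
exists (e / (`|k| + 1)) => // z zc /(FL _ _ _ (ltW c0) yc zc) /le_lt_trans; apply.
rewrite mulrA ltr_pdivrMr// mulrC ltr_pM2l//.
by rewrite (le_lt_trans (ler_norm k))// ltrDl.
Qed.

End paths.

(** * Integrals of bounded functions *)

Section bounded_integrals.
Context {d : measure_display} {T : measurableType d} {R : realType}.

Lemma bounded_integrable (mu : {measure set T -> \bar R}) (D : set T) (B : R)
    (f : T -> R) : measurable D -> (mu D < +oo)%E -> measurable_fun D f ->
  (forall x, D x -> `|f x| <= B) -> mu.-integrable D (EFin \o f).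
Proof.
move=> mD Dfin mf fB; apply: measurable_bounded_integrable => //.
by exists B; split; [exact: num_real|move=> M /ltW BM x /= Dx; exact: le_trans (fB _ Dx) BM].
Qed.

(** The integral of a nonnegative function is the supremum of the integrals of
    the simple functions below it, so it is monotone without measurability. *)
Lemma ge0_le_integral_outer (mu : {measure set T -> \bar R}) (f g : T -> \bar R) :
  (forall x, (0 <= f x)%E) -> (forall x, (f x <= g x)%E) ->
  (\int[mu]_x f x <= \int[mu]_x g x)%E.
Proof.
move=> f0 fg; have g0 x : (0 <= g x)%E by exact: le_trans (f0 x) (fg x).
rewrite !ge0_integralTE//; apply: ereal_sup_le => _ /= [h hf <-].
by exists h => // x; exact: le_trans (hf x) (fg x).
Qed.

Lemma prob_setT (P : probability T R) :
  (P : {measure set T -> \bar R}) [set: T] = 1%E.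
Proof. exact: probability_setT. Qed.

Lemma bounded_integral_fin (P : probability T R) (B : R) (f : T -> \bar R) :
  (forall x, (0 <= f x <= B%:E)%E) -> (\int[P]_x f x)%E \is a fin_num.
Proof.
move=> fB; have f0 x : (0 <= f x)%E by have /andP[] := fB x.
rewrite ge0_fin_numE ?integral_ge0//.
apply: (@le_lt_trans _ _ (\int[P]_x B%:E)%E).
  by apply: ge0_le_integral_outer => // x; have /andP[] := fB x.
by rewrite integral_cst// prob_setT mule1 ltry.
Qed.

Variable P : probability T R.

Lemma funepos_EFin (f : T -> R) x :
  ((EFin \o f)^\+ x)%E = (Num.max (f x) 0)%:E.
Proof. by rewrite funeposE/= EFin_max. Qed.

Lemma funeneg_EFin (f : T -> R) x :
  ((EFin \o f)^\- x)%E = (Num.max (- f x) 0)%:E.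
Proof. by rewrite funenegE/= EFin_max. Qed.

Lemma bounded_funepos_fin (B : R) (f : T -> R) : (forall x, `|f x| <= B) ->
  ((\int[P]_x ((EFin \o f)^\+ x))%E \is a fin_num) &&
  ((\int[P]_x ((EFin \o f)^\- x))%E \is a fin_num).
Proof.
move=> fB.
apply/andP; split; apply: (@bounded_integral_fin P B) => x;
  have B0 : 0 <= B := le_trans (normr_ge0 _) (fB x);
  rewrite ?funepos_EFin ?funeneg_EFin !lee_fin ge_max le_max lexx orbT
  B0 andbT/=; have := fB x; rewrite ler_norml => /andP[]; lra.
Qed.

(** Functionals of a path that depends on w in an unknown way may fail to be
    measurable; their integrals are compared by monotonicity alone. *)
Lemma le_Rintegral_outer (B : R) (f g : T -> R) :
  (forall x, `|f x| <= B) -> (forall x, `|g x| <= B) -> (forall x, f x <= g x) ->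
  \int[P]_x f x <= \int[P]_x g x.
Proof.
move=> fB gB fg; have /andP[f1 f2] := bounded_funepos_fin fB.
have /andP[g1 g2] := bounded_funepos_fin gB.
have E (h : T -> R) : (\int[P]_x (h x)%:E =
  \int[P]_x (EFin \o h)^\+ x - \int[P]_x (EFin \o h)^\- x)%E := integralE _ _ _.
have fin (h : T -> R) : (\int[P]_x (EFin \o h)^\+ x)%E \is a fin_num ->
    (\int[P]_x (EFin \o h)^\- x)%E \is a fin_num ->
    (\int[P]_x (h x)%:E)%E \is a fin_num.
  by move=> h1 h2; rewrite E; move: h1 h2; case: integral => //; case: integral.
apply: fine_le; [exact: fin|exact: fin|rewrite !E].
apply: leeB; apply: ge0_le_integral_outer => // x.
  by rewrite !funepos_EFin lee_fin ge_max !le_max fg lexx orbT.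
by rewrite !funeneg_EFin lee_fin ge_max !le_max lerN2 fg lexx orbT.
Qed.

Lemma RintegralN_outer (B : R) (f : T -> R) : (forall x, `|f x| <= B) ->
  \int[P]_x (- f x) = - \int[P]_x f x.
Proof.
move=> fB; have /andP[f1 f2] := bounded_funepos_fin fB.
rewrite /Rintegral; under eq_integral do rewrite EFinN.
rewrite integralN ?fineN//.
by rewrite fin_num_adde_defl// fin_numN.
Qed.

Lemma prob_integrable (B : R) (f : T -> R) : measurable_fun setT f ->
  (forall x, `|f x| <= B) -> P.-integrable setT (EFin \o f).
Proof.
by move=> mf fB; apply: (@bounded_integrable _ _ B) => //; rewrite prob_setT ltry.
Qed.

Lemma Rintegral_bounded_cvg (B : R) (f_ : nat -> T -> R) (f : T -> R) :
  (forall n, measurable_fun setT (f_ n)) -> (forall n x, `|f_ n x| <= B) ->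
  (forall x, f_ n x @[n --> \oo] --> f x) ->
  measurable_fun setT f /\ \int[P]_x f_ n x @[n --> \oo] --> \int[P]_x f x.
Proof.
move=> mf fB ff; have mF : measurable_fun setT f.
  by apply: (measurable_fun_cvg mf) => x _; exact: ff.
split=> //.
have FB x : `|f x| <= B.
  rewrite leNgt; apply/negP => Bf.
  have [N _ /(_ N (leqnn N))/=] := cvgr_gt _ (cvg_norm (ff x)) _ Bf.
  by rewrite ltNge fB.
have [|||_ _ H] := @dominated_convergence _ T R P setT measurableT
  (fun n => EFin \o f_ n) (EFin \o f) (cst B%:E)
  (fun n => (measurable_EFinP _ _).2 (mf n)) ((measurable_EFinP _ _).2 mF).
- apply: aeW => x _; apply/fine_cvgP; split; [exact: nearW|exact: ff].
- exact: (@prob_integrable `|B| (cst B)).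
- by apply: aeW => x n _; rewrite lee_fin.
apply: fine_cvg; rewrite fineK; first exact: H.
by apply: integrable_fin_num => //; exact: (prob_integrable mF FB).
Qed.

(** f lies between g - u and g + u, where u = c + 2 B 1_N is measurable, and
    the monotonicity of the integral handles f itself. *)
Lemma Rintegral_close (B c : R) (f g : T -> R) (N : set T) : 0 <= c ->
  (forall x, `|f x| <= B) -> (forall x, `|g x| <= B) ->
  measurable_fun setT g -> measurable N ->
  (forall x, ~ N x -> `|f x - g x| <= c) ->
  `|\int[P]_x f x - \int[P]_x g x| <= c + 2 * B * fine (P N).
Proof.
move=> c0 fB gB mg mN fg.
have [[x0 _]|T0] := pselect (exists x : T, True); last first.
  have E (h : T -> R) : \int[P]_x h x = 0.
    have -> : [set: T] = set0 by apply/seteqP; split => // x; exfalso; apply: T0; exists x.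
    exact: Rintegral_set0.
  have -> : N = set0 by apply/seteqP; split => // x; exfalso; apply: T0; exists x.
  by rewrite !E subr0 normr0 measure0 /= mulr0 addr0.
have B0 : 0 <= B := le_trans (normr_ge0 _) (fB x0).
have key (h : T -> R) : measurable_fun setT h -> (forall x, `|h x| <= B) ->
    (forall x, f x <= h x + (c + 2 * B * \1_N x)) /\
    (forall x, h x - (c + 2 * B * \1_N x) <= f x) ->
    `|\int[P]_x f x - \int[P]_x h x| <= c + 2 * B * fine (P N).
  move=> mh hB [up lo].
  have mI : measurable_fun setT (\1_N : T -> R) by exact: measurable_indic.
  have I1 x : 0 <= (\1_N x : R) <= 1.
    by rewrite indicE; case: (_ \in _) => /=; rewrite ?lexx ?ler01.
  have mu_ : measurable_fun setT (fun x => c + 2 * B * \1_N x : R).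
    by apply: measurable_funD => //; apply: measurable_funM.
  have uB x : `|c + 2 * B * \1_N x| <= c + 2 * B.
    have /andP[I0 I1'] := I1 x.
    by rewrite ger0_norm ?addr_ge0 ?mulr_ge0 ?ler0n// lerD2l ler_piMr ?mulr_ge0.
  have iu := prob_integrable mu_ uB.
  have ih := prob_integrable mh hB.
  have Iu : \int[P]_x (c + 2 * B * \1_N x) = c + 2 * B * fine (P N).
    have iN : P.-integrable setT (EFin \o (\1_N : T -> R)).
      apply: (@prob_integrable 1) => // x; have /andP[? ?] := I1 x; by rewrite ger0_norm.
    rewrite RintegralD//; last 2 first.
    - by apply: (@prob_integrable `|c|).
    - by apply: (@prob_integrable (2 * B)) => [|x];
        [exact: measurable_funM|have /andP[? ?] := I1 x;
         rewrite ger0_norm ?mulr_ge0// ler_piMr ?mulr_ge0].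
    rewrite RintegralZl// Rintegral_cst// prob_setT mulr1.
    by rewrite /Rintegral integral_indic// setIT.
  have bnd (s : R) x : `|s| <= 1 -> `|h x + s * (c + 2 * B * \1_N x)| <= c + 3 * B.
    move=> s1; apply: le_trans (ler_normD _ _) _.
    rewrite normrM; have : `|s| * `|c + 2 * B * \1_N x| <= c + 2 * B.
      by rewrite -[leRHS]mul1r ler_pM.
    by have := hB x; lra.
  have fB' x : `|f x| <= c + 3 * B by apply: le_trans (fB x) _; lra.
  rewrite ler_norml; apply/andP; split.
    have := @le_Rintegral_outer (c + 3 * B) (fun x => h x - (c + 2 * B * \1_N x)) f _ fB' lo.
    rewrite RintegralB// Iu => H; rewrite lerBrDl; apply: H => x.
    have := @bnd (-1) x; rewrite mulN1r; apply; by rewrite normrN1.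
  have := @le_Rintegral_outer (c + 3 * B) f (fun x => h x + (c + 2 * B * \1_N x)) fB' _ up.
  rewrite RintegralD// Iu => H; rewrite lerBlDl; apply: H => x.
  have := @bnd 1 x; rewrite mul1r; apply; by rewrite normr1.
apply: key => //; split => x.
  rewrite indicE; case: (boolP (x \in N)) => [_|].
    rewrite mulr1; have := fB x; have := gB x; rewrite !ler_norml => /andP[? ?] /andP[? ?]; lra.
  rewrite notin_setE => /fg; rewrite ler_norml => /andP[? ?] /=; lra.
rewrite indicE; case: (boolP (x \in N)) => [_|].
  rewrite mulr1; have := fB x; have := gB x; rewrite !ler_norml => /andP[? ?] /andP[? ?]; lra.
rewrite notin_setE => /fg; rewrite ler_norml => /andP[? ?] /=; lra.
Qed.

End bounded_integrals.

(** * Convergence in distribution from Lipschitz functionals *)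

Section inf_convolution.
Context {R : realType} {V : normedModType R}.
Variables (T B : R) (F : (R -> V) -> R).
Hypothesis FB : bounded_functional B F.

(** The Lipschitz regularization inf_z (F z + k d(y, z)) of F, where d is the
    uniform distance on [0, T]; every bound c of d(y, z) stands for it.  The value
    B makes the set nonempty for every path y. *)
Definition inf_conv (k : R) (y : R -> V) : R :=
  inf [set v | v = B \/ exists z c,
    [/\ cont_path T z, 0 <= c, unif_le T c y z & v = F z + k * c]].

Let lb (k : R) : 0 <= k -> forall y, lbound [set v | v = B \/ exists z c,
    [/\ cont_path T z, 0 <= c, unif_le T c y z & v = F z + k * c]] (- B).
Proof.
move=> k0 y v [->|[z [c [_ c0 _ ->]]]].
  by have := FB (cst 0); rewrite ler_norml => /andP[? ?]; lra.
by have := FB z; rewrite ler_norml => /andP[+ _]; have := mulr_ge0 k0 c0; lra.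
Qed.

Lemma inf_conv_bounded k : 0 <= k -> bounded_functional B (inf_conv k).
Proof.
move=> k0 y; rewrite ler_norml; apply/andP; split.
  by apply: lb_le_inf; [exists B; left|exact: lb].
by apply: ge_inf; [exists (- B); exact: lb|left].
Qed.

Lemma inf_conv_le k y : 0 <= k -> cont_path T y -> inf_conv k y <= F y.
Proof.
move=> k0 yc; apply: ge_inf; first by exists (- B); exact: lb.
right; exists y, 0; split => //; last by rewrite mulr0 addr0.
by move=> t _; rewrite subrr normr0.
Qed.

Lemma inf_conv_lip k : 0 <= k -> lip_functional T k (inf_conv k).
Proof.
move=> k0.
have half y z c : cont_path T y -> cont_path T z -> unif_le T c y z ->
    0 <= c -> inf_conv k y <= inf_conv k z + k * c.
  move=> yc zc yz c0; rewrite -lerBlDr.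
  apply: lb_le_inf; first by exists B; left.
  move=> v [->|[u [c' [uc c'0 zu ->]]]]; rewrite lerBlDr.
    have /(_ y) := inf_conv_bounded k0; rewrite ler_norml => /andP[_ ].
    by have := mulr_ge0 k0 c0; lra.
  apply: ge_inf; first by exists (- B); exact: lb.
  right; exists u, (c + c'); split => //; first by rewrite addr_ge0.
    move=> t tT; rewrite (le_trans _ (lerD (yz t tT) (zu t tT)))//.
    by rewrite (le_trans _ (ler_normD _ _))// addrA subrK.
  by rewrite mulrDr -addrA (addrC (k * c')).
move=> y z c c0 yc zc yz; rewrite ler_norml; apply/andP; split.
  rewrite lerBrDl lerBlDr; apply: half => // t tT; rewrite distrC; exact: yz.
by rewrite lerBlDl; exact: half.
Qed.

(** Close to y, the values of F exceed F y - e by continuity; far from y, the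
    penalty k d(y, z) exceeds the oscillation 2 B of F once k is large. *)
Lemma inf_conv_ge y e : cont_path T y -> 0 < e ->
  {within [set y : {uniform` `[0, T]%classic -> V} | cont_path T (y : R -> V)],
    continuous (F : {uniform` `[0, T]%classic -> V} -> R)} ->
  \forall k \near +oo, F y - e <= inf_conv k y.
Proof.
move=> yc e0 /functional_continuousP /(_ y yc e e0)[c c0 Fc].
near=> k; have k0 : 0 < k by near: k; exact: nbhs_pinfty_gt.
apply: lb_le_inf; first by exists B; left.
have FBy x : - B <= F x <= B by rewrite -ler_norml.
move=> v [->|[z [c' [zc c'0 yz ->]]]].
  by have /andP[_ ] := FBy y; lra.
have [cc|cc] := leP c' c.
  have : `|F y - F z| < e by apply: Fc => // t tT; exact: le_trans (yz t tT) cc.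
  by rewrite ltr_norml => /andP[_ ?]; have := mulr_ge0 (ltW k0) c'0; lra.
have : 2 * B <= k * c'.
  apply: (@le_trans _ _ (k * c)); last by rewrite ler_pM2l// ltW.
  rewrite -ler_pdivrMr//; near: k; exact: nbhs_pinfty_ge.
by have /andP[? ?] := FBy y; have /andP[? ?] := FBy z; lra.
Unshelve. all: by end_near.
Qed.

End inf_convolution.

Section portmanteau.
Context {R : realType} {V : normedModType R} {d1 d2 : measure_display}
  {O1 : measurableType d1} {O2 : measurableType d2}.
Variables (T : R) (P : probability O1 R) (Y : R -> O1 -> R -> V)
  (Q : probability O2 R) (L : O2 -> R -> V).
Hypothesis Yc : forall (e : R) w, 0 < e -> cont_path T (Y e w).
Hypothesis Lc : forall w, cont_path T (L w).

(** A bounded continuous functional is the limit from below of its Lipschitz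
    regularizations, and dominated convergence applies to their integrals with
    respect to the limit law.  Along Y only F >= inf_conv k F is used, which
    passes to the integrals by monotonicity. *)
Lemma portmanteau_lip :
  (forall (k B : R) F, 0 <= k -> lip_functional T k F -> bounded_functional B F ->
    measurable_fun [set: O2] (fun w => F (L w)) /\
    \int[P]_w F (Y e w) @[e --> 0^'+] --> \int[Q]_w F (L w)) ->
  cvg_in_distribution_C T P Y Q L.
Proof.
move=> lip.
(* A lower bound for all functionals is enough, the upper bound being the lower
   one for - F. *)
have low (F : (R -> V) -> R) B : bounded_functional B F ->
    {within [set y : {uniform` `[0, T]%classic -> V} | cont_path T (y : R -> V)],
      continuous (F : {uniform` `[0, T]%classic -> V} -> R)} ->
    forall e, 0 < e -> \forall t \near 0^'+,
      \int[Q]_w F (L w) - e < \int[P]_w F (Y t w).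
  move=> FB Fc e e0.
  pose G (k : nat) := inf_conv T B F k%:R.
  have GB (k : nat) y : `|G k y| <= B by exact: inf_conv_bounded.
  have GL (k : nat) := @inf_conv_lip _ _ T B F FB k%:R (ler0n R k).
  have /= [mG Gcvg] := all_and2 (fun k => lip _ _ _ (ler0n R k) (GL k) (GB k)).
  have [_ GF] : measurable_fun setT (fun w => F (L w)) /\
      \int[Q]_w G k (L w) @[k --> \oo] --> \int[Q]_w F (L w).
    apply: (@Rintegral_bounded_cvg _ _ _ Q B) => // w.
    apply/cvgrPdist_le => c c0; near=> k.
    have le1 : G k (L w) <= F (L w) by exact: inf_conv_le.
    have le2 : F (L w) - c <= G k (L w).
      near: k; have := @inf_conv_ge _ _ T B F FB (L w) c (@Lc w) c0 Fc.
      by move=> H; have := @cvgr_idn R _ H; rewrite /= /nbhs/=.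
    by rewrite ger0_norm ?subr_ge0//; lra.
  have e2 : \int[Q]_w F (L w) - e < \int[Q]_w F (L w) by lra.
  have [k _ /(_ k (leqnn k))/= kE] := cvgr_gt _ GF _ e2.
  near=> t; apply: (@lt_le_trans _ _ (\int[P]_w G k (Y t w))).
    by near: t; exact: (cvgr_gt _ (Gcvg k) _ kE).
  have t0 : 0 < t by near: t; exact: nbhs_right_gt.
  apply: (@le_Rintegral_outer _ _ _ P B) => // w.
  by apply: inf_conv_le => //; exact: Yc.
move=> F Fc [B FB]; apply/cvgrPdist_lt => e e0.
have FNB : bounded_functional B (fun y => - F y) by move=> y; rewrite normrN.
have FNc : {within [set y : {uniform` `[0, T]%classic -> V} | cont_path T (y : R -> V)],
      continuous ((fun y => - F y) : {uniform` `[0, T]%classic -> V} -> R)}.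
  by move=> y; apply: cvgN; exact: Fc.
near=> t.
have H1 : \int[Q]_w F (L w) - e < \int[P]_w F (Y t w).
  by near: t; exact: (low F B FB Fc).
have H2 : \int[Q]_w (- F (L w)) - e < \int[P]_w (- F (Y t w)).
  by near: t; exact: (low _ B FNB FNc).
move: H2; rewrite !(@RintegralN_outer _ _ _ _ B)// => H2.
by rewrite ltr_norml; apply/andP; split; lra.
Unshelve. all: by end_near.
Qed.

End portmanteau.

(** * Approximation of both sides of a limit in distribution *)

Section converging_together.
Context {R : realType} {V : normedModType R} {d1 d2 : measure_display}
  {O1 : measurableType d1} {O2 : measurableType d2}.
Variables (T : R) (P : probability O1 R) (S : R -> O1 -> R -> R)
  (Y : R -> O1 -> R -> V) (Q : probability O2 R) (Z : O2 -> R -> R)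
  (L : O2 -> R -> V) (Psi : nat -> (R -> R) -> R -> V) (C : nat -> R).
Hypothesis Sc : forall (e : R) w, 0 < e -> cont_path T (S e w).
Hypothesis Yc : forall (e : R) w, 0 < e -> cont_path T (Y e w).
Hypothesis Zc : forall w, cont_path T (Z w).
Hypothesis Lc : forall w, cont_path T (L w).
Hypothesis SZ : cvg_in_distribution_C T P S Q Z.
Hypothesis mS : forall (k e : R) (F : (R -> R) -> R), 0 < e -> 0 <= k ->
  lip_functional T k F -> measurable_fun [set: O1] (fun w => F (S e w)).
Hypothesis mZ : forall (k : R) (F : (R -> R) -> R), 0 <= k ->
  lip_functional T k F -> measurable_fun [set: O2] (fun w => F (Z w)).
Hypothesis C0 : forall n, 0 <= C n.
Hypothesis Psic : forall n (y : R -> R), cont_path T y -> cont_path T (Psi n y).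
Hypothesis Psi_lip : forall n (y z : R -> R) (c : R), 0 <= c -> cont_path T y -> cont_path T z ->
  unif_le T c y z -> unif_le T (C n * c) (Psi n y) (Psi n z).
Hypothesis PsiZ : forall w (c : R), 0 < c ->
  \forall n \near \oo, unif_le T c (Psi n (Z w)) (L w).
Hypothesis PsiS : forall c eta : R, 0 < c -> 0 < eta ->
  \forall n \near \oo, \forall e \near 0^'+, exists2 N,
    measurable N /\ (P N <= eta%:E)%E &
    forall w, ~ N w -> unif_le T c (Y e w) (Psi n (S e w)).

(** On Lipschitz functionals F, three errors add up: Y is close to Psi n S off a
    set of small probability, F (Psi n S) converges in distribution as F o Psi n
    is again Lipschitz, and Psi n Z tends to L pointwise. *)
Lemma converging_together : cvg_in_distribution_C T P Y Q L.
Proof.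
apply: portmanteau_lip => // k B F k0 Fk FB.
have Hlip n : lip_functional T (k * C n) (F \o Psi n).
  move=> y z c c0 yc zc yz; rewrite -mulrA; apply: Fk; rewrite ?mulr_ge0//.
  - exact: Psic.
  - exact: Psic.
  - exact: Psi_lip.
have kC n : 0 <= k * C n by rewrite mulr_ge0.
have [mFL HL] : measurable_fun setT (fun w => F (L w)) /\
    \int[Q]_w F (Psi n (Z w)) @[n --> \oo] --> \int[Q]_w F (L w).
  apply: (@Rintegral_bounded_cvg _ _ _ Q B) => // [n|w].
    exact: (mZ (kC n) (Hlip n)).
  apply/cvgrPdist_le => e e0; have k1 : 0 < k + 1 by lra.
  have ck : 0 < e / (k + 1) by rewrite divr_gt0.
  near=> n.
  rewrite distrC; apply: (@le_trans _ _ (k * (e / (k + 1)))).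
    apply: Fk => //; [exact: ltW|exact/Psic/Zc|near: n; exact: (@PsiZ w _ ck)].
  rewrite mulrA ler_pdivrMr// mulrC ler_pM2l//; lra.
split=> //; apply/cvgrPdist_lt => e e0.
have B0 : 0 <= B := le_trans (normr_ge0 _) (FB (cst 0)).
(* Adding 1 to k and to B avoids dividing by zero. *)
pose c := e / 8 / (k + 1); pose eta := e / 8 / (B + 1).
have c0 : 0 < c by rewrite !divr_gt0//; lra.
have eta0 : 0 < eta by rewrite !divr_gt0//; lra.
have [n [Hn1 Hn2]] : exists n, `|\int[Q]_w F (L w) - \int[Q]_w F (Psi n (Z w))| < e / 4
  /\ \forall t \near 0^'+, exists2 N, measurable N /\ (P N <= eta%:E)%E &
    forall w, ~ N w -> unif_le T c (Y t w) (Psi n (S t w)).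
  have A : \forall n \near \oo,
      `|\int[Q]_w F (L w) - \int[Q]_w F (Psi n (Z w))| < e / 4.
    by move/cvgrPdist_lt : HL; apply; rewrite divr_gt0.
  have [n [? ?]] := filter_ex (filterI A (PsiS c0 eta0)).
  by exists n.
have Hn3 := SZ (lip_functional_continuous (Hlip n)) (ex_intro _ B (fun y => FB _)).
near=> t.
have t0 : 0 < t by near: t; exact: nbhs_right_gt.
have H3 : `|\int[Q]_w F (Psi n (Z w)) - \int[P]_w F (Psi n (S t w))| < e / 4.
  by near: t; move/cvgrPdist_lt : Hn3; apply; rewrite divr_gt0.
have [N [mN PN] YN] : exists2 N, measurable N /\ (P N <= eta%:E)%E &
    forall w, ~ N w -> unif_le T c (Y t w) (Psi n (S t w)) by near: t.
have H4 : `|\int[P]_w F (Y t w) - \int[P]_w F (Psi n (S t w))| <=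
    k * c + 2 * B * fine (P N).
  apply: Rintegral_close => //; first by rewrite mulr_ge0// ltW.
    exact: (mS t0 (kC n) (Hlip n)).
  move=> w /YN wN; apply: Fk => //; [exact: ltW|exact: Yc|exact/Psic/Sc].
have H5 : fine (P N) <= eta.
  rewrite -lee_fin fineK// ge0_fin_numE//.
  exact: le_lt_trans PN (ltry _).
have H6 : k * c <= e / 8.
  rewrite /c mulrCA ler_piMr//; first by lra.
  by rewrite ler_pdivrMr; lra.
have H7 : 2 * B * fine (P N) <= e / 4.
  apply: (@le_trans _ _ (2 * (B * eta))).
    by rewrite -mulrA ler_pM2l ?ltr0n// ler_wpM2l.
  have : B * eta <= e / 8.
    rewrite /eta mulrCA ler_piMr//; first by lra.
    by rewrite ler_pdivrMr; lra.
  by lra.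
move: Hn1 H3 H4; rewrite !ltr_norml !ler_norml => /andP[? ?] /andP[? ?] /andP[? ?].
by apply/andP; split; lra.
Unshelve. all: by end_near.
Qed.

End converging_together.

(** * Meshes, and measurability of functionals of paths *)

Section path_measurability.
Context {R : realType}.

Definition grid (T : R) (n : nat) (j : nat) : R := T * (j%:R / n.+1%:R).

Definition grid_index (T : R) (n : nat) (t : R) : nat :=
  Num.trunc (t / T * n.+1%:R).

Lemma grid_index_bounds (T : R) n t : 0 < T -> 0 <= t <= T ->
  [/\ (grid_index T n t <= n.+1)%N, grid T n (grid_index T n t) <= t &
      t <= grid T n (grid_index T n t) + T / n.+1%:R].
Proof.
move=> T0 /andP[t0 tT]; have n0 : 0 < n.+1%:R :> R by [].
have x0 : 0 <= t / T * n.+1%:R by rewrite mulr_ge0 ?divr_ge0// ltW.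
have /andP[lo up] := truncn_itv x0.
have tE : t = T * (t / T * n.+1%:R / n.+1%:R) by field; rewrite !gt_eqF.
split.
- rewrite -ltnS truncn_lt_nat// (@le_lt_trans _ _ n.+1%:R) ?ltr_nat//.
  by rewrite -[leRHS]mul1r ler_pM2r// ler_pdivrMr// mul1r.
- by rewrite [leRHS]tE /grid ler_pM2l// ler_pM2r ?invr_gt0.
- rewrite [leLHS]tE /grid -mulrDr -[X in _ + X]mul1r -mulrDl.
  by rewrite ler_pM2l// ler_pM2r ?invr_gt0// natr1 ltW.
Qed.

Lemma grid_ge0 (T : R) n j : 0 < T -> 0 <= grid T n j.
Proof. by move=> T0; rewrite mulr_ge0 ?divr_ge0// ltW. Qed.

(** Uniform continuity on the compact interval [0, T]. *)
Lemma cont_path_grid {V : normedModType R} (T : R) (y : R -> V) e :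
  0 < T -> cont_path T y -> 0 < e ->
  \forall n \near \oo, forall t, 0 <= t <= T ->
    `|y t - y (grid T n (grid_index T n t))| <= e.
Proof.
move=> T0 yc e0.
have /compact_near_coveringP cov := @segment_compact R 0 T.
have : \forall n \near \oo, `[0, T]%classic `<=` (fun t => 0 <= t <= T ->
    `|y t - y (grid T n (grid_index T n t))| <= e).
  apply: cov => t; rewrite /= in_itv/= => tT.
  have /subspace_continuousP /(_ t) := yc; rewrite /= in_itv/= => /(_ tT).
  move=> /cvgrPdist_le /(_ (e / 2)); rewrite divr_gt0// => /(_ isT).
  rewrite /within/= near_withinE => -[c /= c0 yt].
  have c2 : 0 < c / 2 by rewrite divr_gt0.
  have [N _ NT] : \forall n \near \oo, T / (c / 2) < n%:R by exact: nbhs_infty_gtr.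
  exists ([set s | `|t - s| < c / 2], [set n | (N <= n)%N]).
    by split; [apply/nbhs_ballP; exists (c / 2)|exists N].
  move=> [s n] /= [ts Nn] sT; have [ju lo up] := grid_index_bounds n T0 sT.
  have g0 := grid_ge0 n (grid_index T n s) T0.
  have /andP[s0 s1] := sT.
  have Tn : T / n.+1%:R < c / 2.
    rewrite ltr_pdivrMr// mulrC -ltr_pdivrMr//.
    by rewrite (lt_le_trans (NT _ (leqnn N)))// ler_nat ltnW.
  have A1 : `|y t - y s| <= e / 2.
    apply: yt; rewrite /ball_/= ?in_itv/=; last by rewrite s0 s1.
    by rewrite (lt_trans ts)// ltr_pdivrMr// ltr_pMr// ltr1n.
  have A2 : `|y t - y (grid T n (grid_index T n s))| <= e / 2.
    apply: yt; rewrite /ball_/= ?in_itv/=; last by rewrite g0 (le_trans lo).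
    move: ts lo up Tn; rewrite !ltr_norml => /andP[].
    move: (T / _) (grid T n _) => u g; move=> ? ? ? ? ?; apply/andP; split; lra.
  by rewrite (le_trans (ler_distD (y t) _ _))// (distrC _ (y t)); lra.
by apply: filterS => n H t tT; apply: H => //=; rewrite in_itv.
Qed.

Definition step_path (T : R) (c : nat * seq rat) (t : R) : R :=
  ratr (nth 0 c.2 (grid_index T c.1 t)).

(** Rational step paths approximate every continuous path but are not
    continuous, so each of them is replaced by a continuous path next to it, if
    there is one.  This gives a countable dense family of continuous paths. *)
Definition near_step (T : R) (c : (nat * seq rat) * nat) : R -> R :=
  xget (cst 0) [set y | cont_path T y /\
    unif_le T (c.2.+1%:R^-1) y (step_path T c.1)].

Lemma near_step_cont T c : cont_path T (near_step T c).
Proof.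
rewrite /near_step; case: xgetP => [y _ []//|_].
by apply: continuous_subspaceT => x; exact: cvg_cst.
Qed.

Lemma near_step_dense T y e : 0 < T -> cont_path T y -> 0 < e ->
  exists c, unif_le T e y (near_step T c).
Proof.
move=> T0 yc e0.
have e4 : 0 < e / 4 by rewrite divr_gt0.
have [m _ mE] : \forall m \near \oo, (e / 2)^-1 < m%:R by exact: nbhs_infty_gtr.
have m1 : m.+1%:R^-1 <= e / 2.
  have e2 : 0 < e / 2 by rewrite divr_gt0.
  rewrite -[leRHS]invrK lef_pV2 ?posrE ?invr_gt0//.
  by rewrite ltW// (lt_le_trans (mE _ (leqnn m)))// ler_nat.
have [r rE r0] : exists2 r : R, r = m.+1%:R^-1 & 0 < r.
  by exists m.+1%:R^-1 => //; rewrite invr_gt0.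
rewrite -rE in m1.
have r2 : 0 < r / 2 by rewrite divr_gt0.
have [n _ /(_ n (leqnn n)) nE] := cont_path_grid T0 yc r2.
have Hq j : {q : rat | `|y (grid T n j) - ratr q| <= r / 2}.
  have yr : y (grid T n j) - r / 2 < y (grid T n j) + r / 2 by lra.
  apply: cid; have [q] := rat_in_itvoo yr.
  rewrite in_itv/= => /andP[q1 q2]; exists q.
  by rewrite ler_norml; apply/andP; split; lra.
pose s := mkseq (fun j => sval (Hq j)) n.+2.
have ys : unif_le T r y (step_path T (n, s)).
  move=> t tT; have [ju _ _] := grid_index_bounds n T0 tT.
  rewrite /step_path/= nth_mkseq// (le_trans (ler_distD (y (grid T n (grid_index T n t))) _ _))//.
  by have := nE t tT; have := svalP (Hq (grid_index T n t)); lra.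
exists ((n, s), m) => t tT; rewrite /near_step; case: xgetP => [z _ [zc zs]|/(_ y)[]]; last first.
    by rewrite /= -rE.
  have := ys t tT; have := zs t tT; rewrite [in X in X -> _]distrC /= => h1 h2.
  rewrite (le_trans (ler_distD (step_path T (n, s) t) _ _))//.
  by move: h1 h2; rewrite -rE; lra.
Qed.

Context {d : measure_display} {O : measurableType d}.

Lemma unif_le_measurable (T c : R) (z : O -> R -> R) (y : R -> R) : 0 < T ->
  (forall w, cont_path T (z w)) -> cont_path T y ->
  (forall t, 0 <= t <= T -> measurable_fun setT (fun w => z w t)) ->
  measurable [set w | unif_le T c (z w) y].
Proof.
move=> T0 zc yc mz.
(* It suffices to compare the two continuous paths at the mesh points. *)
pose A (n j : nat) := [set w | grid T n j <= T ->
  `|z w (grid T n j) - y (grid T n j)| <= c].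
have -> : [set w | unif_le T c (z w) y] = \bigcap_n \bigcap_j A n j.
  apply/seteqP; split => [w H n _ j _ /= gT|w H t tT].
    by apply: H; rewrite grid_ge0.
  apply/ler_addgt0Pr => e e0; have e2 : 0 < e / 2 by rewrite divr_gt0.
  have [n _ /(_ n (leqnn n)) [n1 n2]] := filterI (cont_path_grid T0 (zc w) e2)
     (cont_path_grid T0 yc e2).
  have [ju lo _] := grid_index_bounds n T0 tT.
  have := H n I (grid_index T n t) I; rewrite /A/=.
  have /andP[_ tT'] := tT; rewrite (le_trans lo)// => /(_ isT).
  have := n1 t tT; have := n2 t tT.
  set g := grid T n _; set a := z w t; set b := y t; set a' := z w g; set b' := y g.
  rewrite !ler_norml => /andP[? ?] /andP[? ?] /andP[? ?]; apply/andP; split; lra.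
apply: bigcapT_measurable => n; apply: bigcapT_measurable => j.
rewrite /A; have [gT|gT] := leP (grid T n j) T; last first.
  by rewrite (_ : mkset _ = setT)//; apply/seteqP; split.
rewrite (_ : mkset _ = setT `&` [set w | `|z w (grid T n j) - y (grid T n j)| <= c]).
  apply: measurable_fun_le => //; apply: measurableT_comp => //.
  by apply: measurable_funB => //; apply: mz; rewrite grid_ge0.
by apply/seteqP; split => [w /(_ isT) zy|w [_ zy] _]; [split|].
Qed.

(** The sublevel sets are countable unions of uniform balls around the paths of
    a countable dense family, and z w belongs to such a ball if and only if it
    satisfies countably many conditions at single times. *)
Lemma lip_functional_measurable (T k : R) (F : (R -> R) -> R) (z : O -> R -> R) :
  0 < T -> 0 <= k -> lip_functional T k F -> (forall w, cont_path T (z w)) ->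
  (forall t, 0 <= t <= T -> measurable_fun setT (fun w => z w t)) ->
  measurable_fun setT (fun w => F (z w)).
Proof.
move=> T0 k0 Fk zc mz.
apply: (measurability _ (RGenInftyO.measurableE R)) => _ [_ [a ->] <-].
rewrite setTI.
pose D (c : (nat * seq rat) * nat) (m : nat) :=
  if F (near_step T c) + k * m.+1%:R^-1 < a
  then [set w | unif_le T (m.+1%:R^-1) (z w) (near_step T c)] else set0.
have -> : (fun w => F (z w)) @^-1` `]-oo, a[ = \bigcup_c \bigcup_m D c m.
  apply/seteqP; split => [w|w [c _ [m _]]]; rewrite /= in_itv/=; last first.
    rewrite /D; case: ifPn => // Fa /= zy; apply: le_lt_trans Fa.
    rewrite -lerBlDl; apply: le_trans (ler_norm _) _.
    by apply: Fk => //; exact: near_step_cont.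
  move=> Fa.
  have [m _ mE] : \forall m \near \oo, 2 * k / (a - F (z w)) < m%:R.
    exact: nbhs_infty_gtr.
  have {}mE : 2 * (k * m.+1%:R^-1) < a - F (z w).
    rewrite mulrA ltr_pdivrMr// -ltr_pdivrMl ?subr_gt0// mulrC.
    by rewrite (lt_le_trans (mE _ (leqnn m)))// ler_nat.
  have m0 : 0 < m.+1%:R^-1 :> R by rewrite invr_gt0.
  have [c yc] := near_step_dense T0 (zc w) m0.
  exists c => //; exists m => //; rewrite /D ifT//.
  have : `|F (z w) - F (near_step T c)| <= k * m.+1%:R^-1.
    by apply: Fk => //; exact: near_step_cont.
  rewrite ler_norml => /andP[]; move: mE; move: (k * _) => u ? ? ?; lra.
apply: countable_bigcupT_measurable => [|c]; first exact: countableP.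
apply: bigcupT_measurable => m; rewrite /D; case: ifP => // _.
by apply: unif_le_measurable => //; exact: near_step_cont.
Qed.

End path_measurability.

(** * Matrix-valued integrals *)

Section matrix_norm.
Context {R : realType}.

Lemma mx_norm_le {m n : nat} (A : 'M[R]_(m, n)) (c : R) : 0 <= c ->
  (forall i j, `|A i j| <= c) -> `|A| <= c.
Proof.
move=> c0 Ac; rewrite /Num.Def.normr/= mx_normrE.
by apply: bigmax_le => // -[i j] _; exact: Ac.
Qed.

Lemma mx_coord_le {m n : nat} (A : 'M[R]_(m, n)) i j : `|A i j| <= `|A|.
Proof.
rewrite {2}/Num.Def.normr/= mx_normrE.
exact: (@le_bigmax _ _ _ 0 (fun ij : 'I_m * 'I_n => `|A ij.1 ij.2|) (i, j)).
Qed.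

Lemma mx_norm_mul {m n p : nat} (A : 'M[R]_(m, n)) (B : 'M[R]_(n, p)) :
  `|A *m B| <= n%:R * `|A| * `|B|.
Proof.
apply: mx_norm_le => [|i j]; first by rewrite !mulr_ge0.
rewrite mxE (le_trans (ler_norm_sum _ _ _))//.
apply: (@le_trans _ _ (\sum_(k < n) `|A| * `|B|)).
  by apply: ler_sum => k _; rewrite normrM ler_pM// mx_coord_le.
by rewrite sumr_const card_ord -mulrA mulr_natl.
Qed.

Lemma cvg_mxP {T : Type} {F : set_system T} {FF : Filter F} {m n : nat}
    (f : T -> 'M[R]_(m, n)) (l : 'M[R]_(m, n)) :
  (forall i j, f t i j @[t --> F] --> l i j) -> f t @[t --> F] --> l.
Proof.
move=> fl; apply/cvgrPdist_le => e e0.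
have : \forall t \near F, forall i j, `|l i j - f t i j| <= e.
  apply: filter_forall => i; apply: filter_forall => j.
  by have /cvgrPdist_le := fl i j; exact.
apply: filterS => t H; apply: mx_norm_le => [|i j]; first exact: ltW.
by rewrite !mxE.
Qed.

Lemma cvg_mx_coord {T : Type} {F : set_system T} {FF : Filter F} {m n : nat}
    (f : T -> 'M[R]_(m, n)) (l : 'M[R]_(m, n)) i j :
  f t @[t --> F] --> l -> f t i j @[t --> F] --> l i j.
Proof.
move=> fl; apply: (@continuous_cvg _ _ _ _ _ f (fun N : 'M[R]_(m, n) => N i j)) => //.
exact: coord_continuous.
Qed.

End matrix_norm.

Section matrix_integrals.
Context {d : measure_display} {T : measurableType d} {R : realType}.
Variable mu : {measure set T -> \bar R}.
Implicit Types D : set T.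

Definition mx_integrable {m n : nat} D (F : T -> 'M[R]_(m, n)) : Prop :=
  forall i j, mu.-integrable D (EFin \o (fun t => F t i j)).

Lemma integrable_sumR D (I : Type) (s : seq I) (f : I -> T -> R) :
  measurable D -> (forall i, mu.-integrable D (EFin \o f i)) ->
  mu.-integrable D (EFin \o (fun t => \sum_(i <- s) f i t)).
Proof.
move=> mD fi; rewrite (_ : _ \o _ = (fun t => \sum_(i <- s) (f i t)%:E)%E).
  by apply: integrable_sum => // i _; exact: fi.
by apply/funext => t; rewrite /= sumEFin.
Qed.

Lemma Rintegral_sumR D (I : Type) (s : seq I) (f : I -> T -> R) :
  measurable D -> (forall i, mu.-integrable D (EFin \o f i)) ->
  \int[mu]_(t in D) (\sum_(i <- s) f i t) = \sum_(i <- s) \int[mu]_(t in D) f i t.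
Proof.
move=> mD fi; elim: s => [|i s IH].
  under eq_Rintegral do rewrite big_nil.
  by rewrite big_nil Rintegral_cst// mul0r.
under eq_Rintegral do rewrite big_cons.
by rewrite big_cons RintegralD// ?IH//; exact: integrable_sumR.
Qed.

Lemma integrableZlR D (c : R) (f : T -> R) : measurable D ->
  mu.-integrable D (EFin \o f) -> mu.-integrable D (EFin \o (fun t => c * f t)).
Proof.
move=> mD fi; rewrite (_ : _ \o _ = (fun t => c%:E * (EFin \o f) t)%E).
  exact: integrableZl.
by apply/funext.
Qed.

Lemma integrableDR D (f g : T -> R) : measurable D ->
  mu.-integrable D (EFin \o f) -> mu.-integrable D (EFin \o g) ->
  mu.-integrable D (EFin \o (fun t => f t + g t)).
Proof. by move=> mD fi gi; exact: (integrableD mD fi gi). Qed.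

Lemma mx_integrableD {m n} D (F G : T -> 'M[R]_(m, n)) : measurable D ->
  mx_integrable D F -> mx_integrable D G -> mx_integrable D (fun t => F t + G t).
Proof.
move=> mD Fi Gi i j; under [X in EFin \o X]eq_fun do rewrite mxE.
exact: integrableDR.
Qed.

Lemma mx_integrableZ {m n} D (c : R) (F : T -> 'M[R]_(m, n)) : measurable D ->
  mx_integrable D F -> mx_integrable D (fun t => c *: F t).
Proof.
move=> mD Fi i j; under [X in EFin \o X]eq_fun do rewrite mxE.
exact: integrableZlR.
Qed.

Lemma mx_integrableB {m n} D (F G : T -> 'M[R]_(m, n)) : measurable D ->
  mx_integrable D F -> mx_integrable D G -> mx_integrable D (fun t => F t - G t).
Proof.
move=> mD Fi Gi; under [X in mx_integrable _ X]eq_fun do rewrite -scaleN1r.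
by apply: mx_integrableD => //; exact: mx_integrableZ.
Qed.

Lemma mx_bounded_integrable {m n} D (B : R) (F : T -> 'M[R]_(m, n)) :
  measurable D -> (mu D < +oo)%E ->
  (forall i j, measurable_fun D (fun t => F t i j)) ->
  (forall t, D t -> `|F t| <= B) -> mx_integrable D F.
Proof.
move=> mD muD mF FB i j; apply: (@bounded_integrable _ _ _ _ _ B) => // t Dt.
by rewrite (le_trans (mx_coord_le _ _ _))// FB.
Qed.

Lemma mxint_norm_le {m n} D (F : T -> 'M[R]_(m, n)) (b : T -> R) :
  measurable D -> mx_integrable D F -> mu.-integrable D (EFin \o b) ->
  (forall t, D t -> `|F t| <= b t) -> `|mxint mu D F| <= \int[mu]_(t in D) b t.
Proof.
move=> mD Fi bi Fb; apply: mx_norm_le.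
  by apply: Rintegral_ge0 => t /Fb; exact: le_trans.
move=> i j; rewrite mxE (le_trans (le_normr_Rintegral _ _))//.
apply: le_Rintegral => //; first exact: (integrable_norm (Fi i j)).
by move=> t /Fb; apply: le_trans; exact: mx_coord_le.
Qed.

Lemma mxintD {m n} D (F G : T -> 'M[R]_(m, n)) : measurable D ->
  mx_integrable D F -> mx_integrable D G ->
  mxint mu D (fun t => F t + G t) = mxint mu D F + mxint mu D G.
Proof.
move=> mD Fi Gi; apply/matrixP => i j; rewrite !mxE.
by under eq_Rintegral do rewrite mxE; rewrite RintegralD.
Qed.

Lemma mxintZ {m n} D (c : R) (F : T -> 'M[R]_(m, n)) : measurable D ->
  mx_integrable D F -> mxint mu D (fun t => c *: F t) = c *: mxint mu D F.
Proof.
move=> mD Fi; apply/matrixP => i j; rewrite !mxE.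
by under eq_Rintegral do rewrite mxE; rewrite RintegralZl.
Qed.

Lemma mxintB {m n} D (F G : T -> 'M[R]_(m, n)) : measurable D ->
  mx_integrable D F -> mx_integrable D G ->
  mxint mu D (fun t => F t - G t) = mxint mu D F - mxint mu D G.
Proof.
move=> mD Fi Gi; apply/matrixP => i j; rewrite !mxE.
by under eq_Rintegral do rewrite !mxE; rewrite RintegralB.
Qed.

Lemma mxint_mulr {m n p} D (F : T -> 'M[R]_(m, n)) (B : 'M[R]_(n, p)) :
  measurable D -> mx_integrable D F ->
  mxint mu D (fun t => F t *m B) = mxint mu D F *m B.
Proof.
move=> mD Fi; apply/matrixP => i j; rewrite !mxE.
under eq_Rintegral do rewrite mxE.
rewrite Rintegral_sumR//.
  by apply: eq_bigr => k _; rewrite mxE RintegralZr.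
move=> k; under [X in EFin \o X]eq_fun do rewrite mulrC.
exact: integrableZlR.
Qed.

Lemma mxint_mull {m n p} D (B : 'M[R]_(m, n)) (F : T -> 'M[R]_(n, p)) :
  measurable D -> mx_integrable D F ->
  mxint mu D (fun t => B *m F t) = B *m mxint mu D F.
Proof.
move=> mD Fi; apply/matrixP => i j; rewrite !mxE.
under eq_Rintegral do rewrite mxE.
rewrite Rintegral_sumR//.
  by apply: eq_bigr => k _; rewrite mxE RintegralZl.
by move=> k; exact: integrableZlR.
Qed.

Lemma measurable_mulmx {m n p} D (F : T -> 'M[R]_(m, n)) (G : T -> 'M[R]_(n, p)) :
  (forall i j, measurable_fun D (fun t => F t i j)) ->
  (forall i j, measurable_fun D (fun t => G t i j)) ->
  forall i j, measurable_fun D (fun t => (F t *m G t) i j).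
Proof.
move=> mF mG i j; under eq_fun do rewrite mxE.
by apply: measurable_sum => k; exact: measurable_funM.
Qed.

Lemma eq_mxint {m n} D (F G : T -> 'M[R]_(m, n)) :
  (forall t, D t -> F t = G t) -> mxint mu D F = mxint mu D G.
Proof.
move=> FG; apply/matrixP => i j; rewrite !mxE; apply: eq_Rintegral => t.
by rewrite inE => /FG ->.
Qed.

Lemma mxint_cst {m n} D (A : 'M[R]_(m, n)) : measurable D ->
  mxint mu D (fun=> A) = fine (mu D) *: A.
Proof.
by move=> mD; apply/matrixP => i j; rewrite !mxE Rintegral_cst// mulrC.
Qed.

End matrix_integrals.

Section interval_integrals.
Context {R : realType} (mu : {measure set (measurableTypeR R) -> \bar R}).

Lemma itv_split (s t : R) : 0 <= s -> s <= t ->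
  `[0, t]%classic = `[0, s] `|` `]s, t] :> set R.
Proof.
move=> s0 st; apply/seteqP; split => x /=; rewrite !in_itv/=.
  by move=> /andP[x0 xt]; have [xs|sx] := leP x s; [left|right]; rewrite ?x0 ?xt.
by move=> [/andP[x0 xs]|/andP[sx xt]]; rewrite ?x0 ?xt ?(le_trans xs)//
  andbT (le_trans s0)// ltW.
Qed.

Lemma integrable_itvS (f : R -> R) (T s t : R) (a b : bool) :
  mu.-integrable `[0, T] (EFin \o f) -> 0 <= s -> t <= T ->
  mu.-integrable [set` Interval (BSide a s) (BSide b t)] (EFin \o f).
Proof.
move=> fi s0 tT; apply: (integrableS _ _ _ fi) => // x /=.
rewrite !itv_boundlr /= => /andP[sx xt]; apply/andP; split.
  by rewrite bnd_simp (le_trans s0)//; case: a sx; rewrite bnd_simp// => /ltW.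
by rewrite bnd_simp (le_trans _ tT)//; case: b xt; rewrite bnd_simp// => /ltW.
Qed.

Lemma Rintegral_itvoc (f : R -> R) (s t : R) : 0 <= s -> s <= t ->
  mu.-integrable `[0, t] (EFin \o f) ->
  \int[mu]_(u in `[0, t]) f u - \int[mu]_(u in `[0, s]) f u =
  \int[mu]_(u in `]s, t]) f u.
Proof.
move=> s0 st fi; apply/eqP; rewrite subr_eq addrC; apply/eqP.
rewrite (itv_split s0 st) Rintegral_setU//; first by rewrite -itv_split.
rewrite disj_set2E; apply/eqP/seteqP; split => // x [] /=; rewrite !in_itv/=.
by move=> /andP[_ xs] /andP[/lt_le_trans /(_ xs)]; rewrite ltxx.
Qed.

Lemma mxint_itvB {m n} (F : R -> 'M[R]_(m, n)) (s t : R) : 0 <= s -> s <= t ->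
  mx_integrable mu `[0, t] F ->
  mxint mu `[0, t] F - mxint mu `[0, s] F = mxint mu `]s, t] F.
Proof.
by move=> s0 st Fi; apply/matrixP => i j; rewrite !mxE Rintegral_itvoc//; exact: Fi.
Qed.

End interval_integrals.

(** * The inequality of Gronwall *)

Section gronwall.
Context {R : realType}.
Notation mu := (@lebesgue_measure R).

Lemma cont_path_integrable (T : R) (u : R -> R) s t : cont_path T u ->
  0 <= s -> t <= T -> mu.-integrable `[s, t] (EFin \o u).
Proof.
move=> uc s0 tT; apply: continuous_compact_integrable; first exact: segment_compact.
apply: continuous_subspaceW uc => x /=; rewrite !in_itv/= => /andP[? ?].
by rewrite (le_trans s0)//= (le_trans _ tT).
Qed.

Lemma continuous_expR_scale (k : R) : continuous (fun s : R => expR (k * s)).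
Proof.
move=> x; apply: continuous_comp; last exact: continuous_expR.
by apply: cvgM; [exact: cvg_cst|exact: cvg_id].
Qed.

Lemma Rintegral_expR (k s t : R) : 0 < k -> s <= t ->
  \int[mu]_(u in `[s, t]) expR (k * u) = (expR (k * t) - expR (k * s)) / k.
Proof.
move=> k0; rewrite le_eqVlt => /predU1P[<-|st].
  by rewrite set_itv1 Rintegral_set1 subrr mul0r.
have dF (x : R) : is_derive x 1 (fun s => k^-1 * expR (k * s)) (expR (k * x)).
  have d1 : is_derive x 1 (fun s => k * s) k.
    by apply: is_derive_eq; rewrite /GRing.scale/= mulr1.
  apply: is_derive_eq; rewrite /GRing.scale/=; field; exact: lt0r_neq0.
have cF : continuous (fun s : R => k^-1 * expR (k * s)).
  by move=> x; apply: cvgM; [exact: cvg_cst|exact: continuous_expR_scale].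
rewrite /Rintegral (@continuous_FTC2 R _ (fun s => k^-1 * expR (k * s)))//.
- by rewrite /= -mulrBr mulrC.
- exact/continuous_subspaceT/continuous_expR_scale.
- split=> [x _||]; first by have := dF x; case.
  + by apply: cvg_at_right_filter; exact: cF.
  + by apply: cvg_at_left_filter; exact: cF.
- by move=> x _; rewrite derive1E; have := dF x; case.
Qed.

(** The weight exp(- 2 (k + 1) t) has the rate k + 1 instead of k in order to be
    usable for k = 0. *)
Definition gronwall_cst (k T : R) : R := 2 * expR (2 * (k + 1) * T).

Lemma gronwall_cst_gt0 k T : 0 < gronwall_cst k T.
Proof. by rewrite mulr_gt0// expR_gt0. Qed.

(** Multiplying by an exponential weight of twice the Lipschitz constant turns
    the integral term into half of the maximum, which can be absorbed. *)
Lemma gronwall (T b k : R) (u : R -> R) : 0 <= T -> 0 <= b -> 0 <= k ->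
  cont_path T u -> (forall t, 0 <= t <= T -> 0 <= u t) ->
  (forall t, 0 <= t <= T -> u t <= b + k * \int[mu]_(s in `[0, t]) u s) ->
  forall t, 0 <= t <= T -> u t <= b * gronwall_cst k T.
Proof.
move=> T0 b0 k0 uc u0 ub.
pose K := 2 * (k + 1); have K0 : 0 < K by rewrite /K; lra.
pose v t := u t * expR (- (K * t)).
have vc : {within `[0, T]%classic, continuous v}.
  move=> x; apply: cvgM; first exact: uc.
  apply: continuous_subspaceT => {}x; apply: continuous_comp; last exact: continuous_expR.
  by apply: cvgN; apply: cvgM; [exact: cvg_cst|exact: cvg_id].
have [c cT vmax] := EVT_max T0 vc.
have uE s : u s = v s * expR (K * s) by rewrite /v -mulrA -expRD addNr expR0 mulr1.
have v0 : 0 <= v c by rewrite mulr_ge0 ?expR_ge0// u0//; move: cT; rewrite in_itv.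
have uv s : 0 <= s <= T -> u s <= v c * expR (K * s).
  by move=> sT; rewrite uE ler_wpM2r ?expR_ge0// vmax// in_itv.
have vc2b : v c <= 2 * b.
  have cT' : 0 <= c <= T by move: cT; rewrite in_itv.
  have /andP[c0 c1] := cT'.
  have H : \int[mu]_(s in `[0, c]) u s <= v c * ((expR (K * c) - 1) / K).
    have := Rintegral_expR K0 c0; rewrite mulr0 expR0 => <-; rewrite -RintegralZl//.
      apply: le_Rintegral => //; first exact: (cont_path_integrable uc).
        apply: integrableZlR => //; apply: (@cont_path_integrable T) => //.
        exact/continuous_subspaceT/continuous_expR_scale.
      move=> x /=; rewrite in_itv/= => /andP[x0 xc]; apply: uv.
      by rewrite x0 (le_trans xc).
    apply: (@cont_path_integrable T) => //.
    exact/continuous_subspaceT/continuous_expR_scale.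
  have E0 : 0 < expR (K * c) by exact: expR_gt0.
  have E1 : 1 <= expR (K * c) by rewrite -expR0 ler_expR mulr_ge0// ltW.
  have I0 : 0 <= \int[mu]_(s in `[0, c]) u s.
    by apply: Rintegral_ge0 => s /=; rewrite in_itv/= => /andP[s0 sc]; rewrite u0// s0 (le_trans sc).
  have H2 : k * \int[mu]_(s in `[0, c]) u s <= v c * ((expR (K * c) - 1) / 2).
    apply: (@le_trans _ _ ((K / 2) * (v c * ((expR (K * c) - 1) / K)))).
      apply: ler_pM => //; rewrite /K; lra.
    by rewrite le_eqVlt; apply/orP; left; apply/eqP; field; rewrite gt_eqF.
  have := ub c cT'; rewrite uE.
  set I := Rintegral _ _ _ in H2 *; set E := expR _ in E0 E1 H2 *; set m := v c in v0 H2 *.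
  move=> H3; have H4 : m * E <= 2 * b * E.
    have : b <= b * E by rewrite ler_peMr.
    have : m * E <= b + m * E / 2 - m / 2 by lra.
    by lra.
  by rewrite -(ler_pM2r E0).
move=> t tT; apply: le_trans (uv t tT) _; rewrite /gronwall_cst mulrA (mulrC b).
apply: ler_pM; rewrite ?expR_ge0//.
by rewrite ler_expR ler_pM2l//; case/andP: tT.
Qed.

End gronwall.

(** * Continuous matrix-valued paths *)

Section continuous_matrix_paths.
Context {R : realType}.
Notation mu := (@lebesgue_measure R).
Implicit Types T : R.

Lemma cont_path_coord {m n} T (F : R -> 'M[R]_(m, n)) i j :
  cont_path T F -> cont_path T (fun t => F t i j).
Proof. by move=> Fc x; apply: cvg_mx_coord; exact: Fc. Qed.

Lemma cont_path_mx {m n} T (F : R -> 'M[R]_(m, n)) :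
  (forall i j, cont_path T (fun t => F t i j)) -> cont_path T F.
Proof. by move=> Fc x; apply: cvg_mxP => i j; exact: Fc. Qed.

Lemma cont_path_norm {V : normedModType R} T (F : R -> V) :
  cont_path T F -> cont_path T (fun t => `|F t|).
Proof. by move=> Fc x; apply: cvg_norm; exact: Fc. Qed.

Lemma cont_pathD {V : normedModType R} T (F G : R -> V) :
  cont_path T F -> cont_path T G -> cont_path T (fun t => F t + G t).
Proof. by move=> Fc Gc x; apply: cvgD; [exact: Fc|exact: Gc]. Qed.

Lemma cont_pathB {V : normedModType R} T (F G : R -> V) :
  cont_path T F -> cont_path T G -> cont_path T (fun t => F t - G t).
Proof. by move=> Fc Gc x; apply: cvgB; [exact: Fc|exact: Gc]. Qed.

Lemma cont_pathZ {V : normedModType R} T (c : R) (F : R -> V) :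
  cont_path T F -> cont_path T (fun t => c *: F t).
Proof. by move=> Fc x; apply: cvgZr; exact: Fc. Qed.

Lemma cont_path_sum {V : normedModType R} T (I : Type) (s : seq I)
    (F : I -> R -> V) :
  (forall i, cont_path T (F i)) -> cont_path T (fun t => \sum_(i <- s) F i t).
Proof.
move=> Fc; elim: s => [|i s IH].
  under eq_fun do rewrite big_nil.
  by apply: continuous_subspaceT => x; exact: cvg_cst.
by under eq_fun do rewrite big_cons; apply: cont_pathD.
Qed.

Lemma cont_path_mul {m n p} T (F : R -> 'M[R]_(m, n)) (G : R -> 'M[R]_(n, p)) :
  cont_path T F -> cont_path T G -> cont_path T (fun t => F t *m G t).
Proof.
move=> Fc Gc; apply: cont_path_mx => i j.
under eq_fun do rewrite mxE.
apply: (@cont_path_sum R) => k x; apply: cvgM; exact: cont_path_coord.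
Qed.

Lemma eq_cont_path {V : normedModType R} T (f g : R -> V) :
  (forall t, 0 <= t <= T -> f t = g t) -> cont_path T f -> cont_path T g.
Proof.
by move=> fg; apply: subspace_eq_continuous => t; rewrite inE/= in_itv/= => /fg.
Qed.

Lemma cont_path_sub {V : normedModType R} T (F : R -> V) :
  {within `[0, +oo[%classic, continuous F} -> cont_path T F.
Proof. by apply: continuous_subspaceW => x /=; rewrite !in_itv/= => /andP[->]. Qed.

Lemma cont_path_bounded {V : normedModType R} T (F : R -> V) : 0 <= T ->
  cont_path T F -> exists2 B, 0 <= B & forall t, 0 <= t <= T -> `|F t| <= B.
Proof.
move=> T0 /cont_path_norm Fc; have [c _ cmax] := EVT_max T0 Fc.
by exists `|F c| => // t tT; apply: cmax; rewrite in_itv.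
Qed.

Lemma cont_path_mx_integrable {m n} T (F : R -> 'M[R]_(m, n)) s t :
  cont_path T F -> 0 <= s -> t <= T -> mx_integrable mu `[s, t] F.
Proof.
move=> Fc s0 tT i j; apply: cont_path_integrable s0 tT.
exact: cont_path_coord.
Qed.

Lemma lipschitz_cont_path {V : normedModType R} T (K : R) (y : R -> V) :
  (forall s t, 0 <= s -> s <= t -> t <= T -> `|y t - y s| <= K * (t - s)) ->
  cont_path T y.
Proof.
move=> yK; apply/subspace_continuousP => t; rewrite /= in_itv/= => /andP[t0 tT].
have yK2 s : 0 <= s <= T -> `|y t - y s| <= `|K| * `|t - s|.
  move=> /andP[s0 sT]; have [st|/ltW ts] := leP s t.
    rewrite (le_trans (yK _ _ s0 st tT))// [X in _ <= _ * X]ger0_norm ?subr_ge0//.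
    by rewrite ler_wpM2r ?subr_ge0// ler_norm.
  rewrite distrC (distrC t) (le_trans (yK _ _ t0 ts sT))//.
  rewrite [X in _ <= _ * X]ger0_norm ?subr_ge0//.
  by rewrite ler_wpM2r ?subr_ge0// ler_norm.
apply/cvgrPdist_le => e e0; have k1 : 0 < `|K| + 1 by rewrite ltr_wpDl.
rewrite near_withinE; exists (e / (`|K| + 1)) => /=; first by rewrite divr_gt0.
move=> s /= ts; rewrite in_itv/= => /yK2 /le_trans; apply.
apply: (@le_trans _ _ (`|K| * (e / (`|K| + 1)))); first by rewrite ler_wpM2l// ltW.
by rewrite mulrA ler_pdivrMr// mulrC ler_pM2l// lerDl.
Qed.

Lemma lebesgue_itvoc (s t : R) : s <= t -> fine (mu `]s, t]) = t - s.
Proof.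
move=> st; rewrite lebesgue_measure_itv/= lte_fin; case: ltP => //= ts.
by apply/eqP; rewrite eq_sym subr_eq0 eq_le ts st.
Qed.

Lemma mxint_lip {m n} T (B : R) (F : R -> 'M[R]_(m, n)) s t :
  mx_integrable mu `[0, T] F -> (forall t, 0 <= t <= T -> `|F t| <= B) ->
  0 <= s -> s <= t -> t <= T ->
  `|mxint mu `[0, t] F - mxint mu `[0, s] F| <= B * (t - s).
Proof.
move=> Fi FB s0 st tT.
have sub : `[0, t] `<=` (`[0, T] : set R).
  by move=> x /=; rewrite !in_itv/= => /andP[-> /le_trans]; apply.
have sub2 : `]s, t] `<=` (`[0, t] : set R).
  move=> x /=; rewrite !in_itv/= => /andP[/ltW sx ->].
  by rewrite (le_trans s0).
have Fit : mx_integrable mu `[0, t] F.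
  by move=> i j; apply: (integrableS _ _ _ (Fi i j)).
rewrite mxint_itvB// -lebesgue_itvoc// -Rintegral_cst//.
apply: mxint_norm_le => //.
- by move=> i j; apply: (integrableS _ _ _ (Fit i j)).
- apply: (@bounded_integrable _ _ _ _ _ `|B|) => //.
  by rewrite /= lebesgue_measure_itv/= lte_fin; case: ifP => _; rewrite ?ltry// -EFinB ltry.
- move=> x /sub2/sub /=; rewrite in_itv/=; exact: FB.
Qed.

Lemma cont_path_mxint {m n} T (B : R) (F : R -> 'M[R]_(m, n)) :
  mx_integrable mu `[0, T] F -> (forall t, 0 <= t <= T -> `|F t| <= B) ->
  cont_path T (fun t => mxint mu `[0, t] F).
Proof.
by move=> Fi FB; apply: (@lipschitz_cont_path _ _ B) => s t s0 st tT; apply: mxint_lip Fi FB _ _ _.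
Qed.

(** Gronwall's inequality for y - z, where y and z solve y = v + int y A with
    sources that differ by at most c. *)
Lemma volterra_stability {m n} T (c K : R) (y z : R -> 'M[R]_(m, n))
    (A : R -> 'M[R]_n) : 0 <= T -> 0 <= c -> 0 <= K ->
  cont_path T y -> cont_path T z -> cont_path T A ->
  (forall t, 0 <= t <= T -> `|A t| <= K) ->
  (forall t, 0 <= t <= T ->
    `|y t - z t - mxint mu `[0, t] (fun s => (y s - z s) *m A s)| <= c) ->
  unif_le T (c * gronwall_cst (n%:R * K) T) y z.
Proof.
move=> T0 c0 K0 yc zc Ac AK H t tT.
have yzc := cont_pathB yc zc.
apply: (@gronwall _ T c (n%:R * K) (fun t => `|y t - z t|)) => //.
- by rewrite mulr_ge0.
- exact: cont_path_norm.
- move=> {tT}t /andP[t0 tT].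
  set I := mxint mu `[0, t] (fun s => (y s - z s) *m A s).
  rewrite (_ : y t - z t = (y t - z t - I) + I); last by rewrite subrK.
  rewrite (le_trans (ler_normD _ _))// lerD ?H ?t0//.
  have ni : mu.-integrable `[0, t] (EFin \o (fun s => `|y s - z s|)).
    by apply: (@cont_path_integrable _ T) => //; exact: cont_path_norm.
  rewrite -RintegralZl//; apply: mxint_norm_le => //.
  + by apply: (@cont_path_mx_integrable _ _ T) => //; exact: cont_path_mul.
  + exact: integrableZlR.
  + move=> s /=; rewrite in_itv/= => /andP[s0 st].
    rewrite (le_trans (mx_norm_mul _ _))// mulrAC.
    rewrite ler_wpM2r// ler_wpM2l// AK// s0 (le_trans st)//.
Qed.

End continuous_matrix_paths.

(** * Integrals with a parameter, and the theorem of Fubini *)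

Section parametric_integrals.
Context {d1 d2 : measure_display} {T1 : measurableType d1}
  {T2 : measurableType d2} {R : realType}.

Lemma measurable_Rintegral_param (m2 : {sigma_finite_measure set T2 -> \bar R})
    (f : T1 * T2 -> R) : measurable_fun setT f ->
  measurable_fun setT (fun x => \int[m2]_y f (x, y)).
Proof.
move=> mf; have mEf : measurable_fun setT (EFin \o f) by exact/measurable_EFinP.
have mp := measurable_funepos mEf; have mn := measurable_funeneg mEf.
have mP := measurable_fun_fubini_tonelli_F (m2 := m2) _ mp (funepos_ge0 _).
have mN := measurable_fun_fubini_tonelli_F (m2 := m2) _ mn (funeneg_ge0 _).
have E : (fun x => \int[m2]_y f (x, y)) = (fun x => fine
    (fubini_F m2 ((EFin \o f)^\+)%E x - fubini_F m2 ((EFin \o f)^\-)%E x)%E).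
  apply/funext => x; rewrite /Rintegral integralE.
  by congr (fine (_ - _)%E); apply: eq_integral => y _; rewrite ?funeposE ?funenegE.
rewrite E; apply: (measurableT_comp (f := fine)) => //.
exact: emeasurable_funB.
Qed.

End parametric_integrals.

Lemma supported_integrable {d : measure_display} {T : measurableType d}
    {R : realType} (mu : {measure set T -> \bar R}) (D : set T) (C : R)
    (f : T -> R) : measurable D -> (mu D < +oo)%E -> measurable_fun setT f ->
  (forall x, `|f x| <= C) -> (forall x, ~ D x -> f x = 0) ->
  mu.-integrable setT (EFin \o f).
Proof.
move=> mD muD mf fC f0.
have -> : EFin \o f = (EFin \o f) \_ D.
  apply/funext => x; rewrite patchE; case: ifPn => //.
  by rewrite notin_setE => /f0 /= ->.
apply/(integrable_mkcond _ mD).1.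
by apply: (@bounded_integrable _ _ _ _ _ C) => //; exact: measurable_funTS.
Qed.

Section bounded_fubini.
Context {d1 d2 : measure_display} {T1 : measurableType d1}
  {T2 : measurableType d2} {R : realType}
  (m1 : {sigma_finite_measure set T1 -> \bar R})
  (m2 : {sigma_finite_measure set T2 -> \bar R}).

Lemma bounded_Fubini (D1 : set T1) (D2 : set T2) (C : R) (f : T1 * T2 -> R) :
  measurable D1 -> measurable D2 -> (m1 D1 < +oo)%E -> (m2 D2 < +oo)%E ->
  measurable_fun setT f -> (forall p, `|f p| <= C) ->
  (forall x y, ~ (D1 x /\ D2 y) -> f (x, y) = 0) ->
  \int[m1]_x (\int[m2]_y f (x, y)) = \int[m2]_y (\int[m1]_x f (x, y)).
Proof.
move=> mD1 mD2 D1y D2y mf fC f0.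
have fi : (m1 \x m2)%E.-integrable setT (EFin \o f).
  apply: (@supported_integrable _ _ _ _ (D1 `*` D2) C) => //.
  - exact: measurableX.
  - by rewrite /= product_measure1E//; apply: lte_mul_pinfty => //; rewrite ge0_fin_numE.
  - by move=> [x y]; exact: f0.
have i2 x : m2.-integrable setT (EFin \o (fun y => f (x, y))).
  apply: (@supported_integrable _ _ _ _ D2 C) => //.
  - by apply: (measurableT_comp mf); exact: measurable_pair1.
  - by move=> y yD; apply: f0 => -[].
have i1 y : m1.-integrable setT (EFin \o (fun x => f (x, y))).
  apply: (@supported_integrable _ _ _ _ D1 C) => //.
  - by apply: (measurableT_comp mf); exact: measurable_pair2.
  - by move=> x xD; apply: f0 => -[].
rewrite {1 3}/Rintegral; congr fine.
transitivity (\int[m1]_x \int[m2]_y (f (x, y))%:E)%E.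
  apply: eq_integral => x _; rewrite /Rintegral fineK//.
  by apply: integrable_fin_num => //; exact: i2.
transitivity (\int[m2]_y \int[m1]_x (f (x, y))%:E)%E; first exact: (Fubini fi).
apply: eq_integral => y _; rewrite /Rintegral fineK//.
by apply: integrable_fin_num => //; exact: i1.
Qed.

End bounded_fubini.

Section triangle.
Context {R : realType}.
Notation mu := (@lebesgue_measure R).
Notation mR := (measurableTypeR R).

Lemma measurable_le2 {d : measure_display} {T : measurableType d} (f g : T -> R) :
  measurable_fun setT f -> measurable_fun setT g ->
  measurable_fun setT (fun x => (f x <= g x)%R%:R : R).
Proof.
move=> mf mg; rewrite (_ : (fun x => _) = \1_[set x | (f x <= g x)%R]).
  by apply: measurable_indic; rewrite -[X in measurable X]setTI; exact: measurable_fun_le.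
by apply/funext => x; rewrite indicE; congr ((nat_of_bool _)%:R); apply/idP/idP; rewrite inE.
Qed.

(** Turns endpoints into variables of the integrand, where joint measurability
    and the theorem of Fubini can see them. *)
Lemma Rintegral_itv_indic (f : R -> R) (s t : R) :
  \int[mu]_(u in `[s, t]) f u =
  \int[mu]_u ((s <= u)%R%:R * (u <= t)%R%:R * f u).
Proof.
rewrite Rintegral_mkcond; apply: eq_Rintegral => u _.
rewrite patchE; case: ifPn.
  by rewrite inE/= in_itv/= => /andP[-> ->]; rewrite !mul1r.
rewrite notin_setE/= in_itv/= => /negP; rewrite negb_and.
by case: (s <= u); case: (u <= t) => //= _; rewrite ?mul0r ?mulr0 ?mul0r.
Qed.

Lemma measurable_Rintegral_itv (g : mR * mR -> R) : measurable_fun setT g ->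
  measurable_fun setT (fun p : mR * mR => \int[mu]_(u in `[p.1, p.2]) g (p.1, u)).
Proof.
move=> mg.
under eq_fun do rewrite Rintegral_itv_indic.
apply: (@measurable_Rintegral_param _ _ (mR * mR)%type mR R mu
  (fun q : (mR * mR) * mR => (q.1.1 <= q.2)%R%:R * (q.2 <= q.1.2)%R%:R * g (q.1.1, q.2))).
have m1 : measurable_fun setT (fun q : (mR * mR) * mR => q.1.1 : R).
  exact: (measurableT_comp measurable_fst measurable_fst).
have m2 : measurable_fun setT (fun q : (mR * mR) * mR => q.1.2 : R).
  exact: (measurableT_comp measurable_snd measurable_fst).
have m3 : measurable_fun setT (fun q : (mR * mR) * mR => q.2 : R).
  exact: measurable_snd.
apply: measurable_funM; first by apply: measurable_funM; exact: measurable_le2.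
apply: (measurableT_comp mg).
exact: measurable_fun_pair m1 m3.
Qed.

Lemma Fubini_triangle (g : mR * mR -> R) (C t : R) : measurable_fun setT g ->
  (forall s u, 0 <= s -> s <= u -> u <= t -> `|g (s, u)| <= C) ->
  \int[mu]_(s in `[0, t]) (\int[mu]_(u in `[s, t]) g (s, u)) =
  \int[mu]_(u in `[0, t]) (\int[mu]_(s in `[0, u]) g (s, u)).
Proof.
move=> mg gC; have [t0|t0] := ltP t 0.
  by rewrite set_itv_ge ?Rintegral_set0// bnd_simp -ltNge.
pose q (p : mR * mR) := (0 <= p.1)%R%:R * (p.1 <= p.2)%R%:R * (p.2 <= t)%R%:R * g p.
have mq : measurable_fun setT q.
  have m1 : measurable_fun setT (fun p : mR * mR => p.1 : R) by exact: measurable_fst.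
  have m2 : measurable_fun setT (fun p : mR * mR => p.2 : R) by exact: measurable_snd.
  apply: measurable_funM => //; apply: measurable_funM; last exact: measurable_le2.
  by apply: measurable_funM; exact: measurable_le2.
have C0 : 0 <= C by apply: le_trans (gC 0 0 _ _ _).
have qC p : `|q p| <= C.
  rewrite /q; case: p => s u /=; case: (boolP (0 <= s)) => s0; last by rewrite !mul0r normr0.
  case: (boolP (s <= u)) => su; last by rewrite mulr0 !mul0r normr0.
  case: (boolP (u <= t)) => ut; last by rewrite mulr0 !mul0r normr0.
  by rewrite !mul1r gC.
have itvy : (mu `[0%R, t] < +oo)%E.
  by rewrite /= lebesgue_measure_itv/= lte_fin; case: ifP => _; rewrite ?ltry// -EFinB ltry.
have q0 s u : ~ (`[0, t]%classic s /\ `[0, t]%classic u) -> q (s, u) = 0.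
  move=> H; rewrite /q/=; case: (boolP (0 <= s)) => s0; last by rewrite !mul0r.
  case: (boolP (s <= u)) => su; last by rewrite mulr0 !mul0r.
  case: (boolP (u <= t)) => ut; last by rewrite mulr0 !mul0r.
  exfalso; apply: H; rewrite /= !in_itv/= s0 ut (le_trans su ut)/=.
  by rewrite (le_trans s0 su).
have F := bounded_Fubini (m1 := mu) (m2 := mu) (measurable_itv _) (measurable_itv _) itvy itvy mq qC q0.
rewrite [LHS]Rintegral_mkcond [RHS]Rintegral_mkcond.
transitivity (\int[mu]_s (\int[mu]_u q (s, u))).
  apply: eq_Rintegral => s _; rewrite patchE; case: ifPn => [|sD].
    rewrite inE/= in_itv/= => /andP[s0 st].
    rewrite Rintegral_itv_indic; apply: eq_Rintegral => u _.
    by rewrite /q/= s0 mul1r.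
  rewrite notin_setE in sD.
  transitivity (\int[mu]_u (0 : R)); first by rewrite Rintegral_cst// mul0r.
  by apply: eq_Rintegral => u _; rewrite q0// => -[].
rewrite F; apply: eq_Rintegral => u _; rewrite patchE; case: ifPn => [|uD].
  rewrite inE/= in_itv/= => /andP[u0 ut].
  rewrite Rintegral_itv_indic; apply: eq_Rintegral => s _.
  by rewrite /q/= ut mulr1.
rewrite notin_setE in uD.
transitivity (\int[mu]_u (0 : R)); last by rewrite Rintegral_cst// mul0r.
by apply: eq_Rintegral => s _; rewrite q0// => -[].
Qed.

End triangle.

(** * The time-ordered exponential *)

Section ordered_exponential_theory.
Context {R : realType} {d : nat}.
Notation mu := (@lebesgue_measure R).
Notation mR := (measurableTypeR R).
Variables (A : R -> 'M[R]_d) (K : R).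
Hypothesis Ac : continuous A.
Hypothesis AK : forall u, `|A u| <= K.

Notation P n s t := (ordered_power A s n t).

Let mA i j : measurable_fun setT (fun u : mR => A u i j).
Proof.
have cA : continuous (fun u : R => A u i j).
  by move=> u; apply: cvg_mx_coord; exact: Ac.
exact: continuous_measurable_fun cA.
Qed.

Lemma ordered_power_measurable n i j :
  measurable_fun setT (fun p : mR * mR => P n p.1 p.2 i j).
Proof.
elim: n i j => [|n IH] i j; first exact: measurable_cst.
have mg : measurable_fun setT (fun q : mR * mR => (P n q.1 q.2 *m A q.2) i j).
  apply: (@measurable_mulmx _ _ R) => // k l.
  exact: (measurableT_comp (mA k l) measurable_snd).
have := measurable_Rintegral_itv mg.
by apply: eq_measurable_fun => p _; rewrite /= mxE.
Qed.

Lemma ordered_power_measurable1 n s i j :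
  measurable_fun setT (fun u : mR => P n s u i j).
Proof.
exact: (measurableT_comp (ordered_power_measurable n i j) (@measurable_pair1 _ _ mR mR s)).
Qed.

Lemma ordered_power_measurable2 n t i j :
  measurable_fun setT (fun s : mR => P n s t i j).
Proof.
exact: (measurableT_comp (ordered_power_measurable n i j) (@measurable_pair2 _ _ mR mR t)).
Qed.

Let K0 : 0 <= K := le_trans (normr_ge0 _) (AK 0).
Let c : R := d%:R * K + 1.
Let c0 : 0 < c.
Proof. by rewrite ltr_wpDl// mulr_ge0. Qed.

(** This is exp(2 c (t - s)), with a rate c that exceeds the norm of the
    multiplication by A. *)
Definition resolvent_bound (s t : R) : R := expR (- (2 * c * s)) * expR (2 * c * t).

Lemma resolvent_bound_ge1 s t : s <= t -> 1 <= resolvent_bound s t.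
Proof.
move=> st; rewrite /resolvent_bound -expRD -[leLHS]expR0 ler_expR.
by rewrite addrC subr_ge0 ler_wpM2l// mulr_ge0// ltW.
Qed.

Lemma itv_lty (s t : R) : (mu `[s, t] < +oo)%E.
Proof.
by rewrite /= lebesgue_measure_itv/= lte_fin; case: ifP => _; rewrite ?ltry// -EFinB ltry.
Qed.

Lemma ordered_power_integrable n s t :
  (forall u, s <= u <= t -> `|P n s u| <= 2^-1 ^+ n * resolvent_bound s u) ->
  mx_integrable mu `[s, t] (fun u => P n s u *m A u).
Proof.
move=> Pb; apply: (@mx_bounded_integrable _ _ _ _ _ _ _
    (d%:R * (2^-1 ^+ n * resolvent_bound s t) * K)) => //.
- exact: itv_lty.
- move=> i j; apply: measurable_funTS; apply: (@measurable_mulmx _ _ R) => // k l.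
  exact: ordered_power_measurable1.
- move=> u /=; rewrite in_itv/= => sut.
  rewrite (le_trans (mx_norm_mul _ _))// ler_pM ?mulr_ge0// ler_wpM2l//.
  rewrite (le_trans (Pb u sut))// ler_wpM2l ?exprn_ge0 ?invr_ge0//.
  rewrite /resolvent_bound ler_wpM2l ?expR_ge0// ler_expR ler_wpM2l//.
    by rewrite mulr_ge0// ltW.
  by case/andP: sut.
Qed.

(** The same exponential weight as for Gronwall's inequality: every further
    integration gains a factor 1/2. *)
Lemma ordered_power_norm n s t : s <= t ->
  `|P n s t| <= 2^-1 ^+ n * resolvent_bound s t.
Proof.
elim: n t => [|n IH] t st.
  rewrite expr0 mul1r (le_trans _ (resolvent_bound_ge1 st))//.
  apply: mx_norm_le => // i j; rewrite mxE.
  by case: (_ == _); rewrite ?normr1 ?normr0 ?ler01.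
have IH' u : s <= u <= t -> `|P n s u| <= 2^-1 ^+ n * resolvent_bound s u.
  by move=> /andP[su _]; exact: IH.
pose g : R := c * (2^-1 ^+ n * expR (- (2 * c * s))).
have gi : mu.-integrable `[s, t] (EFin \o (fun u => expR (2 * c * u))).
  apply: continuous_compact_integrable; first exact: segment_compact.
  exact/continuous_subspaceT/continuous_expR_scale.
apply: (@le_trans _ _ (\int[mu]_(u in `[s, t]) (g * expR (2 * c * u)))).
  apply: mxint_norm_le => //.
  - exact: ordered_power_integrable.
  - exact: integrableZlR.
  - move=> u /=; rewrite in_itv/= => sut.
    rewrite (le_trans (mx_norm_mul _ _))// /g.
    rewrite (_ : c * _ * _ = 2^-1 ^+ n * resolvent_bound s u * c); last first.
      by rewrite /resolvent_bound; ring.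
    rewrite mulrAC mulrC ler_pM ?mulr_ge0 ?IH'//.
    by rewrite /c ler_wpDr// ler_wpM2l.
rewrite RintegralZl// Rintegral_expR//; last by rewrite mulr_gt0.
rewrite (_ : g * _ = 2^-1 ^+ n.+1 * (resolvent_bound s t - 1)).
  by rewrite ler_wpM2l ?exprn_ge0 ?invr_ge0// lerBlDr lerDl.
rewrite /g /resolvent_bound exprS -[X in _ * (_ - X)](mulVf (x := expR (2 * c * s))).
  by rewrite expRN; field; rewrite !gt_eqF ?expR_gt0.
by rewrite gt_eqF ?expR_gt0.
Qed.

Notation U N s t := (series (fun n => P n s t) N).

Lemma ordered_series_tail s t N k : s <= t ->
  `|U (N + k)%N s t - U N s t| <=
    (2 * 2^-1 ^+ N - 2 * 2^-1 ^+ (N + k)) * resolvent_bound s t.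
Proof.
move=> st; elim: k => [|k IH].
  by rewrite addn0 !subrr mul0r normr0.
rewrite addnS seriesSr addrAC (le_trans (ler_normD _ _))//.
have := ordered_power_norm (N + k) st; move: IH; rewrite exprS.
set x := `|_|; set y := `|_|; set p := 2^-1 ^+ (N + k); set q := 2^-1 ^+ N.
set b := resolvent_bound s t => H1 H2.
rewrite (_ : (_ - _) * b = (2 * q - 2 * p) * b + p * b); first exact: lerD.
by field.
Qed.

Lemma is_cvg_geometric_bound (u : nat -> R) (C : R) :
  (forall n, `|u n| <= 2^-1 ^+ n * C) -> cvgn (series u).
Proof.
move=> uC; apply: normed_cvg.
apply: (@series_le_cvg _ _ (geometric C 2^-1)) => [n|n|n|] /=.
- exact: normr_ge0.
- by rewrite mulrC (le_trans _ (uC n)).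
- by rewrite /= mulrC.
- by apply: is_cvg_geometric_series; rewrite ger0_norm ?invr_ge0// invf_lt1// ltr1n.
Qed.

(** The entries of the partial sums are scalar series dominated by a geometric
    series. *)
Lemma ordered_expmx_cvg s t : s <= t ->
  U N s t @[N --> \oo] --> ordered_expmx A s t.
Proof.
move=> st; suff [L UL] : exists L : 'M[R]_d, U N s t @[N --> \oo] --> L.
  exact: (cvgP L UL).
exists (\matrix_(i, j) limn (series (fun n => P n s t i j))).
apply: cvg_mxP => i j; rewrite mxE.
have EU : (fun N => U N s t i j) = series (fun n => P n s t i j).
  by apply/funext => N; rewrite !seriesEnat/= summxE.
rewrite EU; apply: (@is_cvg_geometric_bound _ (resolvent_bound s t)) => n.
by rewrite (le_trans (mx_coord_le _ _ _))// ordered_power_norm.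
Qed.

Lemma ordered_expmx_tail s t N : s <= t ->
  `|ordered_expmx A s t - U N s t| <= 2 * 2^-1 ^+ N * resolvent_bound s t.
Proof.
move=> st; apply/ler_addgt0Pr => e e0.
have /cvgrPdist_le /(_ e e0) [M _ /(_ (N + M)%N (leq_addl _ _)) /= H] :=
  ordered_expmx_cvg st.
rewrite (le_trans (ler_distD (U (N + M)%N s t) _ _))// addrC lerD//.
rewrite (le_trans (ordered_series_tail N M st))// mulrBl lerBlDr lerDl.
rewrite !mulr_ge0 ?exprn_ge0 ?invr_ge0// ?expR_ge0//.
Qed.

Variables (m : nat) (B : R -> 'M[R]_(m, d)) (Kb T : R).
Hypothesis Bc : continuous B.
Hypothesis BK : forall u, `|B u| <= Kb.
Hypothesis T0 : 0 <= T.

Let Kb0 : 0 <= Kb := le_trans (normr_ge0 _) (BK 0).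

Let mB i j : measurable_fun setT (fun u : mR => B u i j).
Proof.
have cB : continuous (fun u : R => B u i j).
  by move=> u; apply: cvg_mx_coord; exact: Bc.
exact: continuous_measurable_fun cB.
Qed.

Let BP n s t : `|B s *m P n s t| <= d%:R * Kb * `|P n s t|.
Proof. by rewrite (le_trans (mx_norm_mul _ _))// ler_wpM2r// ler_wpM2l. Qed.

Let E := resolvent_bound 0 T.

Let E1 : 1 <= E. Proof. exact: resolvent_bound_ge1. Qed.

Let boundE s t : 0 <= s -> s <= t -> t <= T -> resolvent_bound s t <= E.
Proof.
move=> s0 st tT; have c2 : 0 <= 2 * c by rewrite mulr_ge0// ltW.
rewrite /E /resolvent_bound; apply: ler_pM; rewrite ?expR_ge0// ler_expR.
  by rewrite lerN2 mulr0 mulr_ge0.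
exact: ler_wpM2l.
Qed.

Let powE n s t : 0 <= s -> s <= t -> t <= T -> `|P n s t| <= 2^-1 ^+ n * E.
Proof.
move=> s0 st tT; rewrite (le_trans (ordered_power_norm n st))//.
by rewrite ler_wpM2l ?exprn_ge0 ?invr_ge0// boundE.
Qed.

Definition iterated_integral n t := mxint mu `[0, t] (fun s => B s *m P n s t).
Notation J := iterated_integral.

Let iB n t : t <= T -> mx_integrable mu `[0, t] (fun s => B s *m P n s t).
Proof.
move=> tT; apply: (@mx_bounded_integrable _ _ _ _ _ _ _ (d%:R * Kb * (2^-1 ^+ n * E))) => //.
- exact: itv_lty.
- move=> i j; apply: measurable_funTS; apply: (@measurable_mulmx _ _ R) => // k l.
  exact: ordered_power_measurable2.
- move=> s /=; rewrite in_itv/= => /andP[s0 st].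
  by rewrite (le_trans (BP _ _ _))// ler_wpM2l ?mulr_ge0// powE.
Qed.

(** Fubini on the triangle 0 <= s <= u <= t, the variable u being the last, i.e.
    the largest, of the times in the ordered power. *)
Lemma iterated_integralS n t : t <= T ->
  J n.+1 t = mxint mu `[0, t] (fun u => J n u *m A u).
Proof.
move=> tT; apply/matrixP => i j; rewrite !mxE.
pose g (q : mR * mR) := (B q.1 *m P n q.1 q.2 *m A q.2) i j.
have mg : measurable_fun setT g.
  apply: (@measurable_mulmx _ _ R); last first.
    by move=> k l; exact: (measurableT_comp (mA k l) measurable_snd).
  apply: (@measurable_mulmx _ _ R) => k l; last exact: ordered_power_measurable.
  exact: (measurableT_comp (mB k l) measurable_fst).
transitivity (\int[mu]_(s in `[0, t]) (\int[mu]_(u in `[s, t]) g (s, u))).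
  apply: eq_Rintegral => s; rewrite inE/= in_itv/= => /andP[s0 st].
  rewrite -mxint_mull//.
    by rewrite mxE; apply: eq_Rintegral => u _; rewrite mulmxA.
  apply: ordered_power_integrable => u /andP[su ut]; exact: ordered_power_norm.
rewrite (@Fubini_triangle _ _ (d%:R * (d%:R * Kb * (2^-1 ^+ n * E)) * K))//; last first.
  move=> s u s0 su ut; rewrite (le_trans (mx_coord_le _ _ _))// (le_trans (mx_norm_mul _ _))//.
  rewrite /= ler_pM ?mulr_ge0// ler_wpM2l// (le_trans (BP _ _ _))// ler_wpM2l ?mulr_ge0//.
  by rewrite powE// (le_trans ut).
apply: eq_Rintegral => u; rewrite inE/= in_itv/= => /andP[u0 ut].
rewrite -mxint_mulr//; last by apply: iB; exact: le_trans tT.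
by rewrite mxE.
Qed.

Lemma iterated_integral_cont n : cont_path T (J n).
Proof.
elim: n => [|n IH].
  have E0 : J 0 = fun t => mxint mu `[0, t] B.
    by apply/funext => t; apply: eq_mxint => s _; rewrite mulmx1.
  rewrite E0; apply: (@cont_path_mxint _ _ _ _ Kb) => //.
  by apply: (@cont_path_mx_integrable _ _ _ T) => //; exact: continuous_subspaceT.
have JA : cont_path T (fun u => J n u *m A u).
  by apply: cont_path_mul => //; exact: continuous_subspaceT.
have [C _ JC] := cont_path_bounded T0 JA.
have := cont_path_mxint (cont_path_mx_integrable JA (lexx _) (lexx _)) JC.
by apply: eq_cont_path => t /andP[_ tT]; rewrite iterated_integralS.
Qed.

Definition resolvent_integral t :=
  mxint mu `[0, t] (fun s => B s *m ordered_expmx A s t).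

(** The geometric tail bound of the exponential is uniform on the triangle and
    can be integrated. *)
Lemma resolvent_integral_tail N t : 0 <= t <= T ->
  `|resolvent_integral t - \sum_(n < N) J n t| <=
    2^-1 ^+ N * (2 * d%:R * Kb * E * T).
Proof.
move=> /andP[t0 tT].
have UB : mx_integrable mu `[0, t] (fun s => B s *m ordered_expmx A s t).
  apply: (@mx_bounded_integrable _ _ _ _ _ _ _ (d%:R * Kb * (2 * E))) => //.
  - exact: itv_lty.
  - move=> i j.
    apply: (@measurable_fun_cvg _ _ _ _ (fun N s => (B s *m U N s t) i j)) => [M|s].
      apply: measurable_funTS; apply: (@measurable_mulmx _ _ R) => // k l.
      rewrite (_ : (fun s => _) = fun s => \sum_(0 <= n < M) P n s t k l).
        by apply: measurable_sum => n; exact: ordered_power_measurable2.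
      by apply/funext => s; rewrite seriesEnat summxE.
    rewrite /= in_itv/= => /andP[s0 st]; apply: cvg_mx_coord.
    apply: cvg_mxP => k l; rewrite mxE; under eq_fun do rewrite mxE.
    apply: Defs.cvg_sumR => q; apply: cvgM; first exact: cvg_cst.
    by apply: cvg_mx_coord; exact: ordered_expmx_cvg.
  - move=> s /=; rewrite in_itv/= => /andP[s0 st].
    rewrite (le_trans (mx_norm_mul _ _))// ler_pM ?mulr_ge0// ?ler_wpM2l//.
    have := @ordered_expmx_tail s t 0 st; rewrite expr0 mulr1 seriesEnat/= big_geq// subr0.
    by move=> /le_trans; apply; rewrite ler_wpM2l// boundE.
have U0 : (fun s => B s *m U 0%N s t) = fun=> 0.
  by apply/funext => s; rewrite seriesEnat/= big_geq// mulmx0.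
have iU M : mx_integrable mu `[0, t] (fun s => B s *m U M s t).
  elim: M => [|M IH].
    rewrite U0 => i j; apply: (@bounded_integrable _ _ _ _ _ 0) => //.
      exact: itv_lty.
    by move=> s _; rewrite mxE normr0.
  rewrite (_ : (fun s => _) = fun s => B s *m U M s t + B s *m P M s t); last first.
    by apply/funext => s; rewrite seriesSr mulmxDr.
  by apply: mx_integrableD => //; exact: iB.
have -> : \sum_(n < N) J n t = mxint mu `[0, t] (fun s => B s *m U N s t).
  rewrite -(big_mkord xpredT (fun n => J n t)).
  elim: N => [|N IH].
    by rewrite big_geq// U0 mxint_cst// scaler0.
  rewrite big_nat_recr//= IH -mxintD//; last exact: iB.
  by apply: eq_mxint => s _; rewrite -mulmxDr -seriesSr.
rewrite -mxintB//.
apply: (@le_trans _ _ (\int[mu]_(s in `[0, t]) (d%:R * Kb * (2 * 2^-1 ^+ N * E)))).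
  apply: mxint_norm_le => //.
  - by apply: mx_integrableB => //; exact: iU.
  - apply: (@bounded_integrable _ _ _ _ _ `|d%:R * Kb * (2 * 2^-1 ^+ N * E)|) => //.
    exact: itv_lty.
  - move=> s /=; rewrite in_itv/= => /andP[s0 st].
    rewrite -mulmxBr (le_trans (mx_norm_mul _ _))// ler_pM ?mulr_ge0// ?ler_wpM2l//.
    apply: le_trans (ordered_expmx_tail N st) _.
    by apply: ler_wpM2l; [rewrite mulr_ge0 ?exprn_ge0 ?invr_ge0|exact: boundE].
have E0 : 0 <= E := le_trans ler01 E1.
have muT : fine (mu `[0%R, t]) <= T.
  rewrite /= lebesgue_measure_itv/= lte_fin; case: ltP => // _ /=.
  by rewrite subr0.
rewrite Rintegral_cst//.
rewrite [leRHS](_ : _ = d%:R * Kb * (2 * 2^-1 ^+ N * E) * T); last by ring.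
by apply: ler_wpM2l => //; rewrite !mulr_ge0 ?exprn_ge0 ?invr_ge0.
Qed.

End ordered_exponential_theory.

(** * The linear Volterra equation *)

Section volterra.
Context {R : realType}.
Notation mu := (@lebesgue_measure R).

Lemma unif_limit_cont_path {V : normedModType R} (T : R) (y : R -> V) :
  (forall e : R, 0 < e -> exists2 z, cont_path T z & unif_le T e y z) ->
  cont_path T y.
Proof.
move=> H; apply/subspace_continuousP => t tT; apply/cvgrPdist_le => e e0.
have e3 : 0 < e / 3 by rewrite divr_gt0.
have [z zc yz] := H _ e3.
have /subspace_continuousP /(_ t tT) /cvgrPdist_le /(_ _ e3) := zc.
rewrite /within/= !near_withinE; apply: filterS => s zs sT.
move: tT (sT); rewrite /= !in_itv/= => /yz yzt /yz yzs.
rewrite (le_trans (ler_distD (z t) _ _))// (le_trans (lerD (lexx _) (ler_distD (z s) _ _)))//.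
rewrite (distrC (z s) (y s)); have := zs sT; move: yzt yzs.
by move: `|_| `|_| `|_| => a b c; lra.
Qed.

Lemma geometric_le0 (x C : R) : (forall N, x <= 2^-1 ^+ N * C) -> x <= 0.
Proof.
move=> H; rewrite leNgt; apply/negP => x0.
have h1 : `|2^-1 : R| < 1 by rewrite ger0_norm ?invr_ge0// invf_lt1// ltr1n.
have [N _ /(_ N (leqnn N)) /=] := cvgr_lt _ (cvg_geometric C h1) _ x0.
by rewrite mulrC ltNge H.
Qed.

(** Variation of constants for y = V + int y A. *)
Definition volterra_sol {m d : nat} (A : R -> 'M[R]_d) (V : R -> 'M[R]_(m, d))
    (t : R) : 'M[R]_(m, d) :=
  V t + mxint mu `[0, t] (fun s => V s *m A s *m ordered_expmx A s t).

Lemma eq_ordered_expmx {d : nat} (A A' : R -> 'M[R]_d) s t :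
  (forall u, s <= u <= t -> A u = A' u) ->
  ordered_expmx A s t = ordered_expmx A' s t.
Proof.
move=> AA; have E n : forall v, v <= t -> ordered_power A s n v = ordered_power A' s n v.
  elim: n => [//|n IH] v vt /=.
  apply: eq_mxint => u /=; rewrite in_itv/= => /andP[su uv].
  by rewrite AA ?su ?(le_trans uv)// IH ?(le_trans uv).
rewrite /ordered_expmx; congr (limn _); apply/funext => N.
by rewrite !seriesEnat; apply: eq_bigr => n _; exact: E.
Qed.

(** Composition with it extends a path from [0, T] to a path that is continuous
    on the whole line, with the same values on [0, T]. *)
Definition clamp (T s : R) : R := Num.min T (Num.max 0 s).

Lemma clamp_id T s : 0 <= s <= T -> clamp T s = s.
Proof. by move=> /andP[s0 sT]; rewrite /clamp max_r// min_r. Qed.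

Lemma clamp_itv T s : 0 <= T -> 0 <= clamp T s <= T.
Proof. by move=> T0; rewrite /clamp le_min T0 le_max lexx/= ge_min lexx. Qed.

Lemma cont_path_clamp {V : normedModType R} T (y : R -> V) : 0 <= T ->
  cont_path T y -> continuous (y \o clamp T).
Proof.
move=> T0 yc s.
have cc : {for s, continuous (clamp T)}.
  have c0 : {for s, continuous (cst (0 : R) \max id)}.
    by apply: (@continuous_max _ _ (cst 0) id); [exact: cvg_cst|exact: cvg_id].
  suff : {for s, continuous (cst T \min (cst (0 : R) \max id))} by [].
  by apply: continuous_min c0; exact: cvg_cst.
have cT : `[0, T]%classic (clamp T s) by rewrite /= in_itv/= clamp_itv.
have /subspace_continuousP /(_ _ cT) /cvgrPdist_le yc' := yc.
apply/cvgrPdist_le => e e0; have := yc' e e0; rewrite near_withinE => /cc H.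
have {}H : \forall u \near s, `[0, T]%classic (clamp T u) ->
    `|y (clamp T s) - y (clamp T u)| <= e by exact: H.
by apply: filterS H => u /=; apply; rewrite in_itv/= clamp_itv.
Qed.

(** Expanding the ordered exponential turns the formula into V + sum_n J_n, where
    J_(n+1) = int J_n A and J_0 = int V A.  Its partial sums L_N therefore satisfy
    L_(N+1) = V + int L_N A, which passes to the limit as the tails are uniformly
    geometric. *)
Lemma volterra_solP {m d : nat} (T : R) (A : R -> 'M[R]_d) (V : R -> 'M[R]_(m, d)) :
  0 <= T -> cont_path T A -> cont_path T V ->
  cont_path T (volterra_sol A V) /\
  (forall t, 0 <= t <= T -> volterra_sol A V t =
     V t + mxint mu `[0, t] (fun s => volterra_sol A V s *m A s)).
Proof.
move=> T0 Ac Vc.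
pose A' := A \o clamp T; pose B := (fun s => V s *m A s) \o clamp T.
have A'c : continuous A' by exact: cont_path_clamp.
have Bc : continuous B by apply: cont_path_clamp => //; exact: cont_path_mul.
have [K K0 AK] := cont_path_bounded T0 Ac.
have [Kb Kb0 VK] := cont_path_bounded T0 (cont_path_mul Vc Ac).
have A'K u : `|A' u| <= K by apply: AK; exact: clamp_itv.
have BK u : `|B u| <= Kb by apply: VK; exact: clamp_itv.
pose J := iterated_integral A' B.
have Y'E t : 0 <= t <= T -> volterra_sol A V t = V t + resolvent_integral A' B t.
  move=> /andP[t0 tT]; congr (_ + _); apply: eq_mxint => s /=.
  rewrite in_itv/= => /andP[s0 st]; rewrite /B/= clamp_id ?s0 ?(le_trans st)//.
  congr (_ *m _); apply: eq_ordered_expmx => u /andP[su ut].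
  by rewrite /A'/= clamp_id// (le_trans s0 su) (le_trans ut).
pose L N t := V t + \sum_(n < N) J n t.
have Jc n : cont_path T (J n) by exact: iterated_integral_cont.
have Lc N : cont_path T (L N).
  by apply: cont_pathD => //; exact: cont_path_sum.
pose C := 2 * d%:R * Kb * resolvent_bound (d := d) K 0 T * T.
have C0 : 0 <= C by rewrite !mulr_ge0// ?expR_ge0.
have LY N : unif_le T (2^-1 ^+ N * C) (volterra_sol A V) (L N).
  move=> t tT; rewrite Y'E// /L opprD addrACA subrr add0r.
  exact: resolvent_integral_tail.
have Yc : cont_path T (volterra_sol A V).
  apply: unif_limit_cont_path => e e0.
  have h1 : `|2^-1 : R| < 1 by rewrite ger0_norm ?invr_ge0// invf_lt1// ltr1n.
  have [N _ /(_ N (leqnn N)) /= H] := cvgr_lt _ (cvg_geometric C h1) _ e0.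
  exists (L N) => // t /(LY N) /le_trans; apply.
  by rewrite mulrC ltW.
split => // t tT.
have /andP[t0 tT'] := tT.
have iA (F : R -> 'M[R]_(m, d)) : cont_path T F -> mx_integrable mu `[0, t] (fun s => F s *m A s).
  move=> Fc; apply: (@cont_path_mx_integrable _ _ _ T) => //; exact: cont_path_mul.
have LS N : L N.+1 t = V t + mxint mu `[0, t] (fun s => L N s *m A s).
  rewrite /L; congr (_ + _).
  rewrite (_ : (fun s => _) = fun s => V s *m A s + (\sum_(n < N) J n s) *m A s); last first.
    by apply/funext => s; rewrite mulmxDl.
  rewrite mxintD//; last 2 first.
  - exact: iA.
  - by apply: iA; exact: cont_path_sum.
  rewrite big_ord_recl; congr (_ + _).
    apply: eq_mxint => s /=; rewrite in_itv/= => /andP[s0 st].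
    by rewrite mulmx1 /B/= clamp_id// s0 (le_trans st).
  elim: N => [|N IH].
    rewrite big_ord0 (_ : (fun s => _) = fun=> 0); first by rewrite mxint_cst// scaler0.
    by apply/funext => s; rewrite big_ord0 mul0mx.
  have JE : (fun s => (\sum_(n < N.+1) J n s) *m A s) =
      fun s => (\sum_(n < N) J n s) *m A s + J N s *m A s.
    by apply/funext => s; rewrite big_ord_recr/= mulmxDl.
  rewrite JE big_ord_recr/= IH mxintD//; last 2 first.
  - by apply: iA; exact: cont_path_sum.
  - exact: iA.
  congr (_ + _); rewrite /J (iterated_integralS A'c A'K Bc BK N tT').
  apply: eq_mxint => s /=; rewrite in_itv/= => /andP[s0 st].
  by rewrite /A'/= clamp_id// s0 (le_trans st).
apply/eqP; rewrite -subr_eq0 -normr_le0.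
apply: (@geometric_le0 _ (C + d%:R * C * K * T)) => N.
set Y := volterra_sol A V in Yc LY *.
rewrite opprD addrA.
rewrite (_ : Y t - V t - _ = (Y t - L N.+1 t) - mxint mu `[0, t] (fun s => (Y s - L N s) *m A s)).
  rewrite mulrDr (le_trans (ler_normB _ _))// lerD//.
    rewrite (le_trans (LY N.+1 t tT))// exprS ler_wpM2r//.
    by rewrite ler_piMl ?exprn_ge0 ?invr_ge0// invf_le1// ler1n.
  have YLA : mx_integrable mu `[0, t] (fun s => (Y s - L N s) *m A s).
    by apply: iA; exact: cont_pathB.
  pose q := 2^-1 ^+ N * (d%:R * C * K).
  have q0 : 0 <= q by rewrite !mulr_ge0 ?exprn_ge0 ?invr_ge0.
  apply: (@le_trans _ _ (\int[mu]_(s in `[0, t]) q)).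
    apply: mxint_norm_le => //.
      apply: (@bounded_integrable _ _ _ _ _ `|q|) => //; exact: itv_lty.
    move=> s /=; rewrite in_itv/= => /andP[s0 st].
    have sT : 0 <= s <= T by rewrite s0 (le_trans st).
    rewrite (le_trans (mx_norm_mul _ _))// /q mulrA.
    apply: ler_pM; rewrite ?mulr_ge0//; last exact: AK.
    by rewrite mulrCA ler_wpM2l// LY.
  rewrite Rintegral_cst// mulrA -/q; apply: ler_wpM2l => //.
  rewrite /= lebesgue_measure_itv/= lte_fin; case: ltP => // _ /=.
  by rewrite subr0.
rewrite LS (_ : (fun s => (Y s - L N s) *m A s) = fun s => Y s *m A s - L N s *m A s).
  rewrite mxintB//; [|exact: iA|exact: iA].
  by rewrite opprB opprD !addrA subrK.
by apply/funext => s; rewrite mulmxBl.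
Qed.

End volterra.

(** * Riemann sums along a mesh *)

Section mesh.
Context {R : realType}.
Variables (T : R) (n : nat).
Hypothesis T0 : 0 < T.

Lemma grid0 : grid T n 0 = 0. Proof. by rewrite /grid mul0r mulr0. Qed.

Lemma gridn : grid T n n.+1 = T.
Proof. by rewrite /grid divff ?mulr1// pnatr_eq0. Qed.

Lemma le_grid j k : (j <= k)%N -> grid T n j <= grid T n k.
Proof.
by move=> jk; rewrite /grid ler_pM2l// ler_pM2r ?invr_gt0// ler_nat.
Qed.

Lemma gridS j : grid T n j.+1 - grid T n j = T / n.+1%:R.
Proof. by rewrite /grid -mulrBr -mulrBl -natr1 addrAC subrr add0r mul1r. Qed.

(** Stopping at t makes a Riemann sum a path in t. *)
Definition mesh_increment {V : zmodType} (I : R -> V) (t : R) (j : nat) : V :=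
  I (Num.min t (grid T n j.+1)) - I (Num.min t (grid T n j)).

Lemma sum_mesh_increment {V : zmodType} (I : R -> V) t : 0 <= t <= T ->
  \sum_(j < n.+1) mesh_increment I t j = I t - I 0.
Proof.
move=> /andP[t0 tT]; rewrite -(big_mkord xpredT (mesh_increment I t)).
rewrite /mesh_increment telescope_sumr// gridn grid0 min_l// min_r//.
Qed.

Variable mu : {measure set (measurableTypeR R) -> \bar R}.
Hypothesis mu0 : mu [set 0] = 0%E.

Lemma Rintegral_itv00 (f : R -> R) : \int[mu]_(s in `[0, 0]) f s = 0.
Proof.
rewrite set_itv1; transitivity (\int[mu]_(s in [set 0]) (f 0)).
  by apply: eq_Rintegral => x; rewrite inE => ->.
rewrite Rintegral_cst; last exact: measurable_set1.
by rewrite mu0 mulr0.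
Qed.

(** As a point mass at 0 is excluded, the integral is the sum of its increments
    over the cells, on each of which F and G j can be compared. *)
Lemma mesh_approx {m d : nat} (F : R -> 'M[R]_(m, d)) (G : nat -> R -> 'M[R]_(m, d))
    (l : R -> R) (c t : R) : 0 <= c ->
  mx_integrable mu `[0, T] F -> (forall j, mx_integrable mu `[0, T] (G j)) ->
  mu.-integrable `[0, T] (EFin \o l) ->
  (forall s, 0 <= s <= T -> 0 <= l s) ->
  (forall j s, (j < n.+1)%N -> grid T n j <= s <= grid T n j.+1 ->
    `|F s - G j s| <= c * l s) ->
  0 <= t <= T ->
  `|mxint mu `[0, t] F -
    \sum_(j < n.+1) mesh_increment (fun u => mxint mu `[0, u] (G j)) t j| <=
  c * \int[mu]_(s in `[0, T]) l s.
Proof.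
move=> c0 Fi Gi li l0 FG tT; have /andP[t0 tT'] := tT.
have F0 : mxint mu `[0, 0] F = 0.
  by apply/matrixP => i j; rewrite !mxE Rintegral_itv00.
have mxiS (X : R -> 'M[R]_(m, d)) a b : 0 <= a -> b <= T -> mx_integrable mu `[0, T] X ->
    mx_integrable mu `[a, b] X /\ mx_integrable mu `]a, b] X.
  move=> a0 bT Xi; split=> i j.
    exact: (@integrable_itvS _ _ _ T a b true false (Xi i j)).
  exact: (@integrable_itvS _ _ _ T a b false false (Xi i j)).
have liS a b : 0 <= a -> b <= T ->
    mu.-integrable `[a, b] (EFin \o l) /\ mu.-integrable `]a, b] (EFin \o l).
  move=> a0 bT; split.
    exact: (@integrable_itvS _ _ _ T a b true false li).
  exact: (@integrable_itvS _ _ _ T a b false false li).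
have -> : mxint mu `[0, t] F =
    \sum_(j < n.+1) mesh_increment (fun u => mxint mu `[0, u] F) t j.
  by rewrite sum_mesh_increment// F0 subr0.
rewrite -sumrB (le_trans (ler_norm_sum _ _ _))//.
apply: (@le_trans _ _ (\sum_(j < n.+1)
    c * mesh_increment (fun u => \int[mu]_(s in `[0, u]) l s) t j)).
  apply: ler_sum => -[j jn] _ /=; rewrite /mesh_increment.
  set b := Num.min t _; set a := Num.min t (grid T n j).
  have a0 : 0 <= a by rewrite /a le_min t0 grid_ge0.
  have ab : a <= b by rewrite /a /b le_min !ge_min lexx/= (le_grid (leqnSn j)) orbT.
  have bT : b <= T by rewrite /b ge_min tT'.
  have [F1 F2] := mxiS F 0 b (lexx 0) bT Fi.
  have [G1 G2] := mxiS (G j) 0 b (lexx 0) bT (Gi j).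
  have [l1 l2] := liS 0 b (lexx 0) bT.
  have [F3 F4] := mxiS F a b a0 bT Fi.
  have [G3 G4] := mxiS (G j) a b a0 bT (Gi j).
  have [l3 l4] := liS a b a0 bT.
  rewrite !mxint_itvB// Rintegral_itvoc// -mxintB// -RintegralZl//.
  apply: mxint_norm_le => //.
  - exact: mx_integrableB.
  - exact: integrableZlR.
  - move=> s /=; rewrite in_itv/= => /andP[a_s sb]; apply: FG => //.
    move: a_s sb; rewrite /a /b gt_min le_min => /orP[ts|/ltW ->] /andP[st ->] //.
    by move: (lt_le_trans ts st); rewrite ltxx.
rewrite -mulr_sumr sum_mesh_increment// Rintegral_itv00 subr0.
rewrite ler_wpM2l// -subr_ge0 Rintegral_itvoc//.
apply: Rintegral_ge0 => s /=; rewrite in_itv/= => /andP[ts sT].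
by apply: l0; rewrite sT (le_trans t0)// ltW.
Qed.

End mesh.

Section stieltjes_measure.
Context {R : realType}.
Variable z : R -> R.
Hypothesis zi : increasing_path z.
Notation mz := (lebesgue_stieltjes_measure (path_ext z)).

Let extE t : 0 <= t -> path_ext z t = z t.
Proof. by move=> t0; rewrite /path_ext; case: asboolP => // _; rewrite max_r. Qed.

Let extN t : t <= 0 -> path_ext z t = z 0.
Proof. by move=> t0; rewrite /path_ext; case: asboolP => // _; rewrite max_l. Qed.

Let oc s t : s <= t -> mz `]s, t] = (path_ext z t - path_ext z s)%:E.
Proof.
move=> st; rewrite /lebesgue_stieltjes_measure /measure_extension/=.
by rewrite measurable_mu_extE/= ?wlength_itv_bnd//; exact: is_ocitv.
Qed.

Lemma stieltjes_set0 : mz [set 0] = 0%E.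
Proof.
apply/eqP; rewrite -measure_le0 -(_ : mz `](-1), 0] = 0%E).
  apply: le_measure; rewrite ?inE//=.
  by move=> x /= ->; rewrite in_itv/= lexx ltrN10.
by rewrite oc ?lerN10// !extN ?lerN10// subrr.
Qed.

Lemma stieltjes_itv t : 0 <= t -> mz `[0, t] = (z t - z 0)%:E.
Proof.
move=> t0; rewrite (@itv_split _ 0)// measureU//.
  by rewrite /= set_itv1 [X in (X + _)%E]stieltjes_set0 add0e [LHS]oc// !extE.
apply/seteqP; split => // x [] /=; rewrite !in_itv/=.
by move=> /andP[_ xs] /andP[/lt_le_trans /(_ xs)]; rewrite ltxx.
Qed.

(** The integrand is replaced by its value at the left end of each cell; its
    variation there is c times the mesh size, and the total mass is z T - z 0. *)
Lemma stieltjes_mesh_approx {m d : nat} (T : R) (n : nat) (H : R -> 'M[R]_(m, d))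
    (c t : R) : 0 < T -> 0 <= c -> mx_integrable mz `[0, T] H ->
  (forall s u, 0 <= s <= T -> 0 <= u <= T -> `|H s - H u| <= c * `|s - u|) ->
  0 <= t <= T ->
  `|stieltjes_int z H t -
    \sum_(j < n.+1) mesh_increment T n z t j *: H (grid T n j)| <=
    c * (T / n.+1%:R) * (z T - z 0).
Proof.
move=> T0 c0 Hi HL tT.
have zy s : 0 <= s -> (mz `[0%R, s] < +oo)%E.
  by move=> s0; rewrite stieltjes_itv// ltry.
have ci (k : R) : (mz : {measure set _ -> \bar R}).-integrable `[0, T] (EFin \o cst k).
  apply: (@bounded_integrable _ _ _ _ _ `|k|) => //; exact: (zy _ (ltW T0)).
have /andP[t0 _] := tT.
have E j u : 0 <= u ->
    mxint mz `[0, u] (cst (H (grid T n j))) = (z u - z 0) *: H (grid T n j).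
  by move=> u0; rewrite mxint_cst// [X in fine X]stieltjes_itv.
have -> : \sum_(j < n.+1) mesh_increment T n z t j *: H (grid T n j) =
    \sum_(j < n.+1) mesh_increment T n
      (fun u => mxint mz `[0, u] (cst (H (grid T n j)))) t j.
  apply: eq_bigr => j _; rewrite /mesh_increment !E ?le_min ?t0 ?grid_ge0//.
  by rewrite -scalerBl opprB addrA subrK.
have I1 : \int[mz]_(s in `[0, T]) cst 1 s = z T - z 0.
  by rewrite Rintegral_cst// mul1r [X in fine X]stieltjes_itv// ltW.
rewrite -I1; apply: (@mesh_approx _ T n T0 mz stieltjes_set0 m d H
  (fun j => cst (H (grid T n j))) (cst 1) (c * (T / n.+1%:R)) t) => //.
- by rewrite !mulr_ge0 ?invr_ge0// ltW.
- move=> j i k; exact: ci.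
- move=> j s jn sj; rewrite mulr1.
  have /andP[s0 s1] := sj.
  have gT : grid T n j.+1 <= T by rewrite -[leRHS](gridn T n) le_grid.
  rewrite (le_trans (HL _ _ _ _))//.
  + by rewrite (le_trans (grid_ge0 _ _ T0) s0) (le_trans s1).
  + by rewrite grid_ge0// (le_trans s0)// (le_trans s1).
  + by rewrite ler_wpM2l// ger0_norm ?subr_ge0// -(gridS T n j) lerD2r.
Qed.

End stieltjes_measure.

(** * Change of time scale, and measurability along the flow *)

Section scaling.
Context {R : realType}.
Notation mu := (@lebesgue_measure R).
Notation mR := (measurableTypeR R).

Definition scale_time (e : R) : mR -> mR := fun s => s / e.

Lemma measurable_scale_time e : measurable_fun setT (scale_time e).
Proof.
have c : continuous (fun s : R => s / e).
  by move=> s; apply: cvgM; [exact: cvg_id|exact: cvg_cst].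
exact: continuous_measurable_fun c.
Qed.

Variable e : R.
Hypothesis e0 : 0 < e.

(** Dividing the image measure by e gives the right measure to the intervals,
    and Lebesgue measure is the only such measure. *)
Lemma lebesgue_scaleE (A : set mR) : measurable A ->
  pushforward mu (scale_time e) A = (e%:E * mu A)%E.
Proof.
move=> mA; have mS := measurable_scale_time e.
have ei : 0 <= e^-1 by rewrite invr_ge0 ltW.
pose pf : {measure set mR -> \bar R} :=
  measure_function_pushforward__canonical__measure_function_Measure mu mS.
pose nu := mscale (NngNum ei) pf.
have -> : mu A = nu A.
  apply: (@lebesgue_measure_unique R nu) => //= _ [[a b]] _ <-.
  rewrite /nu /mscale/= /pushforward.
  have -> : scale_time e @^-1` `]a, b] = `](a * e), (b * e)]%classic.
    apply/seteqP; split => x /=; rewrite !in_itv/= /scale_time;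
      by rewrite ltr_pdivlMr// ler_pdivrMr.
  rewrite !lebesgue_measure_itv/= !lte_fin ltr_pM2r//.
  case: ifP => _; last by rewrite mule0.
  by rewrite -!EFinB -EFinM; congr (_%:E); field; rewrite gt_eqF.
rewrite /nu /mscale/= muleA -EFinM divff ?gt_eqF//.
by rewrite mul1e.
Qed.

(** The positive and negative parts are integrated against the image measure. *)
Lemma Rintegral_scale (g : R -> R) (t B : R) : measurable_fun setT (g : mR -> R) ->
  (forall s, `|g s| <= B) -> 0 <= t ->
  \int[mu]_(s in `[0, t]) g (s / e) = e * \int[mu]_(s in `[0, t / e]) g s.
Proof.
move=> mg gB t0; have mS := measurable_scale_time e.
have pre : scale_time e @^-1` `[0, t / e] = `[0, t]%classic.
  apply/seteqP; split => x /=; rewrite !in_itv/= /scale_time.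
    by move=> /andP[x0]; rewrite ler_pM2r ?invr_gt0// => ->;
      rewrite andbT; move: x0; rewrite pmulr_lge0// invr_gt0.
  by move=> /andP[x0 xt]; rewrite divr_ge0 ?(ltW e0)//= ler_pM2r ?invr_gt0.
have key (f : R -> \bar R) : measurable_fun setT (f : mR -> \bar R) ->
    (forall s, (0 <= f s)%E) ->
    (\int[mu]_(s in `[0%R, t]) f (s / e)%R = e%:E * \int[mu]_(s in `[0%R, (t / e)%R]) f s)%E.
  move=> mf f0.
  have PF := @ge0_integral_pushforward _ _ mR mR R (scale_time e) mS mu `[0, t / e]%classic f.
  rewrite pre in PF; transitivity (\int[pushforward mu (scale_time e)]_(y in `[0%R, (t / e)%R]) f y)%E.
    by rewrite PF//; exact: measurable_funTS.
  have -> : (\int[pushforward mu (scale_time e)]_(y in `[0%R, (t / e)%R]) f y =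
      \int[mscale (NngNum (ltW e0)) mu]_(y in `[0%R, (t / e)%R]) f y)%E.
    by apply: eq_measure_integral => A mA _; rewrite /mscale/= [LHS]lebesgue_scaleE.
  by rewrite ge0_integral_mscale//; exact: measurable_funTS.
have mE : measurable_fun setT (EFin \o g : mR -> \bar R) by exact/measurable_EFinP.
have P1 := key _ (measurable_funepos mE) (funepos_ge0 _).
have P2 := key _ (measurable_funeneg mE) (funeneg_ge0 _).
have lty (s : R) : (mu `[0%R, s] < +oo)%E by exact: itv_lty.
have gi : mu.-integrable `[0, t / e] (EFin \o g).
  by apply: (@bounded_integrable _ _ _ _ _ B) => //; [exact: lty|exact: measurable_funTS].
have F1 : (\int[mu]_(s in `[0%R, (t / e)%R]) (EFin \o g)^\+ s)%E \is a fin_num.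
  by apply: integrable_fin_num => //; apply: integrable_funepos gi.
have F2 : (\int[mu]_(s in `[0%R, (t / e)%R]) (EFin \o g)^\- s)%E \is a fin_num.
  by apply: integrable_fin_num => //; apply: integrable_funeneg gi.
have L : (\int[mu]_(s in `[0%R, t]) (g (s / e)%R)%:E =
    \int[mu]_(s in `[0%R, t]) ((EFin \o g)^\+ (s / e)%R) -
    \int[mu]_(s in `[0%R, t]) ((EFin \o g)^\- (s / e)%R))%E.
  rewrite integralE; congr (_ - _)%E; apply: eq_integral => s _.
    by rewrite !funeposE.
  by rewrite !funenegE.
have L2 : (\int[mu]_(s in `[0%R, (t / e)%R]) (g s)%:E =
    \int[mu]_(s in `[0%R, (t / e)%R]) (EFin \o g)^\+ s -
    \int[mu]_(s in `[0%R, (t / e)%R]) (EFin \o g)^\- s)%E := integralE _ _ _.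
rewrite /Rintegral L P1 P2 L2 -(fineK F1) -(fineK F2).
by rewrite -!EFinM -!EFinB /= mulrBr.
Qed.

End scaling.

Section borel_vectors.
Context {R : realType} {d : nat}.
Notation mR := (measurableTypeR R).

Lemma measurable_borelRV {dT : measure_display} {T : measurableType dT}
    (y : T -> borelRV R d) :
  (forall U : set 'rV[R]_d, open U -> measurable (y @^-1` U)) ->
  measurable_fun setT y.
Proof.
move=> yU; apply: (@measurability _ _ T (borelRV R d) setT y (@open 'rV[R]_d)) => // _ [U oU <-].
by rewrite setTI; exact: yU.
Qed.

Lemma measurable_path_borelRV (y : R -> 'rV[R]_d) : continuous y ->
  measurable_fun setT (y : mR -> borelRV R d).
Proof.
move=> /continuousP yc; apply: measurable_borelRV => U /yc oU.
exact: open_measurable.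
Qed.

Lemma measurable_borelRV_coord i j :
  measurable_fun setT (fun v : borelRV R d => (v : 'rV[R]_d) i j).
Proof.
apply: (measurability _ (RGenInftyO.measurableE R)) => _ [_ [a ->] <-].
rewrite setTI; apply: sub_sigma_algebra.
have /continuousP := @coord_continuous R 1 d i j.
by move=> /(_ `]-oo, a[%classic); apply; exact: open_lt.
Qed.

End borel_vectors.

Section flow_measurability.
Context {R : realType} {d : nat} {dM : measure_display} {M : measurableType dM}.
Notation mR := (measurableTypeR R).
Variables (phi : R -> M -> M) (f : 'rV[R]_d -> M -> 'rV[R]_d).
Hypothesis phi_flow : measurable_flow phi.
Hypothesis mf : measurable_fun [set: borelRV R d * M]
  (fun p => f p.1 p.2 : borelRV R d).

Lemma measurable_flow_fun : measurable_fun setT (fun p : mR * M => phi p.1 p.2).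
Proof. by case: phi_flow. Qed.

Lemma measurable_orbit w : measurable_fun setT (fun s : mR => phi s w).
Proof. exact: (measurableT_comp measurable_flow_fun (measurable_pair2 w)). Qed.

Lemma measurable_field_coord x i j : measurable_fun setT (fun w => f x w i j).
Proof.
apply: (measurableT_comp (measurable_borelRV_coord i j)).
exact: (measurableT_comp mf (measurable_pair1 (x : borelRV R d))).
Qed.

Lemma measurable_field_path (y : R -> 'rV[R]_d) e w i j : continuous y ->
  measurable_fun setT (fun s : mR => f (y s) (phi (s / e) w) i j).
Proof.
move=> yc; apply: (measurableT_comp (measurable_borelRV_coord i j)).
have my := measurable_path_borelRV yc.
have mo := measurableT_comp (measurable_orbit w) (measurable_scale_time e).
exact: (measurableT_comp mf (measurable_fun_pair my mo)).
Qed.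

Lemma measurable_orbit_integral (g : M -> R) (t : R) : measurable_fun setT g ->
  measurable_fun setT (fun w => \int[lebesgue_measure]_(s in `[0, t]) g (phi s w)).
Proof.
move=> mg.
under eq_fun do rewrite Rintegral_itv_indic.
apply: (@measurable_Rintegral_param _ _ M mR R lebesgue_measure
  (fun q : M * mR => (0 <= q.2)%R%:R * (q.2 <= t)%R%:R * g (phi q.2 q.1))).
apply: measurable_funM; first by apply: measurable_funM; exact: measurable_le2.
apply: (measurableT_comp mg).
exact: (measurableT_comp measurable_flow_fun (@measurable_swap _ _ _ _)).
Qed.

End flow_measurability.

(** * Taylor expansion, and autonomous equations *)

Section derivatives_along_segments.
Context {R : realType}.

Lemma is_derive_coord {m n : nat} (f : R -> 'M[R]_(m, n)) (t : R)
    (D : 'M[R]_(m, n)) i j :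
  is_derive t (1 : R) f D -> is_derive t (1 : R) (fun s => f s i j) (D i j).
Proof.
move=> [fd <-]; apply: DeriveDef; first exact: (derivable_mxP _ _ _).1.
by rewrite derive_mx// mxE.
Qed.

Lemma is_derive_segment {V W : normedModType R} (g : V -> W) (w v : V) (s : R) :
  differentiable g (w + s *: v) ->
  is_derive s (1 : R) (fun u => g (w + u *: v)) ('d g (w + s *: v) v).
Proof.
move=> gd; have dd : derivable g (w + s *: v) v by exact: diff_derivable.
have E : (fun h : R => h^-1 *: (((fun u => g (w + u *: v)) \o shift s) (h *: (1 : R)) - g (w + s *: v))) =
    (fun h => h^-1 *: ((g \o shift (w + s *: v)) (h *: v) - g (w + s *: v))).
  apply/funext => h; rewrite /= /shift (_ : h *: (1 : R) = h); last exact: mulr1.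
  by rewrite scalerDl addrCA.
apply: DeriveDef; first by rewrite /derivable E.
by rewrite -deriveE// /derive E.
Qed.

(** The intermediate point depends on the entry, so that entries are treated one
    at a time. *)
Lemma mvt_segment {d m n : nat} (g : 'rV[R]_d -> 'M[R]_(m, n)) (x y : 'rV[R]_d) i j :
  (forall z, differentiable g z) -> exists2 c : R, 0 <= c <= 1 &
    g y i j - g x i j = 'd g (x + c *: (y - x)) (y - x) i j.
Proof.
move=> gd; pose u s := g (x + s *: (y - x)) i j.
have du (s : R) : is_derive s (1 : R) u ('d g (x + s *: (y - x)) (y - x) i j).
  by apply: is_derive_coord; exact: is_derive_segment.
have uc : {within `[0, 1], continuous u}.
  apply: continuous_subspaceT => s; apply: differentiable_continuous.
  by apply/derivable1_diffP; case: (du s).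
have [c] := MVT (ltr01 : (0 : R) < 1) (fun s _ => du s) uc.
rewrite in_itv/= => /andP[/ltW c0 /ltW c1]; rewrite subr0 mulr1 /u.
rewrite scale1r scale0r addr0 (addrC x (y - x)) subrK => E.
by exists c => //; rewrite c0 c1.
Qed.

End derivatives_along_segments.

Section second_order.
Context {R : realType} {d : nat}.
Variables (K : R) (g : 'rV[R]_d -> 'rV[R]_d).
Hypothesis gK : twice_diff_bounded K g.

Let K0 : 0 <= K.
Proof. by have [_ _ + _] := gK 0; apply: le_trans. Qed.

Let gd z : differentiable g z. Proof. by have [] := gK z. Qed.

Let Jd z : differentiable (jacobian g) z. Proof. by have [] := gK z. Qed.

Lemma jacobian_lip x y : `|'J g y - 'J g x| <= K * `|y - x|.
Proof.
apply: mx_norm_le => [|i j]; first by rewrite mulr_ge0.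
have [c _ cE] := mvt_segment x y i j Jd.
have -> : ('J g y - 'J g x) i j = jacobian g y i j - jacobian g x i j.
  by rewrite [LHS]mxE [X in _ + X]mxE.
rewrite cE.
rewrite (le_trans (mx_coord_le _ _ _))//.
by have [_ _ _] := gK (x + c *: (y - x)); exact.
Qed.

(** The differential at the intermediate point is compared to that at x by the
    Lipschitz bound on the Jacobian. *)
Lemma taylor2 x y :
  `|g y - g x - (y - x) *m 'J g x| <= d%:R * K * `|y - x| ^+ 2.
Proof.
apply: mx_norm_le => [|i j]; first by rewrite !mulr_ge0.
have [c /andP[c0 c1] cE] := mvt_segment x y i j gd.
have E : (g y - g x - (y - x) *m 'J g x) i j =
    ((y - x) *m ('J g (x + c *: (y - x)) - 'J g x)) i j.
  rewrite [LHS]mxE [X in X + _]mxE [X in _ + X + _]mxE cE -deriveE//.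
  by rewrite deriveEjacobian// mulmxBr [RHS]mxE.
rewrite E (le_trans (mx_coord_le _ _ _))// (le_trans (mx_norm_mul _ _))//.
rewrite expr2 -!mulrA ler_wpM2l// mulrCA ler_wpM2l//.
rewrite (le_trans (jacobian_lip _ _))// addrC addKr normrZ ger0_norm//.
by rewrite ler_wpM2l// ler_piMl.
Qed.

End second_order.

Lemma lipschitz_continuous {R : realType} {V V' : normedModType R}
    (G : V -> V') (C : R) : lipschitz_with C G -> continuous G.
Proof.
move=> GC v; apply/cvgrPdist_le => e e0; have C1 : 0 < `|C| + 1 by rewrite ltr_wpDl.
near=> u; rewrite (le_trans (GC _ _))//.
apply: (@le_trans _ _ ((`|C| + 1) * (e / (`|C| + 1)))); last first.
  by rewrite mulrC divfK// gt_eqF.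
rewrite (le_trans (ler_wpM2r (normr_ge0 _) (ler_norm C)))//.
apply: ler_pM => //; first by rewrite lerDl.
near: u; apply: cvgr_dist_le; first exact: cvg_id.
by rewrite divr_gt0.
Unshelve. all: by end_near.
Qed.

Lemma cont_path_comp {R : realType} {V V' : normedModType R} (G : V -> V')
    (T : R) (y : R -> V) : continuous G -> cont_path T y -> cont_path T (G \o y).
Proof. by move=> Gc yc t; apply: continuous_cvg; [exact: Gc|exact: yc]. Qed.

Section autonomous.
Context {R : realType} {d : nat}.
Notation mu := (@lebesgue_measure R).
Variables (F : 'rV[R]_d -> 'rV[R]_d) (x : 'rV[R]_d) (W : R -> 'rV[R]_d) (K L : R).
Hypothesis W_sol : solves_autonomous F x W.
Hypothesis FK : forall y, `|F y| <= K.
Hypothesis FL : lipschitz_with L F.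

Let K0 : 0 <= K := le_trans (normr_ge0 _) (FK 0).

Let Wc T : cont_path T W.
Proof. by have [_ Wc _] := W_sol; exact: cont_path_sub. Qed.

Lemma autonomous_field_cont T : cont_path T (F \o W).
Proof.
by apply: cont_path_comp => //; exact: lipschitz_continuous FL.
Qed.

Lemma autonomous_integral t : 0 <= t ->
  W t = x + mxint mu `[0, t] (fun s => F (W s)).
Proof.
have [W0 _ Wd] := W_sol.
rewrite le_eqVlt => /predU1P[<-|t0].
  have -> : mxint mu `[0, 0] (fun s => F (W s)) = 0.
    by apply/matrixP => i j; rewrite !mxE set_itv1 Rintegral_set1.
  by rewrite addr0.
apply/matrixP => i j; rewrite !mxE.
have dW (s : R) : 0 < s -> is_derive s (1 : R) (fun u => W u i j) (F (W s) i j).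
  by move=> s0; apply: is_derive_coord; exact: Wd.
have Wij := @cont_path_coord _ _ _ t W i j (@Wc t).
have [_ W1 W2] := (continuous_within_itvP _ t0).1 Wij.
have := @continuous_FTC2 R (fun s => F (W s) i j) (fun s => W s i j) 0 t t0
  (@cont_path_coord _ _ _ t _ i j (@autonomous_field_cont t)).
rewrite /Rintegral => ->.
- by rewrite /= W0 addrC subrK.
- split => // s; rewrite in_itv/= => /andP[s0 _]; by case: (dW s s0).
- move=> s; rewrite in_itv/= => /andP[s0 _].
  by rewrite derive1E; case: (dW s s0).
Qed.

Lemma autonomous_lip s t : 0 <= s -> s <= t -> `|W t - W s| <= K * (t - s).
Proof.
move=> s0 st; rewrite autonomous_integral ?(le_trans s0)// (autonomous_integral s0).
rewrite opprD addrACA subrr add0r; apply: (@mxint_lip _ _ _ t) => //.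
by apply: (@cont_path_mx_integrable _ _ _ t) => //; exact: autonomous_field_cont.
Qed.

Lemma autonomous_dist s t : 0 <= s -> 0 <= t -> `|W t - W s| <= K * `|t - s|.
Proof.
move=> s0 t0; have [st|/ltW ts] := leP s t.
  by rewrite ger0_norm ?subr_ge0// autonomous_lip.
by rewrite distrC (distrC t) ger0_norm ?subr_ge0// autonomous_lip.
Qed.

End autonomous.

(** * Expansion of the error *)

Section perturbed_equation.
Context {R : realType} {d : nat}.
Notation mu := (@lebesgue_measure R).
Notation mR := (measurableTypeR R).
(* F s y is f(y, phi_(s/e) w) at a fixed w and e, l s is the Lipschitz constant of
   F s, and p s is a function of the orbit that dominates l s and |F s (W s)|.
   The error is measured by the integral of p, and not by the uniform bounds B
   and L, which do not depend on e. *)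
Variables (T : R) (F : R -> 'rV[R]_d -> 'rV[R]_d) (g : 'rV[R]_d -> 'rV[R]_d)
  (x : 'rV[R]_d) (X W : R -> 'rV[R]_d) (l p : R -> R) (B K L Lg : R).
Hypothesis T0 : 0 < T.
Hypothesis W_sol : solves_autonomous g x W.
Hypothesis X_sol : solves_caratheodory (fun s y => F s y + g y) x X.
Hypothesis mF : forall y, continuous y -> forall i j,
  measurable_fun setT (fun s : mR => F s (y s) i j).
Hypothesis ml : measurable_fun setT (l : mR -> R).
Hypothesis mp : measurable_fun setT (p : mR -> R).
Hypothesis FB : forall s y, `|F s y| <= B.
Hypothesis lL : forall s, 0 <= l s <= L.
Hypothesis pB : forall s, p s <= B.
Hypothesis lp : forall s, l s <= p s.
Hypothesis Fl : forall s y z, `|F s y - F s z| <= l s * `|y - z|.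
Hypothesis Fp : forall s, 0 <= s <= T -> `|F s (W s)| <= p s.
Hypothesis Lg0 : 0 <= Lg.
Hypothesis gL : lipschitz_with Lg g.
Hypothesis gK : twice_diff_bounded K g.

Let Xc : cont_path T X.
Proof. by case: X_sol => Xc _; exact: cont_path_sub. Qed.

Let Wc : cont_path T W.
Proof. by have [_ Wc _] := W_sol; exact: cont_path_sub. Qed.

Let L0 : 0 <= L.
Proof. by have /andP[? ?] := lL 0; exact: le_trans (_ : _ <= l 0) _. Qed.

Let p0 s : 0 <= p s.
Proof. by have /andP[l0 _] := lL s; exact: le_trans l0 (lp s). Qed.

Let gc (y : R -> 'rV[R]_d) : cont_path T y -> cont_path T (g \o y).
Proof. by move=> yc; apply: cont_path_comp => //; exact: lipschitz_continuous gL. Qed.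

Lemma field_path_integrable (y : R -> 'rV[R]_d) t : cont_path T y -> t <= T ->
  mx_integrable mu `[0, t] (fun s => F s (y s)).
Proof.
move=> yc tT; apply: (@mx_bounded_integrable _ _ _ _ _ _ _ B) => //.
  exact: itv_lty.
move=> i j.
have := mF (cont_path_clamp (ltW T0) yc) i j.
move=> /(measurable_funTS (D := `[0, t]%classic)); apply: eq_measurable_fun => s.
by rewrite inE/= in_itv/= => /andP[s0 st]; rewrite clamp_id// s0 (le_trans st).
Qed.

Let mass := \int[mu]_(s in `[0, T]) p s.

Let pi : mu.-integrable `[0, T] (EFin \o p).
Proof.
apply: (@bounded_integrable _ _ _ _ _ B) => //.
- exact: itv_lty.
- exact: measurable_funTS.
- by move=> s _; rewrite ger0_norm.
Qed.

Let li : mu.-integrable `[0, T] (EFin \o l).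
Proof.
apply: (@bounded_integrable _ _ _ _ _ L) => //.
- exact: itv_lty.
- exact: measurable_funTS.
- by move=> s _; have /andP[? ?] := lL s; rewrite ger0_norm.
Qed.

Let mass0 : 0 <= mass. Proof. exact: Rintegral_ge0. Qed.

Let subi (q : R -> R) t : (forall s, 0 <= q s) -> 0 <= t <= T ->
  mu.-integrable `[0, T] (EFin \o q) ->
  \int[mu]_(s in `[0, t]) q s <= \int[mu]_(s in `[0, T]) q s.
Proof.
move=> q0 /andP[t0 tT] qi; rewrite -subr_ge0 Rintegral_itvoc//.
exact: Rintegral_ge0.
Qed.

Let XWE t : 0 <= t <= T ->
  X t - W t = mxint mu `[0, t] (fun s => F s (W s)) +
    mxint mu `[0, t] (fun s => F s (X s) - F s (W s)) +
    mxint mu `[0, t] (fun s => g (X s) - g (W s)).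
Proof.
move=> /andP[t0 tT].
have gi (y : R -> 'rV[R]_d) : cont_path T y -> mx_integrable mu `[0, t] (fun s => g (y s)).
  by move=> yc; apply: (@cont_path_mx_integrable _ _ _ T) => //; exact: gc.
have [_ XE] := X_sol.
rewrite XE// (autonomous_integral W_sol gL)//.
have E1 : mxint mu `[0, t] (fun s => F s (X s) - F s (W s)) =
    mxint mu `[0, t] (fun s => F s (X s)) - mxint mu `[0, t] (fun s => F s (W s)).
  by rewrite mxintB//; exact: field_path_integrable.
have E2 : mxint mu `[0, t] (fun s => g (X s) - g (W s)) =
    mxint mu `[0, t] (fun s => g (X s)) - mxint mu `[0, t] (fun s => g (W s)).
  by rewrite mxintB//; exact: gi.
have E3 : mxint mu `[0, t] (fun s => F s (X s) + g (X s)) =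
    mxint mu `[0, t] (fun s => F s (X s)) + mxint mu `[0, t] (fun s => g (X s)).
  by rewrite mxintD//; do ?[exact: field_path_integrable|exact: gi].
rewrite E1 E2 E3.
by rewrite [X in _ = X + _]addrC subrK opprD addrACA subrr add0r addrA.
Qed.

Let G := gronwall_cst (L + Lg) T.

Let G0 : 0 < G. Proof. exact: gronwall_cst_gt0. Qed.

Let XWc : cont_path T (fun s => X s - W s). Proof. exact: cont_pathB. Qed.

Let XWn t : t <= T -> mu.-integrable `[0, t] (EFin \o (fun s => `|X s - W s|)).
Proof.
by move=> tT; apply: (@cont_path_integrable _ T) => //; exact: cont_path_norm.
Qed.

Let FXWi t : t <= T -> mx_integrable mu `[0, t] (fun s => F s (X s) - F s (W s)).
Proof.
move=> tT; apply: mx_integrableB => //; exact: field_path_integrable.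
Qed.

Let gXWi t : t <= T -> mx_integrable mu `[0, t] (fun s => g (X s) - g (W s)).
Proof.
move=> tT; apply: (@cont_path_mx_integrable _ _ _ T) => //.
by apply: cont_pathB; exact: gc.
Qed.

(** The uniform Lipschitz constants enter the exponential, which thus stays
    bounded, and the source term is at most the mass of p. *)
Lemma error_bound t : 0 <= t <= T -> `|X t - W t| <= mass * G.
Proof.
move=> tT; apply: (@gronwall _ T mass (L + Lg) (fun t => `|X t - W t|)) => //.
- exact: ltW.
- by rewrite addr_ge0.
- exact: cont_path_norm.
- move=> {tT}t tT; have /andP[t0 t1] := tT; have XWi := XWn t1.
  rewrite XWE// -addrA mulrDl.
  rewrite (le_trans (ler_normD _ _))// lerD//.
    apply: (le_trans _ (subi p0 tT pi)); apply: mxint_norm_le => //.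
    + exact: field_path_integrable.
    + exact: (@integrable_itvS _ _ _ T 0 t true false pi).
    + by move=> s /=; rewrite in_itv/= => /andP[s0 st]; rewrite Fp// s0 (le_trans st).
  rewrite (le_trans (ler_normD _ _))// lerD//.
    rewrite -RintegralZl//; apply: mxint_norm_le => //; [exact: FXWi|exact: integrableZlR|].
    move=> s _; rewrite (le_trans (Fl _ _ _))// ler_wpM2r//.
    by have /andP[] := lL s.
  rewrite -RintegralZl//; apply: mxint_norm_le => //.
    exact: gXWi.
  exact: integrableZlR.
Qed.

Let K0 : 0 <= K.
Proof. by have [_ _ + _] := gK 0; apply: le_trans. Qed.

Definition linearized_field s := 'J g (W s).
Notation A := linearized_field.

Lemma linearized_field_cont : cont_path T A.
Proof.
apply: cont_path_comp => //; apply: (@lipschitz_continuous _ _ _ _ K) => u v.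
exact: (jacobian_lip gK).
Qed.

Lemma linearized_field_bound s : `|A s| <= K.
Proof. by rewrite /A; have [_ _ + _] := gK (W s). Qed.

Definition remainder_cst : R := G + T * (d%:R * K * G ^+ 2) + (L + Lg + d%:R * K) * T * G.

Let lebT t : 0 <= t <= T -> fine (mu `[0%R, t]) <= T.
Proof.
move=> /andP[t0 tT]; rewrite /= lebesgue_measure_itv/= lte_fin; case: ltP => // _ /=.
  by rewrite subr0.
exact: ltW.
Qed.

(** The remainder consists of F s (X s) - F s (W s) and of the second order term
    of g, both quadratic in the mass.  The linear bound replaces the quadratic
    one when the mass is not small. *)
Lemma remainder_bound t : 0 <= t <= T ->
  `|X t - W t - mxint mu `[0, t] (fun s => F s (W s)) -
    mxint mu `[0, t] (fun s => (X s - W s) *m A s)| <=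
  remainder_cst * (mass * Num.min 1 mass).
Proof.
move=> tT; have /andP[t0 t1] := tT.
have Ai : mx_integrable mu `[0, t] (fun s => (X s - W s) *m A s).
  apply: (@cont_path_mx_integrable _ _ _ T) => //.
  by apply: cont_path_mul => //; exact: linearized_field_cont.
pose I1 := mxint mu `[0, t] (fun s => F s (X s) - F s (W s)).
pose I2 := mxint mu `[0, t] (fun s => (g (X s) - g (W s)) - (X s - W s) *m A s).
rewrite (_ : _ - _ = I1 + I2); last first.
  rewrite /I2 mxintB//; last exact: gXWi.
  rewrite XWE// -/I1; set I0 := mxint mu `[0, t] (fun s => F s (W s)).
  by rewrite -(addrA I0) (addrC I0) addrK -addrA.
have I2i : mx_integrable mu `[0, t] (fun s => (g (X s) - g (W s)) - (X s - W s) *m A s).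
  by apply: mx_integrableB => //; exact: gXWi.
have sT s : s \in `[0, t] -> 0 <= s <= T.
  by rewrite in_itv/= => /andP[-> st]; rewrite (le_trans st).
have lit : mu.-integrable `[0, t] (EFin \o l).
  exact: (@integrable_itvS _ _ _ T 0 t true false li).
have csti (q : R) : mu.-integrable `[0, t] (EFin \o cst q).
  apply: (@bounded_integrable _ _ _ _ _ `|q|) => //; exact: itv_lty.
have mG0 : 0 <= mass * G by rewrite mulr_ge0// ltW.
have cst_le (q : R) : 0 <= q -> \int[mu]_(s in `[0, t]) (cst q s) <= T * q.
  by move=> q0; rewrite Rintegral_cst// mulrC ler_wpM2r// lebT.
have l_le_mass : \int[mu]_(s in `[0, t]) l s <= mass.
  apply: (le_trans _ (subi p0 tT pi)); apply: le_Rintegral => //.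
  exact: (@integrable_itvS _ _ _ T 0 t true false pi).
(* Each of the two terms is bounded by a multiple of mass, and by a multiple of
   mass squared. *)
have B1 : `|I1| <= G * (mass * mass).
  apply: (@le_trans _ _ (\int[mu]_(s in `[0, t]) ((mass * G) * l s))).
    apply: mxint_norm_le => //; [exact: FXWi|exact: integrableZlR|].
    move=> s /sT sT'; rewrite (le_trans (Fl _ _ _))// mulrC ler_wpM2r//.
      by have /andP[] := lL s.
    exact: error_bound.
  by rewrite RintegralZl// (mulrC mass G) -mulrA ler_wpM2l ?(ltW G0)// ler_wpM2l.
have B1' : `|I1| <= L * T * G * mass.
  apply: (@le_trans _ _ (\int[mu]_(s in `[0, t]) (cst (L * (mass * G)) s))).
    apply: mxint_norm_le => //; first exact: FXWi.
    move=> s /sT sT'; rewrite (le_trans (Fl _ _ _))//.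
    by apply: ler_pM => //; [have /andP[] := lL s|have /andP[] := lL s|exact: error_bound].
  rewrite (le_trans (cst_le _ _))//; first by rewrite mulr_ge0.
  by rewrite (_ : T * _ = L * T * G * mass)//; ring.
have B2 : `|I2| <= T * (d%:R * K * G ^+ 2) * (mass * mass).
  apply: (@le_trans _ _ (\int[mu]_(s in `[0, t]) (cst (d%:R * K * (mass * G) ^+ 2) s))).
    apply: mxint_norm_le => //.
    move=> s /sT sT'; rewrite (le_trans (taylor2 gK _ _))// ler_wpM2l ?mulr_ge0//.
    by rewrite lerXn2r ?nnegrE// error_bound.
  rewrite (le_trans (cst_le _ _))//; first by rewrite !mulr_ge0.
  by rewrite exprMn (_ : T * _ = T * (d%:R * K * G ^+ 2) * (mass * mass))//; ring.
have B2' : `|I2| <= (Lg + d%:R * K) * T * G * mass.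
  apply: (@le_trans _ _ (\int[mu]_(s in `[0, t]) (cst ((Lg + d%:R * K) * (mass * G)) s))).
    apply: mxint_norm_le => //.
    move=> s /sT sT'; rewrite (le_trans (ler_normB _ _))// mulrDl lerD//.
      by rewrite (le_trans (gL _ _))// ler_wpM2l// error_bound.
    rewrite (le_trans (mx_norm_mul _ _))// mulrAC.
    apply: ler_pM => //; rewrite ?mulr_ge0//; last exact: error_bound.
    by rewrite ler_wpM2l// linearized_field_bound.
  rewrite (le_trans (cst_le _ _))//; first by rewrite !mulr_ge0// addr_ge0// mulr_ge0.
  by rewrite (_ : T * _ = (Lg + d%:R * K) * T * G * mass)//; ring.
rewrite (le_trans (ler_normD _ _))//.
have c1 : 0 <= T * (d%:R * K * G ^+ 2) by rewrite !mulr_ge0 ?exprn_ge0// ltW.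
have c2 : 0 <= (L + Lg + d%:R * K) * T * G.
  by rewrite !mulr_ge0 ?addr_ge0 ?mulr_ge0// ltW.
rewrite /remainder_cst; have G0' := ltW G0.
have [m1|m1] := leP mass 1.
  rewrite (le_trans (lerD B1 B2))// -mulrDl ler_wpM2r ?mulr_ge0//.
  by rewrite lerDl.
rewrite mulr1 (le_trans (lerD B1' B2'))//.
rewrite (_ : _ + _ = (L + Lg + d%:R * K) * T * G * mass); last by ring.
by rewrite ler_wpM2r// lerDr addr_ge0.
Qed.

(** The rescaled error solves the linear Volterra equation with source v up to
    the error on v and the remainder, whence the conclusion by stability. *)
Lemma error_expansion (k c : R) (v : R -> 'rV[R]_d) : 0 < k -> 0 <= c ->
  cont_path T v ->
  (forall t, 0 <= t <= T -> `|k *: mxint mu `[0, t] (fun s => F s (W s)) - v t| <= c) ->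
  unif_le T ((c + remainder_cst * (k * mass * Num.min 1 mass)) *
      gronwall_cst (d%:R * K) T)
    (fun t => k *: (X t - W t)) (volterra_sol A v).
Proof.
move=> k0 c0 vc vF.
have [Yc YE] := volterra_solP (ltW T0) linearized_field_cont vc.
apply: volterra_stability => //.
- exact: ltW.
- rewrite addr_ge0// !mulr_ge0 ?(ltW k0) ?le_min ?ler01//.
  by rewrite !addr_ge0 ?mulr_ge0 ?addr_ge0 ?mulr_ge0 ?exprn_ge0// ltW.
- exact: cont_pathZ.
- exact: linearized_field_cont.
- by move=> t _; exact: linearized_field_bound.
move=> t tT; have /andP[t0 t1] := tT.
set Y := volterra_sol A v in Yc YE *.
have iA (y : R -> 'rV[R]_d) : cont_path T y -> mx_integrable mu `[0, t] (fun s => y s *m A s).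
  move=> yc; apply: (@cont_path_mx_integrable _ _ _ T) => //.
  by apply: cont_path_mul => //; exact: linearized_field_cont.
pose I0 := mxint mu `[0, t] (fun s => F s (W s)).
pose I := mxint mu `[0, t] (fun s => (X s - W s) *m A s).
have -> : mxint mu `[0, t] (fun s => (k *: (X s - W s) - Y s) *m A s) =
    k *: I - mxint mu `[0, t] (fun s => Y s *m A s).
  rewrite /I -mxintZ//; last exact: iA.
  rewrite -mxintB//; last 2 first.
  - by apply: mx_integrableZ => //; exact: iA.
  - exact: iA.
  by apply: eq_mxint => s _; rewrite mulmxBl scalemxAl.
rewrite YE//; set IY := mxint mu `[0, t] (fun s => Y s *m A s).
rewrite (_ : _ - _ = (k *: I0 - v t) + k *: (X t - W t - I0 - I)); last first.
  rewrite [in RHS]scalerBr [in RHS]scalerBr !opprB.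
  move: (k *: (_ - _)) (k *: I0) (k *: I) => a b e0.
  apply/matrixP => i j; rewrite !mxE.
  by move: (a i j) (v t i j) (IY i j) (e0 i j) (b i j) => *; ring.
rewrite (le_trans (ler_normD _ _))// lerD//; first exact: vF.
rewrite normrZ gtr0_norm// (mulrA remainder_cst) (mulrC remainder_cst) -2!mulrA.
by rewrite ler_wpM2l ?(ltW k0)// mulrCA mulrA -mulrA remainder_bound.
Qed.

End perturbed_equation.

(** * Events of high probability *)

Section high_probability.
Context {d : measure_display} {O : measurableType d} {R : realType}.
Variable P : probability O R.
Implicit Types A B : R -> O -> Prop.

(** The property A may fail to be measurable, whence the measurable exceptional
    set N outside of which it holds. *)
Definition whp_at (eta : R) (A : O -> Prop) : Prop :=
  exists2 N, measurable N /\ (P N <= eta%:E)%E & forall w, ~ N w -> A w.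

Definition whp A : Prop := forall eta, 0 < eta ->
  \forall e \near 0^'+, whp_at eta (A e).

Lemma whp_at_and (eta1 eta2 : R) (A B : O -> Prop) : whp_at eta1 A -> whp_at eta2 B ->
  whp_at (eta1 + eta2) (fun w => A w /\ B w).
Proof.
move=> [N [mN PN] NA] [N' [mN' PN'] NB]; exists (N `|` N').
  split; first exact: measurableU.
  by rewrite (le_trans (measureU2 _ mN mN'))// EFinD leeD.
by move=> w NN; split; [apply: NA|apply: NB] => ?; apply: NN; [left|right].
Qed.

Lemma whp_at_imp (eta : R) (A B : O -> Prop) : (forall w, A w -> B w) ->
  whp_at eta A -> whp_at eta B.
Proof. by move=> AB [N mN NA]; exists N => // w /NA/AB. Qed.

Lemma whp_and A B : whp A -> whp B -> whp (fun e w => A e w /\ B e w).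
Proof.
move=> hA hB eta eta0; have eta2 : 0 < eta / 2 by rewrite divr_gt0.
near=> e; rewrite (splitr eta); apply: whp_at_and.
  by near: e; exact: hA.
by near: e; exact: hB.
Unshelve. all: by end_near.
Qed.

Lemma whp_forall (I : finType) (A : I -> R -> O -> Prop) :
  (forall i, whp (A i)) -> whp (fun e w => forall i, A i e w).
Proof.
move=> hA; suff H (s : seq I) : whp (fun e w => forall i, i \in s -> A i e w).
  move=> eta eta0; have := H (enum I) eta eta0; apply: filterS => e.
  by apply: whp_at_imp => w Aw i; apply: Aw; rewrite mem_enum.
elim: s => [|i s IH].
  move=> eta eta0; apply: nearW => e; exists set0 => //.
  by split => //; rewrite measure0 lee_fin ltW.
have := whp_and (hA i) IH => H eta eta0.
have := H eta eta0; apply: filterS => e; apply: whp_at_imp => w [Ai As] j.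
by rewrite inE => /predU1P[->|/As].
Qed.

Lemma markov_set (f : O -> R) (B c : R) : measurable_fun setT f ->
  (forall w, 0 <= f w <= B) -> 0 < c ->
  measurable [set w | c <= f w] /\
  (P [set w | (c <= f w)%R] <= (c^-1 * \int[P]_w f w)%:E)%E.
Proof.
move=> mf fB c0.
have mN : measurable [set w | c <= f w].
  by rewrite -[X in measurable X]setTI; apply: measurable_fun_le => //; exact: measurable_cst.
split=> //; rewrite -[leLHS]fineK; last first.
  by rewrite ge0_fin_numE// (le_lt_trans (probability_le1 _ _))// ltry.
rewrite lee_fin ler_pdivlMl//.
have mI : measurable_fun setT (\1_[set w | c <= f w] : O -> R) by exact: measurable_indic.
have I1 w : `|\1_[set w | c <= f w] w : R| <= 1.
  by rewrite indicE; case: (_ \in _); rewrite ?normr1 ?normr0 ?ler01.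
have iI := prob_integrable P mI I1.
have -> : fine (P [set w | c <= f w]) = \int[P]_w (\1_[set w | c <= f w] w).
  by rewrite /Rintegral integral_indic// setIT.
rewrite -RintegralZl//; apply: le_Rintegral => //.
- exact: integrableZlR.
- apply: (@prob_integrable _ _ _ P B) => // w; have /andP[f0 ?] := fB w.
  by rewrite ger0_norm.
- move=> w _; rewrite indicE; have /andP[f0 _] := fB w.
  by case: (boolP (w \in _)); rewrite ?mulr0// inE/= mulr1.
Qed.

End high_probability.

Section functionals.
Context {R : realType}.

(** A Lipschitz substitute for the event |z_T| > K. *)
Definition excess (T K : R) (z : R -> R) : R := Num.min 1 (Num.max 0 (`|z T| - K)).

(** A Lipschitz substitute for the event that |z| is large at some time; the cap
    keeps the supremum finite for every path. *)
Definition capped_sup (T : R) (z : R -> R) : R :=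
  sup [set Num.min 1 `|z t| | t in `[0, T]%classic].

Lemma lip_min1 (a b c : R) : `|a - b| <= c -> `|Num.min 1 a - Num.min 1 b| <= c.
Proof.
rewrite /Num.min !ler_norml => /andP[? ?].
by case: ltP => ?; case: ltP => ?; apply/andP; split; lra.
Qed.

Lemma lip_max0 (a b c : R) : `|a - b| <= c -> `|Num.max 0 a - Num.max 0 b| <= c.
Proof.
rewrite /Num.max !ler_norml => /andP[? ?].
by case: ltP => ?; case: ltP => ?; apply/andP; split; lra.
Qed.

Lemma excess_lip (T K : R) : 0 <= T -> lip_functional T 1 (excess T K).
Proof.
move=> T0 y z c c0 _ _ yz; rewrite mul1r; apply/lip_min1/lip_max0.
rewrite opprB addrA subrK; apply: le_trans (ler_dist_dist _ _) _.
by apply: yz; rewrite lexx T0.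
Qed.

Lemma excess_itv (T K : R) (z : R -> R) : 0 <= excess T K z <= 1.
Proof. by rewrite /excess ge_min lexx/= le_min ler01 le_max lexx. Qed.

Lemma capped_sup_has_sup (T : R) (z : R -> R) : 0 <= T ->
  has_sup [set Num.min 1 `|z t| | t in `[0, T]%classic].
Proof.
move=> T0; split; first by exists (Num.min 1 `|z 0|), 0 => //=; rewrite in_itv/= lexx.
by exists 1 => _ [t _ <-]; rewrite ge_min lexx.
Qed.

Lemma capped_sup_itv (T : R) (z : R -> R) : 0 <= T -> 0 <= capped_sup T z <= 1.
Proof.
move=> T0; have [ne ub] := capped_sup_has_sup z T0; apply/andP; split.
  apply: (@le_trans _ _ (Num.min 1 `|z 0|)); first by rewrite le_min ler01/=.
  by apply: ub_le_sup => //; exists 0 => //=; rewrite in_itv/= lexx.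
by apply: ge_sup => // _ [t _ <-]; rewrite ge_min lexx.
Qed.

Lemma capped_sup_lip (T : R) : 0 <= T -> lip_functional T 1 (capped_sup T).
Proof.
move=> T0 y z c c0 _ _ yz; rewrite mul1r.
have half u v : unif_le T c u v -> capped_sup T u <= capped_sup T v + c.
  move=> uv; have [ne ub] := capped_sup_has_sup u T0.
  have [_ ubv] := capped_sup_has_sup v T0.
  apply: ge_sup => // _ [t tT <-]; rewrite -lerBlDr.
  apply: (@le_trans _ _ (Num.min 1 `|v t|)); last by apply: ub_le_sup => //; exists t.
  have : `|Num.min 1 `|u t| - Num.min 1 `|v t| | <= c.
    apply: lip_min1; apply: le_trans (ler_dist_dist _ _) _.
    by apply: uv; move: tT; rewrite /= in_itv.
  by rewrite ler_norml => /andP[_]; rewrite lerBlDr addrC -lerBlDr.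
rewrite ler_norml; apply/andP; split.
  by rewrite lerBrDl lerBlDr; apply: half => t tT; rewrite distrC; exact: yz.
by rewrite lerBlDl; exact: half.
Qed.

Lemma capped_sup_lt (T : R) (z : R -> R) (c : R) : 0 <= T -> c <= 1 -> capped_sup T z < c ->
  forall t, 0 <= t <= T -> `|z t| <= c.
Proof.
move=> T0 c1 zc t tT; have [_ ub] := capped_sup_has_sup z T0.
have : Num.min 1 `|z t| <= capped_sup T z.
  by apply: ub_le_sup => //; exists t => //=; rewrite in_itv.
move=> /le_lt_trans /(_ zc); rewrite gt_min => /orP[|/ltW//].
by rewrite ltNge c1.
Qed.

Lemma capped_sup0 (T : R) : 0 <= T -> capped_sup T (cst 0) = 0.
Proof.
move=> T0; apply/eqP; rewrite eq_le; have /andP[-> _] := capped_sup_itv (cst 0) T0.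
have [ne ub] := capped_sup_has_sup (cst 0) T0.
by rewrite andbT; apply: ge_sup => // _ [t _ <-]; rewrite normr0 ge_min lexx orbT.
Qed.

End functionals.

(** * Occupation integrals *)

Section occupation_integrals.
Context {R : realType} {dM : measure_display} {M : measurableType dM}
  {dO : measure_display} {Omega : measurableType dO}.
Notation mu := (@lebesgue_measure R).
Notation mR := (measurableTypeR R).
Variables (nu : {sigma_finite_measure set M -> \bar R}) (phi : R -> M -> M)
  (a : R -> R) (Q : probability Omega R) (Z : R -> Omega -> R).
Hypothesis phi_flow : measurable_flow phi.
Hypothesis a_gt0 : forall e, 0 < e -> 0 < a e.
Hypothesis Z_measurable : forall t, 0 <= t -> measurable_fun [set: Omega] (Z t).
Hypothesis Z_increasing : forall w, increasing_path (Z ^~ w).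

Definition occupation (g : M -> R) (e : R) (w : M) (t : R) : R :=
  a e * \int[mu]_(s in `[0, t / e]) g (phi s w).

Variables (T : R) (P : probability M R).
Hypothesis T0 : 0 < T.
Hypothesis flln : forall g : M -> R, nu.-integrable [set: M] (EFin \o g) ->
  cvg_in_distribution_C T P (occupation g)
    Q (fun w t => (\int[nu]_w' g w') * Z t w).

(** Boundedness makes the integrals along all orbits finite, where integrability
    would only give almost all of them. *)
Definition bounded_L1 (g : M -> R) : Prop :=
  [/\ measurable_fun setT g, exists B, forall w, `|g w| <= B &
      nu.-integrable setT (EFin \o g)].

Lemma bounded_L1_orbit g w : bounded_L1 g -> measurable_fun setT (fun s : mR => g (phi s w)).
Proof. by move=> [mg _ _]; exact: (measurableT_comp mg (measurable_orbit phi_flow w)). Qed.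

Lemma bounded_L1_integrable g w t : bounded_L1 g ->
  mu.-integrable `[0, t] (EFin \o (fun s => g (phi s w))).
Proof.
move=> gb; have [mg [B gB] _] := gb.
apply: (@bounded_integrable _ _ _ _ _ B) => //; first exact: itv_lty.
by apply: measurable_funTS; exact: bounded_L1_orbit.
Qed.

Lemma bounded_L1B (g1 g2 : M -> R) (c : R) : bounded_L1 g1 -> bounded_L1 g2 ->
  bounded_L1 (fun w => g1 w - c * g2 w).
Proof.
move=> [m1 [B1 b1] i1] [m2 [B2 b2] i2]; split.
- by apply: measurable_funB => //; exact: measurable_funM.
- exists (B1 + `|c| * B2) => w; rewrite (le_trans (ler_normB _ _))// lerD// normrM.
  by rewrite ler_wpM2l.
- under eq_fun do rewrite -mulNr.
  by apply: integrableDR => //; exact: integrableZlR.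
Qed.

Lemma bounded_L1D (g1 g2 : M -> R) : bounded_L1 g1 -> bounded_L1 g2 ->
  bounded_L1 (fun w => g1 w + g2 w).
Proof.
move=> [m1 [B1 b1] i1] [m2 [B2 b2] i2]; split.
- exact: measurable_funD.
- by exists (B1 + B2) => w; rewrite (le_trans (ler_normD _ _))// lerD.
- exact: integrableDR.
Qed.

Lemma bounded_L1Z (c : R) (g : M -> R) : bounded_L1 g -> bounded_L1 (fun w => c * g w).
Proof.
move=> [m1 [B b] i]; split.
- exact: measurable_funM.
- by exists (`|c| * B) => w; rewrite normrM ler_wpM2l.
- exact: integrableZlR.
Qed.

Lemma bounded_L1_sum (I : Type) (s : seq I) (g : I -> M -> R) :
  (forall i, bounded_L1 (g i)) -> bounded_L1 (fun w => \sum_(i <- s) g i w).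
Proof.
move=> gb; elim: s => [|i s IH].
  under eq_fun do rewrite big_nil; split; first exact: measurable_cst.
    by exists 0 => w; rewrite normr0.
  exact: integrable0.
by under eq_fun do rewrite big_cons; exact: bounded_L1D.
Qed.

Lemma occupation_ge0 g e w t : 0 < e -> (forall w, 0 <= g w) -> 0 <= occupation g e w t.
Proof.
by move=> e0 g0; rewrite mulr_ge0 ?(ltW (a_gt0 e0))//; apply: Rintegral_ge0.
Qed.

Lemma le_occupation g1 g2 e w t : 0 < e -> bounded_L1 g1 -> bounded_L1 g2 ->
  (forall w, g1 w <= g2 w) -> occupation g1 e w t <= occupation g2 e w t.
Proof.
move=> e0 b1 b2 g12; rewrite ler_wpM2l ?(ltW (a_gt0 e0))//.
by apply: le_Rintegral => //; exact: bounded_L1_integrable.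
Qed.

Lemma occupationB g1 g2 c e w t : bounded_L1 g1 -> bounded_L1 g2 ->
  occupation (fun w => g1 w - c * g2 w) e w t =
  occupation g1 e w t - c * occupation g2 e w t.
Proof.
move=> b1 b2; have i1 := bounded_L1_integrable w (t / e) b1.
have i2 := bounded_L1_integrable w (t / e) b2.
rewrite /occupation RintegralB//; last exact: integrableZlR.
by rewrite RintegralZl// mulrBr mulrCA.
Qed.

Lemma occupation_cont g e w : 0 < e -> bounded_L1 g -> cont_path T (occupation g e w).
Proof.
move=> e0 gb; have [_ [B gB] _] := gb.
apply: (@lipschitz_cont_path _ _ _ (a e * (B / e))) => s t s0 st tT.
have st' : s / e <= t / e by rewrite ler_pM2r ?invr_gt0.
have s0' : 0 <= s / e by rewrite divr_ge0// ltW.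
have i1 := bounded_L1_integrable w (t / e) gb.
rewrite /occupation -mulrBr normrM gtr0_norm ?a_gt0// -!mulrA.
rewrite ler_wpM2l ?(ltW (a_gt0 e0))// Rintegral_itvoc//.
have i2 : mu.-integrable `]s / e, t / e] (EFin \o (fun s => g (phi s w))).
  exact: (@integrable_itvS _ _ _ (t / e) (s / e) (t / e) false false i1).
rewrite (le_trans (le_normr_Rintegral _ _))//.
apply: (@le_trans _ _ (\int[mu]_(s in `]s / e, t / e]) B)).
  apply: le_Rintegral => //; first exact: (integrable_norm i2).
  apply: (@bounded_integrable _ _ _ _ _ `|B|) => //.
  by rewrite /= lebesgue_measure_itv/= lte_fin; case: ifP => _; rewrite ?ltry// -EFinB ltry.
rewrite Rintegral_cst// lebesgue_itvoc// -mulrBl.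
by rewrite (mulrC (t - s)).
Qed.

Lemma occupation_measurable g e t : bounded_L1 g ->
  measurable_fun setT (fun w => occupation g e w t).
Proof.
by move=> [mg _ _]; apply: measurable_funM => //; exact: measurable_orbit_integral.
Qed.

Lemma Z_cont w : cont_path T (Z ^~ w).
Proof. by have [Zc _] := Z_increasing w; exact: cont_path_sub. Qed.

Lemma functional_occupation_measurable (k e : R) g (F : (R -> R) -> R) :
  0 < e -> bounded_L1 g -> 0 <= k -> lip_functional T k F ->
  measurable_fun setT (fun w => F (occupation g e w)).
Proof.
move=> e0 gb k0 Fk; apply: (lip_functional_measurable T0 k0 Fk).
  by move=> w; exact: occupation_cont.
by move=> t _; exact: occupation_measurable.
Qed.

Lemma functional_Z_measurable (k c : R) (F : (R -> R) -> R) :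
  0 <= k -> lip_functional T k F ->
  measurable_fun setT (fun w => F (fun t => c * Z t w)).
Proof.
move=> k0 Fk; apply: (lip_functional_measurable T0 k0 Fk).
  by move=> w x; apply: cvgM; [exact: cvg_cst|exact: Z_cont].
move=> t /andP[t0 _]; apply: measurable_funM => //; exact: Z_measurable.
Qed.

Lemma functional_occupation_cvg (k B : R) g (F : (R -> R) -> R) :
  bounded_L1 g -> 0 <= k -> lip_functional T k F -> bounded_functional B F ->
  \int[P]_w F (occupation g e w) @[e --> 0^'+] -->
  \int[Q]_w F (fun t => (\int[nu]_w' g w') * Z t w).
Proof.
move=> [_ _ gi] k0 Fk FB; apply: (flln gi); last by exists B => y; exact: FB.
exact: lip_functional_continuous Fk.
Qed.

(** Markov's inequality for a functional with values in [0, 1]. *)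
Lemma functional_whp (c : R) g (F : (R -> R) -> R) : bounded_L1 g ->
  lip_functional T 1 F -> (forall y, 0 <= F y <= 1) -> 0 < c ->
  forall eta, 0 < eta ->
  \int[Q]_w F (fun t => (\int[nu]_w' g w') * Z t w) < c * eta ->
  \forall e \near 0^'+, whp_at P eta (fun w => F (occupation g e w) < c).
Proof.
move=> gb Fk F01 c0 eta eta0 Fc.
have FB : bounded_functional 1 F by move=> y; have /andP[? ?] := F01 y; rewrite ger0_norm.
have := cvgr_lt _ (functional_occupation_cvg gb ler01 Fk FB) _ Fc => near_lt.
near=> e; have e0 : 0 < e by near: e; exact: nbhs_right_gt.
have mF := functional_occupation_measurable e0 gb ler01 Fk.
have [mN PN] := markov_set P mF (fun w => F01 _) c0.
exists [set w | c <= F (occupation g e w)].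
  split => //; rewrite (le_trans PN)// lee_fin ler_pdivrMl// ltW//.
  by near: e; exact: near_lt.
by move=> w /= /negP; rewrite -ltNge.
Unshelve. all: by end_near.
Qed.

(** The excess over n of the limit at time T tends to 0 as n grows, so that some
    n makes the probability of an excess small. *)
Lemma occupation_tight g eta : bounded_L1 g -> 0 < eta -> exists2 K, 0 <= K &
  \forall e \near 0^'+, whp_at P eta (fun w => `|occupation g e w T| <= K).
Proof.
move=> gb eta0; pose I := \int[nu]_w' g w'.
have [_ H] : measurable_fun setT (cst 0 : Omega -> R) /\
    \int[Q]_w excess T n%:R (fun t => I * Z t w) @[n --> \oo] --> \int[Q]_w (cst 0 w : R).
  apply: (@Rintegral_bounded_cvg _ _ _ Q 1) => [n|n w|w].
  - exact: (functional_Z_measurable I ler01 (excess_lip _ (ltW T0))).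
  - by have /andP[? ?] := excess_itv T n%:R (fun t => I * Z t w); rewrite ger0_norm.
  - apply: cvg_near_cst; near=> n.
    rewrite /excess max_l ?min_r// subr_le0; near: n; exact: nbhs_infty_ger.
have eta2 : \int[Q]_w (cst 0 w : R) < 1 * (eta : R) by rewrite Rintegral_cst// mul0r mul1r.
have [n _ /(_ n (leqnn n)) /= Hn] := cvgr_lt _ H _ eta2.
exists (n%:R + 1) => //.
have := functional_whp gb (excess_lip n%:R (ltW T0)) (fun y => excess_itv T n%:R y) ltr01 eta0 Hn.
apply: filterS => e; apply: whp_at_imp => w.
rewrite /excess gt_min ltxx/= gt_max ltr01/= ltrBlDr addrC => ?; exact: ltW.
Unshelve. all: by end_near.
Qed.

(** The limit process is zero, so the expectation of the capped supremum tends to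
    0. *)
Lemma occupation_centered g c : bounded_L1 g -> \int[nu]_w g w = 0 -> 0 < c ->
  whp P (fun e w => unif_le T c (occupation g e w) (cst 0)).
Proof.
move=> gb g0 c0 eta eta0; have T0' := ltW T0.
pose c' := Num.min c 1; have c'0 : 0 < c' by rewrite lt_min c0 ltr01.
have := functional_whp gb (capped_sup_lip T0') (fun y => capped_sup_itv y T0') c'0 eta0.
rewrite g0.
have -> : \int[Q]_w capped_sup T (fun t => 0 * Z t w) = 0.
  rewrite (_ : (fun w => _) = cst 0) ?Rintegral_cst ?mul0r//.
  apply/funext => w; rewrite -[RHS](capped_sup0 T0'); congr capped_sup.
  by apply/funext => t; rewrite mul0r.
move=> /(_ (mulr_gt0 c'0 eta0)); apply: filterS => e; apply: whp_at_imp => w H t tT.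
rewrite subr0 (le_trans (capped_sup_lt T0' _ H tT))//; last by rewrite ge_min lexx.
by rewrite ge_min lexx orbT.
Qed.

End occupation_integrals.

(** * Negligibility of the quadratic remainder *)

Section dichotomy.
Context {R : realType} {dM : measure_display} {M : measurableType dM}
  {dO : measure_display} {Omega : measurableType dO}.
Notation mu := (@lebesgue_measure R).
Variables (nu : {sigma_finite_measure set M -> \bar R}) (phi : R -> M -> M)
  (a : R -> R) (Q : probability Omega R) (Z : R -> Omega -> R).
Hypothesis nu_infinite : nu [set: M] = +oo%E.

(** The measure is infinite and is the limit of the measures of an increasing
    sequence of sets of finite measure. *)
Lemma large_finite_set (m : R) : exists A : set M,
  [/\ measurable A, (nu A < +oo)%E & (m%:E <= nu A)%E].
Proof.
have [F FT FF] := sigma_finiteT nu.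
pose U n := \big[setU/set0]_(i < n) F i.
have mU n : measurable (U n) by apply: bigsetU_measurable => i _; have [] := FF i.
have UT : \bigcup_n U n = setT.
  apply/seteqP; split => // x _; have : [set: M] x by [].
  rewrite FT => -[i _ Fx]; exists i.+1 => //; rewrite /U.
  by rewrite -bigcup_mkord; exists i => //=.
have /= H := @nondecreasing_cvg_mu _ _ _ nu U mU.
have {}H : nu (U n) @[n --> \oo] --> +oo%E.
  rewrite -nu_infinite -UT; apply: H; first exact: bigcup_measurable.
  by move=> i j ij; apply/subsetPset; exact: subset_bigsetU.
have [n _ /(_ n (leqnn n)) /= Hn] := cvgey_ge H m.
exists (U n); split => //.
have fin k : (nu (U k) < +oo)%E.
  elim: k => [|k IH]; first by rewrite /U big_ord0 measure0 ltry.
  rewrite /U big_ord_recr/= (le_lt_trans (measureU2 _ (mU k) _))//.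
    by have [] := FF k.
  by rewrite lte_add_pinfty//; have [] := FF k.
exact: fin.
Qed.

Lemma normalized_indicator (m : R) : 0 < m -> exists g : M -> R,
  [/\ bounded_L1 nu g, forall w, 0 <= g w, forall w, g w <= m^-1 & \int[nu]_w g w = 1].
Proof.
move=> m0; have [A [mA Afin Am]] := large_finite_set m.
have Af : nu A \is a fin_num by rewrite ge0_fin_numE.
pose q := fine (nu A); have qE : nu A = q%:E by rewrite /q fineK.
have mq : m <= q by rewrite -lee_fin -qE.
have q0 : 0 < q by exact: lt_le_trans mq.
have mI : measurable_fun setT (\1_A : M -> R) by exact: measurable_indic.
have I0 w : 0 <= (\1_A w : R) by rewrite indicE.
have I1 w : (\1_A w : R) <= 1 by rewrite indicE; case: (_ \in _); rewrite ?ler01 ?lexx.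
have iI : nu.-integrable setT (EFin \o (\1_A : M -> R)).
  apply: (@supported_integrable _ _ _ nu A 1) => //.
    by move=> w; rewrite ger0_norm.
  by move=> w Aw; rewrite indicE memNset.
exists (fun w => q^-1 * \1_A w); split.
- apply: bounded_L1Z; split => //; exists 1 => w; by rewrite ger0_norm.
- by move=> w; rewrite mulr_ge0 ?invr_ge0 ?(ltW q0).
- move=> w; rewrite (@le_trans _ _ q^-1)//.
    by rewrite ler_piMr ?invr_ge0 ?(ltW q0).
  by rewrite lef_pV2 ?posrE.
- rewrite RintegralZl// /Rintegral integral_indic// setIT -/q.
  by rewrite mulVf// gt_eqF.
Qed.

Hypothesis phi_flow : measurable_flow phi.
Hypothesis a_gt0 : forall e, 0 < e -> 0 < a e.
Hypothesis Z_measurable : forall t, 0 <= t -> measurable_fun [set: Omega] (Z t).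
Hypothesis Z_increasing : forall w, increasing_path (Z ^~ w).
Variables (T : R) (P : probability M R).
Hypothesis T0 : 0 < T.
Notation occupation := (occupation phi a).
Hypothesis flln : forall g : M -> R, nu.-integrable [set: M] (EFin \o g) ->
  cvg_in_distribution_C T P (occupation g)
    Q (fun w t => (\int[nu]_w' g w') * Z t w).

(* The mean of min(1, |Z_T|), which vanishes if and only if Z_T does almost
   surely. *)
Let c0 := \int[Q]_w excess T 0 (Z ^~ w).

(** A normalized indicator of a set of measure m has an occupation integral of
    at most a_e T / (e m); as it must not vanish in the limit, this forces
    a_e / e to be of order m, for every m. *)
Lemma normalization_negligible (c : R) : 0 < c0 -> 0 < c ->
  \forall e \near 0^'+, e / a e <= c.
Proof.
move=> c00 cgt0; pose m := 2 * T / (c0 * c).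
have m0 : 0 < m by rewrite divr_gt0 ?mulr_gt0.
have [g [gb g0 gm gI]] := normalized_indicator m0.
have FB : bounded_functional 1 (excess T 0).
  by move=> y; have /andP[? ?] := excess_itv T 0 y; rewrite ger0_norm.
have H := functional_occupation_cvg flln gb ler01 (excess_lip 0 (ltW T0)) FB.
have E : \int[Q]_w excess T 0 (fun t => (\int[nu]_w' g w') * Z t w) = c0.
  by rewrite gI /c0; apply: eq_Rintegral => w _; congr excess; apply/funext => t; rewrite mul1r.
rewrite E in H; have c02 : c0 / 2 < c0 by lra.
near=> e; have e0 : 0 < e by near: e; exact: nbhs_right_gt.
have ae := a_gt0 e0.
have : c0 / 2 < \int[P]_w excess T 0 (occupation g e w).
  by near: e; exact: (cvgr_gt _ H _ c02).
have occ w : `|occupation g e w T| <= a e * (T / e * m^-1).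
  have te0 : 0 <= T / e by rewrite divr_ge0// ltW.
  rewrite ger0_norm; last exact: occupation_ge0.
  rewrite ler_wpM2l ?(ltW ae)//.
  apply: (@le_trans _ _ (\int[mu]_(s in `[0, T / e]) m^-1)).
    apply: le_Rintegral => //; first exact: bounded_L1_integrable gb.
    by apply: (@bounded_integrable _ _ _ _ _ `|m^-1|) => //; exact: itv_lty.
  rewrite Rintegral_cst// mulrC ler_wpM2r ?invr_ge0 ?(ltW m0)//.
  by rewrite /= lebesgue_measure_itv/= lte_fin; case: ltP => //= _; rewrite subr0.
have : \int[P]_w excess T 0 (occupation g e w) <= a e * (T / e * m^-1).
  apply: (@le_trans _ _ (\int[P]_w (cst (a e * (T / e * m^-1)) w))).
    apply: le_Rintegral => //.
    - apply: (@prob_integrable _ _ _ P 1) => //.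
      exact: (functional_occupation_measurable phi_flow a_gt0 T0 e0 gb ler01 (excess_lip 0 (ltW T0))).
    - by apply: (@prob_integrable _ _ _ P `|a e * (T / e * m^-1)|).
    move=> w _; rewrite /excess subr0 max_r// ge_min.
    by rewrite occ orbT.
  by rewrite Rintegral_cst// prob_setT mulr1.
move=> H1 H2; have := lt_le_trans H2 H1.
have -> : a e * (T / e * m^-1) = (c0 / 2) * (a e / e * c).
  by rewrite /m; field; rewrite !gt_eqF.
rewrite -[X in X < _]mulr1 ltr_pM2l ?divr_gt0// => /ltW H3.
by rewrite ler_pdivrMr//; move: H3; rewrite mulrAC ler_pdivlMr// mul1r mulrC.
Unshelve. all: by end_near.
Qed.

Lemma occupation_vanishes (g : M -> R) (c : R) : c0 <= 0 -> bounded_L1 nu g ->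
  0 < c -> whp P (fun e w => `|occupation g e w T| <= c).
Proof.
move=> c00 gb cgt0 eta eta0; have T0' := ltW T0.
pose I := \int[nu]_w' g w'.
pose c' := Num.min c 1; have c'0 : 0 < c' by rewrite lt_min cgt0 ltr01.
have := functional_whp phi_flow a_gt0 T0 flln gb (excess_lip 0 T0')
  (fun y => excess_itv T 0 y) c'0 eta0.
have mZ1 : measurable_fun setT (fun w => excess T 0 (Z ^~ w)).
  have := functional_Z_measurable Z_measurable Z_increasing T0 1 ler01 (excess_lip 0 T0').
  rewrite (_ : (fun w => _) = (fun w => excess T 0 (Z ^~ w)))//.
  by apply/funext => w; congr excess; apply/funext => t; rewrite mul1r.
have iZ1 : Q.-integrable setT (EFin \o (fun w => excess T 0 (Z ^~ w))).
  apply: (@prob_integrable _ _ _ Q 1) => // w.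
  by have /andP[? ?] := excess_itv T 0 (Z ^~ w); rewrite ger0_norm.
(* min(1, |I| v) <= (1 + |I|) min(1, v). *)
have H0 : \int[Q]_w excess T 0 (fun t => I * Z t w) <= 0.
  apply: (@le_trans _ _ (\int[Q]_w ((1 + `|I|) * excess T 0 (Z ^~ w)))); last first.
    by rewrite RintegralZl// mulr_ge0_le0// addr_ge0.
  apply: le_Rintegral => //.
  - apply: (@prob_integrable _ _ _ Q 1) => [|w].
      exact: (functional_Z_measurable Z_measurable Z_increasing T0 I ler01 (excess_lip 0 T0')).
    by have /andP[? ?] := excess_itv T 0 (fun t => I * Z t w); rewrite ger0_norm.
  - exact: integrableZlR.
  move=> w _; rewrite /excess !subr0 !max_r// normrM.
  have := normr_ge0 I; have := normr_ge0 (Z T w).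
  set u := `|I|; set v := `|Z T w| => v0 u0.
  have [v1|v1] := ltP 1 v; first by rewrite mulr1 ge_min lerDl u0.
  by rewrite mulrDl mul1r ge_min [X in _ || X](_ : _ = true) ?orbT// lerDr.
move=> /(_ (le_lt_trans H0 (mulr_gt0 c'0 eta0))); apply: filterS => e.
apply: whp_at_imp => w; rewrite /excess subr0 max_r// gt_min.
by rewrite ltNge ge_min lexx orbT/= => /ltW /le_trans; apply; rewrite ge_min lexx.
Qed.

(** Either the limit process vanishes at time T and so do the occupation
    integrals, or e is negligible with respect to a_e. *)
Lemma quadratic_remainder_whp (g : M -> R) (c : R) : bounded_L1 nu g ->
  (forall w, 0 <= g w) -> 0 < c ->
  whp P (fun e w =>
    occupation g e w T * Num.min 1 (e / a e * occupation g e w T) <= c).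
Proof.
move=> gb g0 cgt0 eta eta0; have [c00|c00] := leP c0 0.
  have := occupation_vanishes c00 gb cgt0 eta0 => H.
  near=> e; have e0 : 0 < e by near: e; exact: nbhs_right_gt.
  have : whp_at P eta (fun w => `|occupation g e w T| <= c) by near: e.
  apply: whp_at_imp => w; have := occupation_ge0 phi a_gt0 w T e0 g0.
  move=> o0; rewrite ger0_norm// => /(le_trans _); apply.
  by rewrite ler_piMr// ge_min lexx.
have [K K0 HK] := occupation_tight phi_flow a_gt0 Z_measurable Z_increasing T0 flln gb eta0.
have K1 : 0 < K ^+ 2 + 1 by rewrite ltr_wpDl ?exprn_ge0.
have cK : 0 < c / (K ^+ 2 + 1) by rewrite divr_gt0.
have He := normalization_negligible c00 cK.
near=> e; have e0 : 0 < e by near: e; exact: nbhs_right_gt.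
have : whp_at P eta (fun w => `|occupation g e w T| <= K) by near: e.
have ea : e / a e <= c / (K ^+ 2 + 1) by near: e.
apply: whp_at_imp => w; have := occupation_ge0 phi a_gt0 w T e0 g0.
set o := occupation g e w T => o0; rewrite ger0_norm// => oK.
have ea0 : 0 <= e / a e by rewrite divr_ge0 ?ltW// a_gt0.
apply: (@le_trans _ _ (o * (e / a e * o))).
  by rewrite ler_wpM2l// ge_min lexx orbT.
apply: (@le_trans _ _ (K * (c / (K ^+ 2 + 1) * K))).
  have q1 : e / a e * o <= c / (K ^+ 2 + 1) * K by apply: ler_pM.
  have q0 : 0 <= e / a e * o by rewrite mulr_ge0.
  exact: ler_pM.
rewrite mulrCA -expr2 mulrAC ler_pdivrMr// ler_wpM2l ?(ltW cgt0)//.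
by rewrite lerDl.
Unshelve. all: by end_near.
Qed.

End dichotomy.

(** * Lipschitz dependence, and Riemann paths *)

Section lipschitz_constant.
Context {R : realType} {V W : normedModType R} (g : V -> W).

Lemma lip_const_ge0 : (0%:E <= lip_const g)%E.
Proof.
by apply: ereal_sup_ubound; exists (0, 0) => //=; rewrite !subrr !normr0 mul0r.
Qed.

Lemma lip_const_le (K : R) : lipschitz_with K g -> (lip_const g <= `|K|%:E)%E.
Proof.
move=> gK; apply: ge_ereal_sup => _ [[x y] _ <-] /=; rewrite lee_fin.
have [->|xy] := eqVneq x y; first by rewrite !subrr !normr0 mul0r.
rewrite ler_pdivrMr ?normr_gt0 ?subr_eq0// (le_trans (gK x y))//.
by rewrite ler_wpM2r// ler_norm.
Qed.

Lemma lip_const_fin (K : R) : lipschitz_with K g -> lip_const g \is a fin_num.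
Proof.
move=> /lip_const_le gK; rewrite ge0_fin_numE ?lip_const_ge0//.
exact: le_lt_trans gK (ltry _).
Qed.

Lemma lip_constP (K : R) : lipschitz_with K g ->
  lipschitz_with (fine (lip_const g)) g.
Proof.
move=> gK x y; have [->|xy] := eqVneq x y; first by rewrite !subrr !normr0 mulr0.
rewrite -ler_pdivrMr ?normr_gt0 ?subr_eq0// -lee_fin fineK ?(lip_const_fin gK)//.
by apply: ereal_sup_ubound; exists (x, y).
Qed.

End lipschitz_constant.

Section volterra_lipschitz.
Context {R : realType}.

Lemma volterra_sol_lip {m d : nat} (T K c : R) (A : R -> 'M[R]_d)
    (v v' : R -> 'M[R]_(m, d)) : 0 <= T -> 0 <= c -> 0 <= K ->
  cont_path T A -> (forall t, 0 <= t <= T -> `|A t| <= K) ->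
  cont_path T v -> cont_path T v' -> unif_le T c v v' ->
  unif_le T (c * gronwall_cst (d%:R * K) T) (volterra_sol A v) (volterra_sol A v').
Proof.
move=> T0 c0 K0 Ac AK vc v'c vv.
have [yc yE] := volterra_solP T0 Ac vc; have [y'c y'E] := volterra_solP T0 Ac v'c.
apply: volterra_stability => // t tT; have /andP[t0 t1] := tT.
have iA (y : R -> 'M[R]_(m, d)) : cont_path T y ->
    mx_integrable lebesgue_measure `[0, t] (fun s => y s *m A s).
  move=> hy; apply: (@cont_path_mx_integrable _ _ _ T) => //.
  exact: cont_path_mul.
have -> : mxint lebesgue_measure `[0, t] (fun s => (volterra_sol A v s - volterra_sol A v' s) *m A s) =
    mxint lebesgue_measure `[0, t] (fun s => volterra_sol A v s *m A s) -
    mxint lebesgue_measure `[0, t] (fun s => volterra_sol A v' s *m A s).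
  rewrite -mxintB//; [|exact: iA|exact: iA].
  by apply: eq_mxint => s _; rewrite mulmxBl.
rewrite yE// y'E//.
set I := mxint _ _ _; set I' := mxint _ _ _.
rewrite (_ : _ - _ = v t - v' t); first exact: vv.
by rewrite opprD addrACA addrK.
Qed.

Lemma cont_path_min {V : normedModType R} (T g : R) (z : R -> V) : 0 <= T -> 0 <= g ->
  cont_path T z -> cont_path T (fun t => z (Num.min t g)).
Proof.
move=> T0 g0 zc; have cc := cont_path_clamp T0 zc.
have cm : continuous (id \min (cst g) : R -> R).
  by move=> t; apply: continuous_min; [exact: cvg_id|exact: cvg_cst].
have : cont_path T ((z \o clamp T) \o (id \min (cst g))).
  by apply: continuous_subspaceT => t; apply: continuous_comp; [exact: cm|exact: cc].
apply: eq_cont_path => t /andP[t0 tT] /=; rewrite clamp_id//.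
by rewrite le_min t0 g0 ge_min tT.
Qed.

End volterra_lipschitz.

Section riemann_paths.
Context {R : realType} {m d : nat}.
Variables (T : R) (H : R -> 'M[R]_(m, d)) (BH : R).
Hypothesis T0 : 0 < T.
Hypothesis HB : forall t, 0 <= t <= T -> `|H t| <= BH.

(** At each time this depends on z through finitely many values, hence is
    Lipschitz in z, unlike the integral int H dz that it approximates. *)
Definition riemann_path (n : nat) (z : R -> R) (t : R) : 'M[R]_(m, d) :=
  \sum_(j < n.+1) mesh_increment T n z t j *: H (grid T n j).

Lemma grid_itv n j : (j <= n.+1)%N -> 0 <= grid T n j <= T.
Proof.
by move=> jn; rewrite grid_ge0//= -[leRHS](gridn T n) le_grid.
Qed.

Lemma mesh_increment_dist n (y z : R -> R) (c t : R) j : (j < n.+1)%N -> 0 <= t <= T ->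
  unif_le T c y z -> `|mesh_increment T n y t j - mesh_increment T n z t j| <= 2 * c.
Proof.
move=> jn /andP[t0 tT] yz; rewrite /mesh_increment.
set b := Num.min t _; set b' := Num.min t (grid T n j).
have bT : 0 <= b <= T.
  by have /andP[? ?] := grid_itv jn; rewrite /b le_min t0 ge_min tT; apply/andP.
have b'T : 0 <= b' <= T.
  by have /andP[? ?] := grid_itv (ltnW jn); rewrite /b' le_min t0 ge_min tT; apply/andP.
have := yz _ bT; have := yz _ b'T.
move: (y b) (z b) (y b') (z b') => p q r s.
by rewrite !ler_norml => /andP[? ?] /andP[? ?]; apply/andP; split; lra.
Qed.

Lemma riemann_path_cont n z : cont_path T z -> cont_path T (riemann_path n z).
Proof.
move=> zc; apply: cont_path_sum => j; rewrite /mesh_increment.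
have c1 : cont_path T (fun t => z (Num.min t (grid T n j.+1)) - z (Num.min t (grid T n j))).
  by apply: (@cont_pathB R R); apply: (@cont_path_min R); rewrite ?grid_ge0// ltW.
by move=> t; apply: cvgZl; exact: c1.
Qed.

Lemma riemann_path_lip n (y z : R -> R) (c : R) : 0 <= c -> unif_le T c y z ->
  unif_le T (n.+1%:R * (2 * c * BH)) (riemann_path n y) (riemann_path n z).
Proof.
move=> c0 yz t tT; rewrite /riemann_path -sumrB (le_trans (ler_norm_sum _ _ _))//.
apply: (@le_trans _ _ (\sum_(j < n.+1) (2 * c * BH))).
  apply: ler_sum => -[j jn] _ /=; rewrite -scalerBl normrZ.
  by apply: ler_pM => //; [exact: mesh_increment_dist|apply/HB/grid_itv/ltnW].
by rewrite sumr_const card_ord (mulrC n.+1%:R) mulr_natr.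
Qed.

End riemann_paths.

(** * Stieltjes integrals as limits of Riemann paths *)

Section stieltjes_path.
Context {R : realType} {m d : nat}.
Variables (T : R) (H : R -> 'M[R]_(m, d)) (k : R) (z : R -> R).
Hypothesis T0 : 0 < T.
Hypothesis k0 : 0 <= k.
Hypothesis Hc : cont_path T H.
Hypothesis Hk : forall s u, 0 <= s <= T -> 0 <= u <= T -> `|H s - H u| <= k * `|s - u|.
Hypothesis zi : increasing_path z.
Notation mz := (lebesgue_stieltjes_measure (path_ext z)).

Lemma cont_path_stieltjes_integrable : mx_integrable mz `[0, T] H.
Proof.
have T0' := ltW T0; have [B _ HB] := cont_path_bounded T0' Hc.
apply: (@mx_bounded_integrable _ _ _ mz _ _ _ B) => //.
- by rewrite [X in (X < _)%E](stieltjes_itv zi T0') ltry.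
- by move=> i j; apply: subspace_continuous_measurable_fun => //; exact: cont_path_coord.
Qed.

Lemma stieltjes_riemann_path n :
  unif_le T (k * (T / n.+1%:R) * (z T - z 0)) (stieltjes_int z H) (riemann_path T H n z).
Proof.
move=> t tT; apply: stieltjes_mesh_approx => //.
exact: cont_path_stieltjes_integrable.
Qed.

Lemma stieltjes_riemann_path_near (c : R) : 0 < c ->
  \forall n \near \oo, unif_le T c (stieltjes_int z H) (riemann_path T H n z).
Proof.
move=> c0; near=> n; move=> t /(stieltjes_riemann_path n) /le_trans; apply.
have n0 : 0 < n.+1%:R :> R by rewrite ltr0n.
rewrite (_ : _ * _ * _ = k * T * (z T - z 0) / n.+1%:R); last first.
  by move: n.+1%:R n0 => p p0; field; rewrite gt_eqF.
rewrite ler_pdivrMr// [leRHS]mulrC -ler_pdivrMr//.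
apply: (@le_trans _ _ n%:R); last by rewrite ler_nat.
by apply: ltW; near: n; exact: nbhs_infty_gtr.
Unshelve. all: by end_near.
Qed.

(** A uniform limit of Riemann paths, which are continuous. *)
Lemma stieltjes_int_cont : cont_path T (stieltjes_int z H).
Proof.
apply: unif_limit_cont_path => c c0.
have [n Hn] := filter_ex (stieltjes_riemann_path_near c0).
exists (riemann_path T H n z) => //; apply: riemann_path_cont => //.
by have [zc _] := zi; exact: cont_path_sub.
Qed.

End stieltjes_path.

(** * The normalized error *)

Section averaging.
Context {R : realType} {d : nat} {dM : measure_display} {M : measurableType dM}
  {dO : measure_display} {Omega : measurableType dO}.
Notation mu := (@lebesgue_measure R).
Notation mR := (measurableTypeR R).
Variables (nu : {sigma_finite_measure set M -> \bar R}) (phi : R -> M -> M)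
  (a : R -> R) (Q : probability Omega R) (Z : R -> Omega -> R).
Hypothesis nu_infinite : nu [set: M] = +oo%E.
Hypothesis phi_flow : measurable_flow phi.
Hypothesis a_gt0 : forall e, 0 < e -> 0 < a e.
Hypothesis Z_measurable : forall t, 0 <= t -> measurable_fun [set: Omega] (Z t).
Hypothesis Z_increasing : forall w, increasing_path (Z ^~ w).
Variables (T : R) (P : probability M R).
Hypothesis T0 : 0 < T.
Notation occupation := (occupation phi a).
Hypothesis flln : forall g : M -> R, nu.-integrable [set: M] (EFin \o g) ->
  cvg_in_distribution_C T P (occupation g)
    Q (fun w t => (\int[nu]_w' g w') * Z t w).
Variables (f : 'rV[R]_d -> M -> 'rV[R]_d) (fbar : 'rV[R]_d -> 'rV[R]_d)
  (Kf Lf Kb Lb Kj : R).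
Hypothesis f_measurable : measurable_fun [set: borelRV R d * M]
     (fun p => f p.1 p.2 : borelRV R d).
Hypothesis f_bounded : forall x w, `|f x w| <= Kf.
Hypothesis fbar_bounded : forall x, `|fbar x| <= Kb.
Hypothesis f_lipschitz : forall w, lipschitz_with Lf (f ^~ w).
Hypothesis Lb0 : 0 <= Lb.
Hypothesis fbar_lipschitz : lipschitz_with Lb fbar.
Hypothesis f_integrable : forall x i,
     nu.-integrable [set: M] (EFin \o (fun w => f x w ord0 i)).
Hypothesis fbar_twice_diff : twice_diff_bounded Kj fbar.
Hypothesis lip_f_integrable : nu.-integrable [set: M] (fun w => lip_const (f ^~ w)).
Variables (x : 'rV[R]_d) (W : R -> 'rV[R]_d) (X : R -> M -> R -> 'rV[R]_d).
Hypothesis W_sol : solves_autonomous fbar x W.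
Hypothesis X_sol : forall e w, 0 < e ->
     solves_caratheodory (fun t y => f y (phi (t / e) w) + fbar y) x (X e w).

Let T0' : 0 <= T := ltW T0.

Let l (w : M) : R := fine (lip_const (f ^~ w)).

Let l0 w : 0 <= l w. Proof. by rewrite fine_ge0// lip_const_ge0. Qed.

Let lL w : l w <= `|Lf|.
Proof.
by rewrite -lee_fin fineK ?(lip_const_fin (f_lipschitz w))// lip_const_le.
Qed.

Let lE : EFin \o l = fun w => lip_const (f ^~ w).
Proof. by apply/funext => w /=; rewrite fineK// (lip_const_fin (f_lipschitz w)). Qed.

Let lf w y z : `|f y w - f z w| <= l w * `|y - z|.
Proof. exact: (lip_constP (f_lipschitz w)). Qed.

Let l_L1 : bounded_L1 nu l.
Proof.
split; last by rewrite lE.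
  by apply/measurable_EFinP; rewrite lE; case/integrableP: lip_f_integrable.
by exists `|Lf| => w; rewrite ger0_norm.
Qed.

Let f_L1 y i : bounded_L1 nu (fun w => f y w ord0 i).
Proof.
split => //; first exact: (measurable_field_coord f_measurable).
by exists Kf => w; rewrite (le_trans (mx_coord_le _ _ _)).
Qed.

Lemma bounded_L1_norm (g : M -> R) : bounded_L1 nu g -> bounded_L1 nu (fun w => `|g w|).
Proof.
move=> [mg [B gB] gi]; split; first exact: measurableT_comp.
  by exists B => w; rewrite normr_id.
exact: (integrable_norm gi).
Qed.

Definition mean_field (y : 'rV[R]_d) : 'rV[R]_d := mxint nu [set: M] (f y).
Notation h := mean_field.

Let Lh := \int[nu]_w l w.

Let Lh0 : 0 <= Lh. Proof. exact: Rintegral_ge0. Qed.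

Let f_int y : mx_integrable nu setT (f y).
Proof. by move=> i j; rewrite (ord1 i). Qed.

Lemma mean_field_lip y z : `|h y - h z| <= Lh * `|y - z|.
Proof.
have [_ _ li] := l_L1.
rewrite /h -mxintB// -RintegralZr//.
apply: mxint_norm_le => //; first exact: mx_integrableB.
by under [X in EFin \o X]eq_fun do rewrite mulrC; exact: integrableZlR.
Qed.

Let Kb0 : 0 <= Kb := le_trans (normr_ge0 _) (fbar_bounded 0).

Let Wc : cont_path T W.
Proof. by have [_ Wc _] := W_sol; exact: cont_path_sub. Qed.

Let Wd s t : 0 <= s -> 0 <= t -> `|W t - W s| <= Kb * `|t - s|.
Proof. exact: (autonomous_dist W_sol fbar_bounded fbar_lipschitz). Qed.

Definition mean_path (s : R) : 'rV[R]_d := h (W s).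
Notation H := mean_path.

Lemma mean_path_cont : cont_path T H.
Proof. by apply: cont_path_comp => //; exact: (lipschitz_continuous mean_field_lip). Qed.

Lemma mean_path_dist s u : 0 <= s <= T -> 0 <= u <= T ->
  `|H s - H u| <= (Lh * Kb) * `|s - u|.
Proof.
move=> /andP[s0 _] /andP[u0 _]; rewrite (le_trans (mean_field_lip _ _))//.
by rewrite -mulrA ler_wpM2l// Wd.
Qed.

Let LK0 : 0 <= Lh * Kb. Proof. exact: mulr_ge0. Qed.

Lemma occupation_scale g e w t : 0 < e -> 0 <= t -> bounded_L1 nu g ->
  \int[mu]_(s in `[0, t]) (a e / e * g (phi (s / e) w)) = occupation g e w t.
Proof.
move=> e0 t0 gb; have [mg [B gB] _] := gb.
have mo := bounded_L1_orbit phi_flow w gb.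
have gi : mu.-integrable `[0, t] (EFin \o (fun s => g (phi (s / e) w))).
  apply: (@bounded_integrable _ _ _ _ _ B) => //; first exact: itv_lty.
  apply: measurable_funTS; exact: (measurableT_comp mo (measurable_scale_time e)).
rewrite RintegralZl// (Rintegral_scale e0 (g := fun s => g (phi s w)) mo (B := B))//.
by rewrite mulrA divfK ?gt_eqF.
Qed.

(* Dominates both l and |f (W s)| for s in [0, T]: as |W s - x| <= Kb T, moving
    from x to W s costs at most Kb T times the Lipschitz constant l. *)
Let g1 (w : M) : R := \sum_(i < d) `|f x w ord0 i| + (Kb * T + 1) * l w.

Let g1_L1 : bounded_L1 nu g1.
Proof.
apply: bounded_L1D; last exact: bounded_L1Z.
by apply: bounded_L1_sum => i; exact: bounded_L1_norm.
Qed.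

Let KT0 : 0 <= Kb * T. Proof. exact: mulr_ge0. Qed.

Let lg1 w : l w <= g1 w.
Proof.
rewrite /g1 mulrDl mul1r addrA lerDr addr_ge0 ?mulr_ge0//.
by apply: sumr_ge0.
Qed.

Let g10 w : 0 <= g1 w := le_trans (l0 w) (lg1 w).

Let fg1 s w : 0 <= s <= T -> `|f (W s) w| <= g1 w.
Proof.
move=> /andP[s0 sT]; have W0 : W 0 = x by case: W_sol.
rewrite -[f (W s) w](subrK (f x w)) addrC (le_trans (ler_normD _ _))// lerD//.
  apply: mx_norm_le => [|i j]; first by apply: sumr_ge0.
  by rewrite (ord1 i) (bigD1 j)//= lerDl sumr_ge0.
rewrite (le_trans (lf _ _ _))// mulrC ler_wpM2r//.
rewrite -W0 (le_trans (Wd _ _))// subr0 ger0_norm//.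
by rewrite (le_trans (ler_wpM2l Kb0 sT))// lerDl.
Qed.

Variable g0 : M -> R.
Hypothesis g0_L1 : bounded_L1 nu g0.
Hypothesis g0_int : \int[nu]_w g0 w = 1.

(* Centring by a multiple of g0 makes the integral vanish. *)
Let gc (y : 'rV[R]_d) (i : 'I_d) (w : M) : R := f y w ord0 i - h y ord0 i * g0 w.

Let gc_L1 y i : bounded_L1 nu (gc y i). Proof. exact: bounded_L1B. Qed.

Let gc_int y i : \int[nu]_w gc y i w = 0.
Proof.
have [_ _ gi] := g0_L1.
rewrite /gc RintegralB//; last exact: integrableZlR.
by rewrite RintegralZl// g0_int mulr1 /h mxE subrr.
Qed.

(** Freezing W on each cell of the mesh costs at most the Lipschitz constant l
    times the displacement of W.  The frozen integrals are increments of
    occupation integrals of f (W t_j), which differ from h (W t_j) times those of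
    g0 by occupation integrals of centred functions. *)
Lemma perturbation_riemann n e w (c t : R) : 0 < e -> 0 <= c ->
  (forall (j : 'I_n.+1) i, unif_le T c (occupation (gc (W (grid T n j)) i) e w) (cst 0)) ->
  0 <= t <= T ->
  `|(a e / e) *: mxint mu `[0, t] (fun s => f (W s) (phi (s / e) w)) -
     riemann_path T H n (occupation g0 e w) t| <=
  Kb * (T / n.+1%:R) * occupation l e w T + n.+1%:R * (2 * c).
Proof.
move=> e0 c0 gcc tT; have /andP[t0 t1] := tT.
pose k := a e / e; have k0 : 0 < k by rewrite divr_gt0// a_gt0.
have fi (y : R -> 'rV[R]_d) u : cont_path T y -> u <= T ->
    mx_integrable mu `[0, u] (fun s => f (y s) (phi (s / e) w)).
  move=> yc uT; apply: (@field_path_integrable _ _ T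
    (fun s y => f y (phi (s / e) w)) Kf) => //.
  by move=> z zc i j; exact: (measurable_field_path phi_flow f_measurable).
have ci (y : 'rV[R]_d) : cont_path T (cst y).
  by apply: continuous_subspaceT => s; exact: cvg_cst.
pose F s := k *: f (W s) (phi (s / e) w).
pose G (j : nat) s := k *: f (W (grid T n j)) (phi (s / e) w).
have FE : mxint mu `[0, t] F = k *: mxint mu `[0, t] (fun s => f (W s) (phi (s / e) w)).
  by rewrite -mxintZ//; exact: fi.
rewrite -/k -FE.
have li : mu.-integrable `[0, T] (EFin \o (fun s => k * l (phi (s / e) w))).
  have [_ [B lB] _] := l_L1.
  apply: integrableZlR => //; apply: (@bounded_integrable _ _ _ _ _ B) => //.
    exact: itv_lty.
  apply: measurable_funTS.
  exact: (measurableT_comp (bounded_L1_orbit phi_flow w l_L1) (measurable_scale_time e)).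
have A1 : `|mxint mu `[0, t] F -
    \sum_(j < n.+1) mesh_increment T n (fun u => mxint mu `[0, u] (G j)) t j| <=
    Kb * (T / n.+1%:R) * occupation l e w T.
  rewrite -(occupation_scale w e0 T0' l_L1).
  apply: mesh_approx => //.
  - exact: lebesgue_measure_set1.
  - by rewrite !mulr_ge0 ?invr_ge0.
  - by apply: mx_integrableZ => //; exact: fi.
  - by move=> j; apply: mx_integrableZ => //; exact: (fi (cst (W (grid T n j)))).
  - by move=> s _; rewrite mulr_ge0 ?(ltW k0).
  - move=> j s jn /andP[s0 s1].
    rewrite /F /G -scalerBr normrZ gtr0_norm// mulrCA ler_wpM2l ?(ltW k0)//.
    rewrite (le_trans (lf _ _ _))// mulrC ler_wpM2r//.
    have gj0 : 0 <= grid T n j by exact: grid_ge0.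
    rewrite (le_trans (Wd _ _))// ?(le_trans gj0)// ler_wpM2l//.
    by rewrite ger0_norm ?subr_ge0// -(gridS T n j) lerD2r.
have A2 : `|\sum_(j < n.+1) mesh_increment T n (fun u => mxint mu `[0, u] (G j)) t j -
    riemann_path T H n (occupation g0 e w) t| <= n.+1%:R * (2 * c).
  rewrite /riemann_path -sumrB (le_trans (ler_norm_sum _ _ _))//.
  apply: (@le_trans _ _ (\sum_(j < n.+1) (2 * c))); last first.
    by rewrite sumr_const card_ord (mulrC n.+1%:R) mulr_natr.
  apply: ler_sum => j _; apply: mx_norm_le => [|i i']; first by rewrite mulr_ge0.
  rewrite (ord1 i) {i}.
  have GE u : 0 <= u -> u <= T -> mxint mu `[0, u] (G j) ord0 i' =
      occupation (fun w => f (W (grid T n j)) w ord0 i') e w u.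
    move=> u0 uT; rewrite mxE -(occupation_scale w e0 u0 (f_L1 _ _)).
    by apply: eq_Rintegral => s _; rewrite mxE.
  have jT := @grid_itv _ T T0 n j (ltnW (ltn_ord j)).
  have j1T := @grid_itv _ T T0 n j.+1 (ltn_ord j).
  have mT u : 0 <= u <= T -> 0 <= Num.min t u <= T.
    by move=> /andP[? ?]; rewrite le_min t0 ge_min t1; apply/andP.
  have -> : (mesh_increment T n (fun u => mxint mu `[0, u] (G j)) t j -
      mesh_increment T n (occupation g0 e w) t j *: H (grid T n j)) ord0 i' =
      mesh_increment T n (occupation (gc (W (grid T n j)) i') e w) t j - 
      mesh_increment T n (cst 0) t j.
    rewrite /mesh_increment.
    have /andP[? ?] := mT _ jT; have /andP[? ?] := mT _ j1T.
    have oB u : occupation (gc (W (grid T n j)) i') e w u =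
        occupation (fun w => f (W (grid T n j)) w ord0 i') e w u -
        H (grid T n j) ord0 i' * occupation g0 e w u by apply: occupationB => //.
    rewrite !oB -!GE//.
    rewrite [LHS]mxE [X in X + _]mxE [X in _ + X + _]mxE [X in _ + X]mxE [X in _ - X]mxE.
    by rewrite subrr subr0 mulrC; ring.
  by apply: (@mesh_increment_dist _ T T0) => //.
rewrite -(subrKA (\sum_(j < n.+1) mesh_increment T n (fun u => mxint mu `[0, u] (G j)) t j)).
by rewrite (le_trans (ler_normD _ _))// lerD.
Qed.

Notation A := (linearized_field fbar W).
Let Gw := gronwall_cst (d%:R * Kj) T.
Let Gw0 : 0 < Gw. Proof. exact: gronwall_cst_gt0. Qed.

Let Kj0 : 0 <= Kj.
Proof. by have [_ _ + _] := fbar_twice_diff 0; apply: le_trans. Qed.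

Let Ac : cont_path T A. Proof. exact: (linearized_field_cont W_sol fbar_twice_diff). Qed.

Let AK t : `|A t| <= Kj. Proof. exact: linearized_field_bound. Qed.

Let C1 := remainder_cst (d := d) T Kj `|Lf| Lb.

Let C10 : 0 <= C1.
Proof.
have G0 : 0 <= gronwall_cst (`|Lf| + Lb) T by rewrite ltW ?gronwall_cst_gt0.
by rewrite /C1 /remainder_cst !addr_ge0 ?mulr_ge0 ?addr_ge0 ?mulr_ge0 ?exprn_ge0.
Qed.

Definition limit_map (n : nat) (z : R -> R) : R -> 'rV[R]_d :=
  volterra_sol A (riemann_path T H n z).

Lemma error_limit_map n e w (c c1 : R) : 0 < e -> 0 <= c ->
  (forall (j : 'I_n.+1) i, unif_le T c (occupation (gc (W (grid T n j)) i) e w) (cst 0)) ->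
  occupation g1 e w T * Num.min 1 (e / a e * occupation g1 e w T) <= c1 ->
  unif_le T ((Kb * (T / n.+1%:R) * occupation g1 e w T + n.+1%:R * (2 * c) + C1 * c1) * Gw)
    (fun t => (a e / e) *: (X e w t - W t)) (limit_map n (occupation g0 e w)).
Proof.
move=> e0 c0 gcc oc1 t tT; have k0 : 0 < a e / e by rewrite divr_gt0// a_gt0.
have [mg1 [B1 g1B] _] := g1_L1; have [ml _ _] := l_L1.
have mo (g : M -> R) : bounded_L1 nu g -> measurable_fun setT (fun s : mR => g (phi (s / e) w)).
  move=> gb; exact: (measurableT_comp (bounded_L1_orbit phi_flow w gb) (measurable_scale_time e)).
have B10 : 0 <= B1 := le_trans (normr_ge0 _) (g1B w).
have Kf0 : 0 <= Kf := le_trans (normr_ge0 _) (f_bounded 0 w).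
have oc : cont_path T (occupation g0 e w) by exact: (occupation_cont phi_flow a_gt0 e0 g0_L1).
have ol : 0 <= occupation l e w T by exact: (occupation_ge0 phi a_gt0 w T e0 l0).
pose c2 := Kb * (T / n.+1%:R) * occupation l e w T + n.+1%:R * (2 * c).
have c20 : 0 <= c2.
  have n0 : 0 <= n.+1%:R :> R by exact: ler0n.
  have Tn : 0 <= T / n.+1%:R by exact: divr_ge0.
  have cc : 0 <= 2 * c by exact: mulr_ge0.
  exact: (addr_ge0 (mulr_ge0 (mulr_ge0 Kb0 Tn) ol) (mulr_ge0 n0 cc)).
have FB s y : `|f y (phi (s / e) w)| <= Kf + B1.
  by rewrite (le_trans (f_bounded _ _))// lerDl.
have lL' s : 0 <= l (phi (s / e) w) <= `|Lf| by rewrite l0 lL.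
have pB s : g1 (phi (s / e) w) <= Kf + B1.
  by rewrite (le_trans (ler_norm _))// (le_trans (g1B _))// lerDr.
have := @error_expansion R d T (fun s y => f y (phi (s / e) w)) fbar x (X e w) W
  (fun s => l (phi (s / e) w)) (fun s => g1 (phi (s / e) w)) (Kf + B1) Kj `|Lf| Lb T0 W_sol
  (@X_sol e w e0) (fun y yc i j => measurable_field_path phi_flow f_measurable e w i j yc)
  (mo l l_L1) (mo g1 g1_L1) FB lL' pB
  (fun s => lg1 (phi (s / e) w)) (fun s => lf (phi (s / e) w))
  (fun s sT => fg1 (phi (s / e) w) sT) Lb0 fbar_lipschitz fbar_twice_diff
  (a e / e) c2 (riemann_path T H n (occupation g0 e w)) k0 c20
  (riemann_path_cont T0 oc)
  (fun t tT => perturbation_riemann e0 c0 gcc tT) t tT.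
move/le_trans; apply.
set m := \int[mu]_(s in _) _.
have mE : occupation g1 e w T = a e / e * m.
  rewrite -(occupation_scale w e0 T0' g1_L1) RintegralZl//.
  apply: (@bounded_integrable _ _ _ _ _ B1) => //; first exact: itv_lty.
  by apply: measurable_funTS; exact: mo.
apply: ler_wpM2r; first exact: (ltW Gw0).
have em : m = e / a e * occupation g1 e w T.
  by rewrite mE mulrA -[e / a e]invf_div mulVf ?mul1r ?gt_eqF.
apply: lerD; last first.
  by apply: (ler_wpM2l C10); rewrite -mE em.
rewrite /c2; apply: lerD; last exact: lexx.
have KT : 0 <= Kb * (T / n.+1%:R) by exact: (mulr_ge0 Kb0 (divr_ge0 T0' (ler0n _ _))).
apply: (ler_wpM2l KT).
exact: (le_occupation phi_flow a_gt0 w T e0 l_L1 g1_L1 lg1).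
Qed.

(** First n is chosen large, against the tightness bound of the occupation
    integral of g1, then the centred occupation integrals at the finitely many
    mesh points and the quadratic remainder are made small with e. *)
Lemma error_limit_map_whp (c eta : R) : 0 < c -> 0 < eta ->
  \forall n \near \oo, \forall e \near 0^'+, whp_at P eta (fun w =>
    unif_le T c (fun t => (a e / e) *: (X e w t - W t))
      (limit_map n (occupation g0 e w))).
Proof.
move=> cgt0 eta0; have eta3 : 0 < eta / 3 by rewrite divr_gt0.
have [K1 K10 HK] := occupation_tight phi_flow a_gt0 Z_measurable Z_increasing T0 flln g1_L1 eta3.
have C11 : 0 < C1 + 1 := ltr_wpDl C10 ltr01.
pose c1 := c / (3 * (C1 + 1) * Gw).
have c10 : 0 < c1 := divr_gt0 cgt0 (mulr_gt0 (mulr_gt0 (ltr0Sn R 2) C11) Gw0).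
have HQ := quadratic_remainder_whp nu_infinite phi_flow a_gt0 Z_measurable Z_increasing
  T0 flln g1_L1 g10 c10 eta3.
near=> n.
have n0 : 0 < n.+1%:R :> R by rewrite ltr0n.
have nbig : 3 * Kb * T * K1 * Gw / c < n.+1%:R.
  rewrite (@lt_trans _ _ n%:R)// ?ltr_nat//.
  by near: n; exact: nbhs_infty_gtr.
(* The three contributions to the error are at most c / 3 each. *)
pose cn := c / (6 * n.+1%:R * Gw).
have cn0 : 0 < cn := divr_gt0 cgt0 (mulr_gt0 (mulr_gt0 (ltr0Sn R 5) n0) Gw0).
have HC : whp P (fun e w => forall (j : 'I_n.+1) i,
    unif_le T cn (occupation (gc (W (grid T n j)) i) e w) (cst 0)).
  apply: whp_forall => j; apply: whp_forall => i.
  exact: (occupation_centered phi_flow a_gt0 T0 flln (gc_L1 _ i) (gc_int _ i) cn0).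
have {}HC := HC _ eta3.
near=> e.
have e0 : 0 < e by near: e; exact: nbhs_right_gt.
have W1 : whp_at P (eta / 3) (fun w => `|occupation g1 e w T| <= K1) by near: e.
have W2 : whp_at P (eta / 3) (fun w =>
    occupation g1 e w T * Num.min 1 (e / a e * occupation g1 e w T) <= c1) by near: e.
have W3 : whp_at P (eta / 3) (fun w => forall (j : 'I_n.+1) i,
    unif_le T cn (occupation (gc (W (grid T n j)) i) e w) (cst 0)) by near: e.
rewrite (_ : eta = eta / 3 + (eta / 3 + eta / 3)); last by field.
apply: whp_at_imp (whp_at_and W1 (whp_at_and W2 W3)) => w [A1 [A2 A3]] t tT.
apply: (le_trans (error_limit_map e0 (ltW cn0) A3 A2 tT)).
have oK : occupation g1 e w T <= K1 := le_trans (ler_norm _) A1.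
have B1 : Kb * (T / n.+1%:R) * occupation g1 e w T * Gw <= c / 3.
  apply: (@le_trans _ _ (Kb * (T / n.+1%:R) * K1 * Gw)).
    apply: (ler_wpM2r (ltW Gw0)); apply: ler_wpM2l => //.
    exact: (mulr_ge0 Kb0 (divr_ge0 T0' (ler0n _ _))).
  rewrite (_ : _ * Gw = (Kb * T * K1 * Gw) / n.+1%:R); last first.
    by move: n.+1%:R n0 => p p0; field; rewrite gt_eqF.
  rewrite ler_pdivrMr//; move: nbig; rewrite ltr_pdivrMr// => nbig.
  move: nbig; rewrite (_ : 3 * Kb * T * K1 * Gw = 3 * (Kb * T * K1 * Gw)); last by ring.
  move: (Kb * T * K1 * Gw) n.+1%:R => p q; nra.
have B2 : n.+1%:R * (2 * cn) * Gw = c / 3.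
  by rewrite /cn; move: n.+1%:R n0 Gw Gw0 => p p0 q q0; field; rewrite !gt_eqF.
have B3 : C1 * c1 * Gw <= c / 3.
  apply: (@le_trans _ _ ((C1 + 1) * c1 * Gw)).
    apply: (ler_wpM2r (ltW Gw0)); apply: (ler_wpM2r (ltW c10)).
    by rewrite lerDl.
  by rewrite le_eqVlt /c1; apply/orP; left; apply/eqP;
    move: (C1 + 1) C11 Gw Gw0 => p p0 q q0; field; rewrite !gt_eqF.
rewrite [leLHS]mulrDl [X in X + _ <= _]mulrDl B2.
move: B1 B3; move: (_ * Gw) (C1 * c1 * Gw) => p q; lra.
Unshelve. all: by end_near.
Qed.

Lemma mean_path_bounded : exists2 B, 0 <= B & forall t, 0 <= t <= T -> `|H t| <= B.
Proof. exact: cont_path_bounded mean_path_cont. Qed.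

Lemma limit_map_lip n (y z : R -> R) (B c : R) : 0 <= B ->
  (forall t, 0 <= t <= T -> `|H t| <= B) -> 0 <= c ->
  cont_path T y -> cont_path T z -> unif_le T c y z ->
  unif_le T (n.+1%:R * (2 * B) * Gw * c) (limit_map n y) (limit_map n z).
Proof.
move=> B0 HB c0 yc zc yz.
rewrite (_ : _ * c = n.+1%:R * (2 * c * B) * Gw); last first.
  by move: n.+1%:R Gw => p q; ring.
apply: volterra_sol_lip => //.
- by rewrite !mulr_ge0.
- exact: riemann_path_cont.
- exact: riemann_path_cont.
- exact: riemann_path_lip.
Qed.

(** The error is close to limit_map n of the scalar process S^e(g0), which
    converges in distribution to Z since g0 has integral 1, and limit_map n Z
    tends to the limit process. *)
Lemma error_cvg_in_distribution :
  cvg_in_distribution_C T P (fun e w t => (a e / e) *: (X e w t - W t)) Q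
    (fun w => volterra_sol A (stieltjes_int (Z ^~ w) H)).
Proof.
have [B B0 HB] := mean_path_bounded.
have Vc w : cont_path T (stieltjes_int (Z ^~ w) H).
  exact: (stieltjes_int_cont T0 LK0 mean_path_cont mean_path_dist (Z_increasing w)).
have volc (V : R -> 'rV[R]_d) : cont_path T V -> cont_path T (volterra_sol A V).
  by move=> Vc'; have [] := volterra_solP T0' Ac Vc'.
apply: (@converging_together R _ _ _ _ _ T P (occupation g0) _ Q (fun w => Z ^~ w) _
  limit_map (fun n => n.+1%:R * (2 * B) * Gw)).
- by move=> e w e0; exact: (occupation_cont phi_flow a_gt0 e0 g0_L1).
- move=> e w e0; apply: cont_pathZ; apply: cont_pathB => //.
  by have [Xc _] := @X_sol e w e0; exact: cont_path_sub.
- by move=> w; exact: (Z_cont Z_increasing).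
- by move=> w; exact: volc.
- have [_ _ gi] := g0_L1; have := flln gi; rewrite g0_int.
  rewrite (_ : (fun w t => 1 * Z t w) = (fun w => Z ^~ w))//.
  by apply/funext => w; apply/funext => t; rewrite mul1r.
- move=> k e F e0 k0 Fk.
  exact: (functional_occupation_measurable phi_flow a_gt0 T0 e0 g0_L1 k0 Fk).
- move=> k F k0 Fk.
  have := functional_Z_measurable Z_measurable Z_increasing T0 1 k0 Fk.
  rewrite (_ : (fun w => _) = (fun w => F (Z ^~ w)))//.
  by apply/funext => w; congr F; apply/funext => t; rewrite mul1r.
- by move=> n; rewrite !mulr_ge0// ltW.
- by move=> n y yc; apply: volc; exact: riemann_path_cont.
- by move=> n y z c c0 yc zc yz; exact: limit_map_lip.
- move=> w c c0; have cG : 0 < c / Gw by rewrite divr_gt0.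
  have := stieltjes_riemann_path_near T0 LK0 mean_path_cont mean_path_dist (Z_increasing w) cG.
  apply: filterS => n Hn; rewrite -(divfK (lt0r_neq0 Gw0) c).
  apply: volterra_sol_lip => //; first exact: ltW.
    by apply: riemann_path_cont => //; exact: (Z_cont Z_increasing).
  by move=> t tT; rewrite distrC; exact: Hn.
- exact: error_limit_map_whp.
Qed.

End averaging.

(** * Convergence of the normalized error *)
Theorem theorem4p2 (R : realType) (d : nat)
  (dM : measure_display) (M : measurableType dM)
  (nu : {sigma_finite_measure set M -> \bar R})
  (phi : R -> M -> M)
  (nu_infinite : nu [set: M] = +oo%E)
  (phi_flow : measurable_flow phi)
  (phi_nu : flow_preserves nu phi)
  (phi_conservative : conservative_flow nu phi)
  (phi_ergodic : ergodic_flow nu phi)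
  (a : R -> R) (a_gt0 : forall e, 0 < e -> 0 < a e)
  (dO : measure_display) (Omega : measurableType dO) (Q : probability Omega R)
  (Z : R -> Omega -> R)
  (Z_measurable : forall t, 0 <= t -> measurable_fun [set: Omega] (Z t))
  (Z_increasing : forall w, increasing_path (Z ^~ w))
  (flln : forall (T : R) (g : M -> R), 0 < T ->
     nu.-integrable [set: M] (EFin \o g) ->
     strong_cvg_in_distribution_C T nu
       (fun e w t => a e * \int[lebesgue_measure]_(s in `[0, t / e]) g (phi s w))
       Q (fun w t => (\int[nu]_w' g w') * Z t w))
  (f : 'rV[R]_d -> M -> 'rV[R]_d) (fbar : 'rV[R]_d -> 'rV[R]_d)
  (f_measurable : measurable_fun [set: borelRV R d * M]
     (fun p => f p.1 p.2 : borelRV R d))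
  (fbar_measurable : measurable_fun [set: borelRV R d]
     (fbar : borelRV R d -> borelRV R d))
  (f_bounded : exists K, forall x w, `|f x w| <= K)
  (fbar_bounded : exists K, forall x, `|fbar x| <= K)
  (f_lipschitz : exists K, forall w, lipschitz_with K (f ^~ w))
  (fbar_lipschitz : exists K, lipschitz_with K fbar)
  (f_integrable : forall x i,
     nu.-integrable [set: M] (EFin \o (fun w => f x w ord0 i)))
  (f_twice_diff : exists K, forall w, twice_diff_bounded K (f ^~ w))
  (fbar_twice_diff : exists K, twice_diff_bounded K fbar)
  (lip_f_integrable :
     nu.-integrable [set: M] (fun w => lip_const (f ^~ w)))
  (lip_Df_integrable :
     nu.-integrable [set: M] (fun w => lip_const (jacobian (f ^~ w))))
  (W : 'rV[R]_d -> R -> 'rV[R]_d) (X : R -> 'rV[R]_d -> M -> R -> 'rV[R]_d)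
  (W_sol : forall x, solves_autonomous fbar x (W x))
  (X_sol : forall e x w, 0 < e ->
     solves_caratheodory (fun t y => f y (phi (t / e) w) + fbar y) x (X e x w)) :
  forall x : 'rV[R]_d,
  let h y := mxint nu [set: M] (f y) in
  let V w := stieltjes_int (Z ^~ w) (fun s => h (W x s)) in
  let Df s := 'J fbar (W x s) in
  let Y w t := V w t + mxint lebesgue_measure `[0, t]
                 (fun s => V w s *m Df s *m ordered_expmx Df s t) in
  forall T : R, 0 < T ->
    strong_cvg_in_distribution_C T nu
      (fun e w t => (a e / e) *: (X e x w t - W x t)) Q Y.
Proof.
move=> x h V Df Y T T0 P Pnu.
have [Kf f_b] := f_bounded; have [Kb fbar_b] := fbar_bounded.
have [Lf f_l] := f_lipschitz; have [Lb fbar_l] := fbar_lipschitz.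
have [Kj fbar_d] := fbar_twice_diff.
have fbar_l' : lipschitz_with `|Lb| fbar.
  by move=> y z; rewrite (le_trans (fbar_l y z))// ler_wpM2r// ler_norm.
have [g0 [g0_L1 _ _ g0_int]] := normalized_indicator nu_infinite (ltr01 : 0 < 1 :> R).
exact: (@error_cvg_in_distribution R d dM M dO Omega nu phi a Q Z nu_infinite
  phi_flow a_gt0 Z_measurable Z_increasing T P T0 (fun g gi => @flln T g T0 gi P Pnu)
  f fbar Kf Lf Kb `|Lb| Kj f_measurable f_b fbar_b f_l (normr_ge0 _) fbar_l'
  f_integrable fbar_d lip_f_integrable x (W x) (fun e => X e x) (W_sol x)
  (fun e w e0 => X_sol e x w e0) g0 g0_L1 g0_int).
Qed.
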